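(* (i) Let $H$ be a Hilbert space and let $S$ be a sub-semigroup of the unit ball $\mathcal B(H)_{\|\cdot\|\le 1}$ which is compact in the relative weak$^*$-topology (i.e. $S\in\mathsf{CWCH}$) or compact in the relative strong$^*$-topology (i.e. $S\in\mathsf{CSCH}$), with the corresponding topology, and suppose $0\notin S$. Then, with $\Phi_S$, $F(H)$, $F$ as in the context and with $V_S:=V_F\in C(S)^{**}\overline\otimes\mathcal B(F(H))$ and $H_S:=F(H)$, the quadruple $(C(S),\Phi_S,V_S,H_S)$ is a $C^*$-Eberlein algebra. (ii) Conversely, let $\mathbb S=(A,\Phi,V,H)$ be a $C^*$-Eberlein algebra with $A$ unital and commutative. Then there is a weak$^*$-compact sub-semigroup $S\subseteq\mathcal B(H)_{\|\cdot\|\le1}$ with $0\notin S$ (where $S$ carries the relative weak$^*$-topology) and a $*$-isomorphism $A\cong C(S)$ under which $\Phi$ corresponds to $\Phi_S$ and $V$ corresponds to $V_S:=V_\pi$, where $\pi:S\to\mathcal B(H)$ is the inclusion. (iii) Furthermore, let $K$ be a Hilbert space, let $S\subseteq\mathcal B(K)_{\|\cdot\|\le 1}$ be a weak$^*$-compact sub-semigroup with $0\notin S$, carrying the relative weak$^*$-topology, and let $V_S=V_\pi\in C(S)^{**}\overline\otimes\mathcal B(K)$ where $\pi:S\to\mathcal B(K)$ is the inclusion. Then $V_S\in M(C(S)\otimes\mathcal B_0(K))$ if and only if the topology of $S$ coincides with the relative strong$^*$-topology from $\mathcal B(K)$ (i.e. $S\in\mathsf{SCH}$).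
   Context: For a $C^*$-algebra $A$, $A^{**}$ is its bidual von Neumann algebra, $\otimes$ is the minimal $C^*$-tensor product, $\overline\otimes$ the von Neumann algebra tensor product, $M(\cdot)$ the multiplier algebra, $\mathcal B_0(H)$ the compact operators. We identify $A^{**}\overline\otimes\mathcal B(H)$ with the dual of the operator space projective tensor product $A^*\widehat\otimes\mathcal B(H)_*$, and regard $M(A\otimes\mathcal B_0(H))$ as a subalgebra of $A^{**}\overline\otimes\mathcal B(H)$. For $V\in A^{**}\overline\otimes\mathcal B(H)$, $\mu\in A^*$ and $\omega\in\mathcal B(H)_*$ write $(\mu\otimes\mathrm{id})(V)\in\mathcal B(H)$, $(\mathrm{id}\otimes\omega)(V)\in A^{**}$ for the slices. A $C^*$-Eberlein algebra is a quadruple $(A,\Phi,V,H)$ where: (1) $A$ is a $C^*$-algebra, $\Phi:A\to A^{**}\overline\otimes A^{**}$ is a unital $*$-homomorphism (if $A$ is non-unital, this means the normal extension $A^{**}\to A^{**}\overline\otimes A^{**}$ is unital), $H$ is a Hilbert space and $V\in A^{**}\overline\otimes\mathcal B(H)$ is a contraction; (2) $A_V:=\{(\mathrm{id}\otimes\omega)(V):\omega\in\mathcal B(H)_*\}$ is a subset of $A\subseteq A^{**}$ and is norm dense in $A$; (3) the bilinear product on $A^*$ given by $\langle\mu\star\nu,a\rangle=\langle\Phi(a),\mu\otimes\nu\rangle$ is associative; (4) the map $A^*\to\mathcal B(H)$, $\mu\mapsto(\mu\otimes\mathrm{id})(V)$ is a homomorphism for $\star$. Let $S$ be a compact Hausdorff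 semitopological semigroup (product separately continuous), and let $M(S)=C(S)^*$. The map $\Phi_S:C(S)\to C(S)^{**}\overline\otimes C(S)^{**}=(M(S)\widehat\otimes M(S))^*$ is defined by $\langle\Phi_S(f),\mu\otimes\lambda\rangle=\int_S\int_S f(st)\,d\mu(s)\,d\lambda(t)$. If $\pi:S\to\mathcal B(K)_{\|\cdot\|\le1}$ is a weak$^*$-continuous semigroup homomorphism, define $V_\pi\in C(S)^{**}\overline\otimes\mathcal B(K)$ by $\langle V_\pi,\mu\otimes\omega\rangle=\int_S\langle\pi(s),\omega\rangle\,d\mu(s)$ for $\mu\in M(S),\omega\in\mathcal B(K)_*$. For a Hilbert space $H$ with conjugate space $\overline H$ and $x\in\mathcal B(H)$, let $\overline x\in\mathcal B(\overline H)$ be $\overline x(\overline\xi)=\overline{x\xi}$. Put $F(H)=\bigoplus_{m,n\ge0,\,m+n\ge1}H^{\otimes m}\otimes\overline H^{\otimes n}$ and $F(x)=\bigoplus_{m,n\geq 0,\,m+n\geq 1}x^{\otimes m}\otimes\overline x^{\otimes n}\in\mathcal B(F(H))$ for $\|x\|\le1$; for $S\subseteq \mathcal B(H)_{\|\cdot\|\le1}$, $F$ restricted to $S$ is a continuous semigroup homomorphism $S\to\mathcal B(F(H))_{\|\cdot\|\le 1}$. *)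

(* Defs.v *)
From HB Require Import structures.
From mathcomp Require Import all_boot all_order all_algebra.
From mathcomp Require Import complex ring lra.
From mathcomp Require Import all_classical all_reals all_analysis.
Set Implicit Arguments.
Unset Strict Implicit.
Unset Printing Implicit Defensive.
Import Order.TTheory GRing.Theory Num.Def Num.Theory.
Import numFieldNormedType.Exports.
Local Open Scope classical_set_scope.
Local Open Scope ring_scope.

Record cstar_algebra (R : realType) := CstarAlgebra {
  cstar_car :> completeNormedModType R[i];
  cmul : cstar_car -> cstar_car -> cstar_car;
  cstar : cstar_car -> cstar_car;
  cmulA : forall a b c, cmul a (cmul b c) = cmul (cmul a b) c;
  cmul_linl : forall k a b c, cmul (k *: a + b) c = k *: cmul a c + cmul b c;
  cmul_linr : forall k a b c, cmul c (k *: a + b) = k *: cmul c a + cmul c b;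
  cstar_antilin : forall (k : R[i]) a b,
    cstar (k *: a + b) = k^* *: cstar a + cstar b;
  cstarM : forall a b, cstar (cmul a b) = cmul (cstar b) (cstar a);
  cstarK : forall a, cstar (cstar a) = a;
  cnormM : forall a b, `|cmul a b| <= `|a| * `|b|;
  cnorm_cstar : forall a, `|cmul (cstar a) a| = `|a| ^+ 2
}.

Section Cb.
Variables (R : realType) (X : topologicalType).
Local Notation C := R[i]^o.

Definition cb : {pred X -> C} :=
  fun f => `[< continuous f /\ exists M : C, forall x, `|f x| <= M >].

Lemma cbP (f : X -> C) :
  reflect (continuous f /\ exists M : C, forall x, `|f x| <= M) (f \in cb).
Proof. exact: asboolP. Qed.

Lemma cb_submod : submod_closed cb.
Proof.
split=> [|k f g /cbP[cf [M fM]] /cbP[cg [N gN]]]; apply/cbP; split.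
- exact: cst_continuous.
- by exists 0 => x; rewrite normr0.
- by move=> x; apply: cvgD; [apply: cvgZl_tmp; exact: cf|exact: cg].
- exists (`|k| * M + N) => x; rewrite (le_trans (ler_normD _ _))//.
  by rewrite lerD// normrM ler_wpM2l.
Qed.
HB.instance Definition _ := GRing.isSubmodClosed.Build C (X -> C) cb cb_submod.

Record cbfun := CbFun { cbfun_val :> X -> C ; cbfun_cb : cbfun_val \in cb }.
HB.instance Definition _ := [isSub for cbfun_val].
HB.instance Definition _ := [Choice of cbfun by <:].
HB.instance Definition _ := [SubChoice_isSubLmodule of cbfun by <:].

Definition cb_norm (f : cbfun) : R[i] :=
  (sup [set complex.Re `|f x| | x in [set: X]])%:C%C.

Lemma cbfun_inj (f g : cbfun) : (forall x, f x = g x) -> f = g.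
Proof. by move=> fg; apply/val_inj/funext. Qed.

Lemma cb_norm_ge (f : cbfun) x : `|f x| <= cb_norm f.
Proof.
have [_ [M fM]] := cbP _ (cbfun_cb f).
rewrite -[leLHS]RRe_real ?normr_real// /cb_norm lecR.
apply: ub_le_sup; last by exists x.
exists (complex.Re M) => _ [y _ <-].
by have := fM y; rewrite lecE => /andP[].
Qed.

Lemma cb_norm_le (f : cbfun) (M : C) :
  0 <= M -> (forall x, `|f x| <= M) -> cb_norm f <= M.
Proof.
move=> M0 fM; rewrite -[leRHS]RRe_real ?ger0_real// /cb_norm lecR.
have M0' : 0 <= complex.Re M by move: M0; rewrite lecE => /andP[].
have [->|/set0P ne0] := eqVneq [set complex.Re `|f x| | x in [set: X]] set0.
  by rewrite sup0.
apply: ge_sup => // _ [y _ <-].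
by have := fM y; rewrite lecE => /andP[].
Qed.

Lemma cb_norm_ge0 (f : cbfun) : 0 <= cb_norm f.
Proof.
rewrite /cb_norm lecR.
have [->|/set0P[_ [x _ _]]] :=
  eqVneq [set complex.Re `|f x| | x in [set: X]] set0; first by rewrite sup0.
rewrite -lecR; apply: le_trans (cb_norm_ge f x) => //.
exact: normr_ge0.
Qed.

Lemma cb_norm_triangle (f g : cbfun) : cb_norm (f + g) <= cb_norm f + cb_norm g.
Proof.
apply: cb_norm_le => [|x]; first by rewrite addr_ge0 ?cb_norm_ge0.
by rewrite (le_trans (ler_normD _ _))// lerD// cb_norm_ge.
Qed.

Lemma cb_normZ (k : R[i]) (f : cbfun) : cb_norm (k *: f) = `|k| * cb_norm f.
Proof.
apply/eqP; rewrite eq_le; apply/andP; split.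
  apply: cb_norm_le => [|x]; first by rewrite mulr_ge0 ?cb_norm_ge0.
  by rewrite [X in `|X|]/= normrM ler_wpM2l// cb_norm_ge.
have [->|k0] := eqVneq k 0; first by rewrite normr0 mul0r cb_norm_ge0.
rewrite -ler_pdivlMl ?normr_gt0//; apply: cb_norm_le => [|x].
  by rewrite mulr_ge0 ?invr_ge0 ?cb_norm_ge0.
rewrite ler_pdivlMl ?normr_gt0// -normrM.
exact: (cb_norm_ge (k *: f) x).
Qed.

Lemma cb_norm_eq0 (f : cbfun) : cb_norm f = 0 -> f = 0.
Proof.
move=> f0; apply: cbfun_inj => x; apply/eqP.
by rewrite -normr_le0 -f0 cb_norm_ge.
Qed.

HB.instance Definition _ :=
  Lmodule_isNormed.Build R[i] cbfun cb_norm_triangle cb_normZ cb_norm_eq0.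

Lemma cb_normE (f : cbfun) : `|f| = cb_norm f. Proof. by []. Qed.
End Cb.

Lemma normci (R : rcfType) : `|'i%C : R[i]| = 1.
Proof. by rewrite normc_def/= expr0n expr1n add0r sqrtr1. Qed.

Lemma cplx_complete (R : realType) (F : set_system R[i]^o) :
  ProperFilter F -> cauchy F -> cvg F.
Proof.
move=> FF /cauchyP Fc.
have small (h : R[i] -> R) : (forall x y, (`|h x - h y|)%:C%C <= `|x - y|) ->
    cvg (h @ F).
  move=> hl; apply/cauchy_cvgP/cauchyP => e e0.
  have [|x Fx] := Fc (e%:C%C); first by rewrite ltcR.
  exists (h x); move: Fx; rewrite -!ball_normE /=; apply: filterS => y /= xy.
  by rewrite -ltcR (le_lt_trans (hl x y)).
have cRe : cvg (@complex.Re R @ F).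
  by apply: small => x y; rewrite -raddfB/= normc_ge_Re.
have cIm : cvg (@complex.Im R @ F).
  apply: small => x y; rewrite -raddfB/= -normrN -ReiNIm.
  by rewrite (le_trans (normc_ge_Re _))// normrM normci mulr1.
pose a := lim (@complex.Re R @ F); pose b := lim (@complex.Im R @ F).
apply/cvg_ex; exists (a +i* b)%C; apply/cvgrPdist_lt => e e0.
have eE : e = (complex.Re e)%:C%C by rewrite RRe_real// gtr0_real.
have e2 : 0 < complex.Re e / 2 by rewrite divr_gt0// -ltcR -eE.
have /cvgrPdist_lt/(_ _ e2) Ha : @complex.Re R @ F --> a by [].
have /cvgrPdist_lt/(_ _ e2) Hb : @complex.Im R @ F --> b by [].
near=> z.
have -> : (a +i* b)%C - z =
    (a - complex.Re z)%:C%C + 'i%C * (b - complex.Im z)%:C%C.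
  by rewrite [LHS]complexE !raddfB.
rewrite (le_lt_trans (ler_normD _ _))// normrM normci mul1r !normc_def/=.
rewrite !expr0n/= !addr0 !sqrtr_sqr -rmorphD/= eE ltcR.
rewrite [ltRHS]splitr ltrD//; by near: z.
Unshelve. all: by end_near. Qed.

Section CbAlgebra.
Variables (R : realType) (X : topologicalType).
Local Notation C := R[i]^o.
Local Notation cbfun := (cbfun R X).

Lemma cbfun_complete (F : set_system cbfun) :
  ProperFilter F -> cauchy F -> cvg F.
Proof.
move=> FF /cauchyP Fc.
have Fx x : cvg ((fun f : cbfun => f x : C) @ F).
  apply: cplx_complete; apply/cauchyP => e e0.
  have [f Ff] := Fc e e0.
  exists (f x); move: Ff; rewrite -!ball_normE /=; apply: filterS => g /= fg.
  exact: le_lt_trans (cb_norm_ge (f - g) x) fg.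
pose L (x : X) : C := lim ((fun f : cbfun => f x : C) @ F).
have close (e : C) : 0 < e ->
    \forall f \near F, forall x, `|L x - cbfun_val f x| <= e.
  move=> e0; have e4 : 0 < e / 2 / 2 by rewrite !divr_gt0.
  have [f Ff] := Fc _ e4; rewrite -ball_normE in Ff.
  have fg x g : `|f - g| < e / 2 / 2 -> `|f x - g x| < e / 2 / 2.
    exact: le_lt_trans (cb_norm_ge (f - g) x).
  have fL x : `|L x - f x| <= e / 2.
    have /cvgrPdist_lt/(_ _ e4) Lx :
      (fun f : cbfun => f x : C) @ F --> L x by exact: Fx.
    near F => g.
    rewrite -(subrKA (g x)) (le_trans (ler_normD _ _))//.
    rewrite [leRHS]splitr lerD// ltW//; first by near: g.
    by rewrite distrC; apply: fg; near: g.
  near=> g => x.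
  rewrite -(subrKA (f x)) (le_trans (ler_normD _ _))// [e]splitr lerD//.
  rewrite ltW// (lt_le_trans (y := e / 2 / 2))//.
    by apply: fg; near: g.
  by rewrite ler_piMr ?invf_le1 ?ler1n// ltW// divr_gt0.
have LC : L \in @cb R X.
  apply/cbP; split.
    move=> x; apply/cvgrPdist_le => e e0.
    have e4 : 0 < e / 2 / 2 by rewrite !divr_gt0.
    have [f fL] := filter_ex (close _ e4).
    have [cf _] := cbP _ (cbfun_cb f).
    have e2 : 0 < e / 2 by rewrite divr_gt0.
    have /cvgrPdist_lt/(_ _ e2) fx := cf x.
    near=> y.
    have -> : L x - L y = L x - f x + (f x - f y) - (L y - f y).
      by rewrite opprB !subrKA.
    have -> : e = e / 2 / 2 + e / 2 + e / 2 / 2 by rewrite addrAC -!splitr.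
    rewrite (le_trans (ler_normB _ _))// lerD//.
    rewrite (le_trans (ler_normD _ _))// lerD//.
    by rewrite ltW//; near: y; exact: fx.
  have [f fL] := filter_ex (close 1 ltr01).
  exists (1 + `|f|) => x; rewrite -[L x](subrK (f x)).
  by rewrite (le_trans (ler_normD _ _))// lerD// cb_norm_ge.
apply/cvg_ex; exists (CbFun LC); apply/cvgrPdist_le => e e0.
near=> f; rewrite cb_normE; apply: cb_norm_le; first exact: ltW.
by near: f; exact: close.
Unshelve. all: by end_near. Qed.
HB.instance Definition _ := Uniform_isComplete.Build cbfun cbfun_complete.

Lemma cb_mul (f g : cbfun) : (fun x => f x * g x : C) \in @cb R X.
Proof.
have [[cf [M fM]] [cg [N gN]]] := (cbP _ (cbfun_cb f), cbP _ (cbfun_cb g)).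
apply/cbP; split=> [x|]; first by apply: cvgM; [exact: cf|exact: cg].
by exists (M * N) => x; rewrite normrM ler_pM.
Qed.

Lemma cb_conj (f : cbfun) : (fun x => (f x)^* : C) \in @cb R X.
Proof.
have [cf [M fM]] := cbP _ (cbfun_cb f).
apply/cbP; split=> [x|]; last by exists M => x; rewrite norm_conjC.
apply/cvgrPdist_lt => e e0; have /cvgrPdist_lt/(_ _ e0) := cf x.
by apply: filterS => y; rewrite -rmorphB norm_conjC.
Qed.

Let mul f g := CbFun (cb_mul f g).
Let star f := CbFun (cb_conj f).

Lemma cb_normM f g : `|mul f g| <= `|f| * `|g|.
Proof.
apply: cb_norm_le => [|x]; first by rewrite mulr_ge0 ?cb_norm_ge0.
by rewrite /= normrM ler_pM ?cb_norm_ge.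
Qed.

Lemma cb_norm_star f : `|mul (star f) f| = `|f| ^+ 2.
Proof.
have starf : `|star f| <= `|f|.
  apply: cb_norm_le => [|x]; first exact: cb_norm_ge0.
  by rewrite /= norm_conjC cb_norm_ge.
apply/eqP; rewrite eq_le (le_trans (cb_normM _ _))/=; last first.
  by rewrite expr2 ler_wpM2r.
rewrite -[leRHS]sqrtCK ler_pXn2r ?nnegrE ?sqrtC_ge0//.
apply: cb_norm_le => [|x]; first by rewrite sqrtC_ge0.
rewrite -(@ler_pXn2r _ 2) ?nnegrE ?sqrtC_ge0// sqrtCK.
rewrite (le_trans _ (cb_norm_ge (mul (star f) f) x))//.
by rewrite /= normrM norm_conjC expr2.
Qed.

(* The algebra of bounded continuous functions with the supremum norm; for *)
(* compact [X] it is $C(X)$, every continuous function being bounded.      *)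
Definition cb_algebra : cstar_algebra R.
Proof.
apply: (@CstarAlgebra R cbfun mul star).
- by move=> a b c; apply: cbfun_inj => x; rewrite /= mulrA.
- by move=> k a b c; apply: cbfun_inj => x; rewrite /= mulrDl;
    congr (_ + _); exact: esym (mulrA _ _ _).
- by move=> k a b c; apply: cbfun_inj => x; rewrite /= mulrDr;
    congr (_ + _); exact: mulrCA.
- by move=> k a b; apply: cbfun_inj => x; rewrite /= rmorphD;
    congr (_ + _); exact: rmorphM.
- by move=> a b; apply: cbfun_inj => x; rewrite /= rmorphM mulrC.
- by move=> a; apply: cbfun_inj => x; rewrite /= conjCK.
- exact: cb_normM.
- exact: cb_norm_star.
Defined.
End CbAlgebra.

Record blin (R : realType) (E F : normedModType R[i]) := BLin {
  blin_fun :> {linear E -> F};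
  blin_bounded : exists M : R[i], forall x, `|blin_fun x| <= M * `|x|
}.

Section BLin.
Variable R : realType.
Implicit Types E F G : normedModType R[i].

HB.instance Definition _ E F := gen_eqMixin (blin E F).
HB.instance Definition _ E F := gen_choiceMixin (blin E F).

Lemma blin_zero_bounded E F : exists M : R[i], forall x,
  `|(\0 : {linear E -> F}) x| <= M * `|x|.
Proof. by exists 0 => x; rewrite normr0 mul0r. Qed.
Definition blin_zero E F := BLin (blin_zero_bounded E F).
HB.instance Definition _ E F := isPointed.Build (blin E F) (blin_zero E F).

Lemma blin_id_bounded E : exists M : R[i], forall x,
  `|(idfun : {linear E -> E}) x| <= M * `|x|.
Proof. by exists 1 => x; rewrite mul1r. Qed.
Definition blin_id E := BLin (blin_id_bounded E).

Lemma blin_comp_bounded E F G (y : blin F G) (x : blin E F) :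
  exists M : R[i], forall u, `|(y \o x : {linear E -> G}) u| <= M * `|u|.
Proof.
have [[M yM] [N xN]] := (blin_bounded y, blin_bounded x).
exists (`|M| * N) => u; apply: (le_trans (y := `|M| * `|x u|)); last first.
  by rewrite -mulrA ler_wpM2l.
rewrite /=; have [->|xu0] := eqVneq (x u) 0.
  by rewrite raddf0 !normr0 mulr0.
have xu : 0 < `|x u| by rewrite normr_gt0.
rewrite (le_trans (yM _))// ler_wpM2r// real_ler_norm// ger0_real//.
by rewrite -(pmulr_lge0 _ xu) (le_trans _ (yM (x u))).
Qed.
Definition blin_comp E F G (y : blin F G) (x : blin E F) :=
  BLin (blin_comp_bounded y x).

End BLin.

Definition dual (R : realType) (E : normedModType R[i]) := blin E R[i]^o.

Definition lin_span (K : numFieldType) (E : lmodType K) (P : set E) : set E :=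
  [set x | exists n (c : 'I_n -> K) (p : 'I_n -> E),
     (forall i, P (p i)) /\ x = \sum_i c i *: p i].

(* [dot] is linear in its first argument and conjugate-linear in the second. *)
Record hilbert (R : realType) := Hilbert {
  hilbert_car :> completeNormedModType R[i];
  dot : {dot hilbert_car for (conjC : R[i] -> R[i])};
  dot_norm : forall u, `|u| ^+ 2 = dot u u
}.
Arguments dot {R _}.

Section Operators.
Variable R : realType.
Local Notation C := R[i]^o.
Implicit Types H K : hilbert R.

Definition bop H := blin H H.

Definition contractive H (x : bop H) := forall u, `|x u| <= `|u|.

Definition is_adjoint H (x y : bop H) := forall u v, dot (x u) v = dot u (y v).

Definition adjoint H (x : bop H) : bop H := get [set y | is_adjoint x y].

(* $\mathcal B(H)_*$: the functionals $x\mapsto\sum_n\langle xh_n,k_n\rangle$ *)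
(* with $(h_n)$ and $(k_n)$ square-summable.                                 *)
Record predual H := Predual {
  predual_fun :> bop H -> C;
  predual_normal : exists h k : nat -> H,
    [/\ cvgn (series (fun n => `|h n| ^+ 2 : C)),
        cvgn (series (fun n => `|k n| ^+ 2 : C)) &
        forall x : bop H,
          series (fun n => dot (x (h n)) (k n) : C) @ \oo --> predual_fun x]
}.

(* Both topologies on $\mathcal B(H)$ are initial: weak* for all $\omega(x)$, *)
(* strong* for all $xu$ and $x^*u$ with the norm topology of [H].             *)
Variant op_topology := weak_star | strong_star.

Definition op_target (tau : op_topology) H : topologicalType :=
  match tau with
  | weak_star => {ptws predual H -> C}
  | strong_star => {ptws H -> (H * H)%type}
  end.

Definition op_embed tau H : bop H -> op_target tau H :=
  match tau with
  | weak_star => fun x => (fun w : predual H => w x)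
  | strong_star => fun x => (fun u : H => (x u, adjoint x u))
  end.

Definition bop_top tau H : topologicalType :=
  initial_topology (@op_embed tau H).

Definition subsemigroup H (S : set (bop H)) :=
  forall x y, S x -> S y -> S (blin_comp x y).

Definition sub_top tau H (S : set (bop H)) : topologicalType :=
  set_type (S : set (bop_top tau H)).

Definition sub_val tau H (S : set (bop H)) (s : sub_top tau S) : bop H :=
  \val s.

Definition sub_mul tau H (S : set (bop H)) (sgS : subsemigroup S)
    (s t : sub_top tau S) : sub_top tau S :=
  exist _ (blin_comp (sub_val s) (sub_val t))
    (mem_set (sgS _ _ (set_mem (valP s)) (set_mem (valP t)))).

Definition commutant H (P : set (bop H)) : set (bop H) :=
  [set y | forall x, P x -> blin_comp x y = blin_comp y x].

Definition bicommutant H (P : set (bop H)) := commutant (commutant P).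

(* A realization of the Hilbert space tensor product of [K] and [H]; it is   *)
(* unique up to a unique unitary, and [tens] is automatically bilinear.      *)
Record htensor K H := HTensor {
  htensor_car :> hilbert R;
  tens : K -> H -> htensor_car;
  tens_dot : forall u v h k, dot (tens u h) (tens v k) = dot u v * dot h k;
  tens_total : dense (lin_span [set z | exists u h, z = tens u h])
}.
Arguments tens {K H _}.

Definition is_tens_op K H (T : htensor K H) (x : bop K) (y : bop H)
  (t : bop T) := forall u h, t (tens u h) = tens (x u) (y h).

Definition vn_tensor K H (T : htensor K H) (M : set (bop K))
    (N : set (bop H)) : set (bop T) :=
  bicommutant [set t | exists x y, [/\ M x, N y & is_tens_op x y t]].

(* A realization of $F(H)$; [fock_emb m n xi eta] is the vector              *)
(* $\xi_0\otimes\cdots\otimes\xi_{m-1}\otimes                                *)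
(*  \overline{\eta_0}\otimes\cdots\otimes\overline{\eta_{n-1}}$, for m + n > 0.   *)
Record fock H := Fock {
  fock_car :> hilbert R;
  fock_emb : forall m n, ('I_m -> H) -> ('I_n -> H) -> fock_car;
  fock_dot : forall m n (xi xi' : 'I_m -> H) (eta eta' : 'I_n -> H),
    (0 < m + n)%N ->
    dot (fock_emb xi eta) (fock_emb xi' eta') =
      \prod_i dot (xi i) (xi' i) * \prod_j (dot (eta j) (eta' j))^*;
  fock_orth : forall m n m' n' (xi : 'I_m -> H) (eta : 'I_n -> H)
      (xi' : 'I_m' -> H) (eta' : 'I_n' -> H),
    (0 < m + n)%N -> (0 < m' + n')%N -> (m, n) <> (m', n') ->
    dot (fock_emb xi eta) (fock_emb xi' eta') = 0;
  fock_total : dense (lin_span [set z | exists m n (xi : 'I_m -> H)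
    (eta : 'I_n -> H), (0 < m + n)%N /\ z = fock_emb xi eta])
}.

Definition fock_op H (F : fock H) (x : bop H) : bop F :=
  get [set y : bop F | forall m n (xi : 'I_m -> H) (eta : 'I_n -> H),
    (0 < m + n)%N ->
    y (fock_emb F xi eta) = fock_emb F (x \o xi) (x \o eta)].

Definition compact_op H (k : bop H) :=
  compact (closure (k @` [set u : H | `|u| <= 1])).

(* $(\omega_{u,v}\otimes\mathrm{id})(V)$ for the vector functional             *)
(* $\omega_{u,v}=\langle\cdot\,u,v\rangle$.                                   *)
Definition vec_slice K H (T : htensor K H) (V : bop T) (u v : K) : bop H :=
  get [set W : bop H | forall h k,
    dot (W h) k = dot (V (tens u h)) (tens v k)].

Section Algebra.
Variable A : cstar_algebra R.

Definition is_unit (e : A) := forall a, cmul e a = a /\ cmul a e = a.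

Definition star_hom H (f : A -> bop H) :=
  [/\ forall (k : R[i]) a b u, f (k *: a + b) u = k *: f a u + f b u,
      forall a b, f (cmul a b) = blin_comp (f a) (f b) &
      forall a, is_adjoint (f a) (f (cstar a))].

(* A nondegenerate representation in which every functional of $A^*$ is a    *)
(* vector functional, such as the universal representation. For every such   *)
(* representation the canonical map from $A^{**}$ onto the generated von     *)
(* Neumann algebra is a normal isomorphism.                                  *)
Record univ_rep := UnivRep {
  univ_car :> hilbert R;
  rep : A -> bop univ_car;
  rep_star_hom : star_hom rep;
  rep_nondegenerate : dense (lin_span [set z | exists a u, z = rep a u]);
  rep_vector : forall m : dual A, exists u v, forall a, m a = dot (rep a u) v
}.

Variable U : univ_rep.

Definition bidual : set (bop U) := bicommutant (range (rep U)).

(* Vectors implementing a functional; on elements of a von Neumann tensor    *)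
(* product with first factor [bidual], the slice by the vector functional    *)
(* does not depend on the vectors chosen.                                    *)
Definition vectors (m : A -> C) : U * U :=
  get [set p | forall a, m a = dot (rep U a p.1) p.2].

Section Slices.
Variables (H : hilbert R) (T : htensor U H) (V : bop T).

Definition lslice (m : A -> C) : bop H :=
  vec_slice V (vectors m).1 (vectors m).2.

Definition rslice (w : predual H) : bop U :=
  get [set Y : bop U | forall u v, dot (Y u) v = w (vec_slice V u v)].

Definition pairing (m : A -> C) (w : predual H) : C := w (lslice m).

End Slices.

Definition pairing2 (T : htensor U U) (X : bop T) (m l : A -> C) : C :=
  dot (X (tens (vectors m).1 (vectors l).1))
      (tens (vectors m).2 (vectors l).2).

Definition conv (T : htensor U U) (Phi : A -> bop T) (m l : A -> C) : A -> C :=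
  fun a => pairing2 (Phi a) m l.

(* The weak* topology of $A^{**}$ is that of $\mathcal B(U)$, restricted.      *)
Definition unital_hom (T : htensor U U) (Phi : A -> bop T) :=
  (forall e, is_unit e -> Phi e = blin_id T) /\
  (~ (exists e, is_unit e) ->
   exists Psi : bop U -> bop T,
     [/\ continuous (fun x : sub_top weak_star bidual =>
           Psi (sub_val x) : bop_top weak_star T),
         forall a, Psi (rep U a) = Phi a &
         Psi (blin_id U) = blin_id T]).

Record is_eberlein (H : hilbert R) (T2 : htensor U U) (T : htensor U H)
    (Phi : A -> bop T2) (V : bop T) : Prop := IsEberlein {
  eberlein_range : forall a, vn_tensor bidual bidual (Phi a);
  eberlein_hom : star_hom Phi;
  eberlein_unital : unital_hom Phi;
  eberlein_V : vn_tensor bidual setT V;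
  eberlein_contractive : contractive V;
  eberlein_slices : forall w, exists a, rslice V w = rep U a;
  eberlein_dense : dense [set a : A | exists w, rslice V w = rep U a];
  eberlein_assoc : forall m l k : dual A,
    conv Phi (conv Phi m l) k = conv Phi m (conv Phi l k);
  eberlein_mult : forall m l : dual A,
    lslice V (conv Phi m l) = blin_comp (lslice V m) (lslice V l)
}.

(* The minimal tensor product $A\otimes\mathcal B_0(H)$ is the norm closure of *)
(* the algebraic one in a faithful representation; its multiplier algebra is   *)
(* its idealizer in $A^{**}\overline\otimes\mathcal B(H)$.                     *)
Definition min_tensor_compact (H : hilbert R) (T : htensor U H) :
    set (bop T) :=
  [set b | forall e : R[i], 0 < e -> exists n (t : 'I_n -> bop T),
    (forall i, exists a k, compact_op k /\ is_tens_op (rep U a) k (t i)) /\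
    forall z, `|b z - \sum_i t i z| <= e * `|z|].

Definition multiplier_compact (H : hilbert R) (T : htensor U H) :
    set (bop T) :=
  [set x | vn_tensor bidual setT x /\
    forall b, min_tensor_compact b ->
      min_tensor_compact (blin_comp x b) /\
      min_tensor_compact (blin_comp b x)].

End Algebra.
Arguments bidual {A} U _.

Definition star_iso (A B : cstar_algebra R) (g : A -> B) :=
  [/\ bijective g,
      forall (k : R[i]) a b, g (k *: a + b) = k *: g a + g b,
      forall a b, g (cmul a b) = cmul (g a) (g b) &
      forall a, g (cstar a) = cstar (g a)].

(* The integral of [g] against a measure, that is, a functional on $C(X)$;   *)
(* it is zero when [g] is not bounded and continuous.                        *)
Definition sint (X : topologicalType) (m : dual (cb_algebra R X))
  (g : X -> C) : C := m (insubd (0 : cbfun R X) g).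

(* [g] is an isomorphism of [A] onto $C(X)$, along which $C(X)^{**}$ is        *)
(* realized by a representation of [A]. Elementary tensors being total in the *)
(* preduals, [Phi] and [V] are uniquely determined by these predicates.       *)
Definition is_Phi (X : topologicalType) (mul : X -> X -> X)
    (A : cstar_algebra R) (g : A -> cb_algebra R X) (U : univ_rep A)
    (T : htensor U U) (Phi : A -> bop T) :=
  forall a, vn_tensor (bidual U) (bidual U) (Phi a) /\
    forall m l : dual (cb_algebra R X),
      pairing2 (Phi a) (m \o g) (l \o g) =
        sint l (fun t => sint m (fun s => (g a : cbfun R X) (mul s t))).

Definition is_V (X : topologicalType) (A : cstar_algebra R)
    (g : A -> cb_algebra R X) (U : univ_rep A) (H : hilbert R)
    (p : X -> bop H) (T : htensor U H) (V : bop T) :=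
  vn_tensor (bidual U) setT V /\
  forall (m : dual (cb_algebra R X)) (w : predual H),
    pairing V (m \o g) w = sint m (fun s => w (p s)).

End Operators.

(* Main.v *)
Require Import Defs.
From HB Require Import structures.
From mathcomp Require Import all_boot all_order all_algebra.
From mathcomp Require Import complex ring lra.
From mathcomp Require Import all_classical all_reals all_analysis.
Set Implicit Arguments.
Unset Strict Implicit.
Unset Printing Implicit Defensive.
Import Order.TTheory GRing.Theory Num.Def Num.Theory.
Import numFieldNormedType.Exports.
Local Open Scope classical_set_scope.
Local Open Scope ring_scope.

(** Over a compact Hausdorff space a bounded weakly continuous operator field
    [p] has an integrated operator [V] with
    [<V (u (x) h), v (x) k> = <rep (<p h, k>) u, v>], obtained as a weak limit
    of the tensors [sum_j rep phi_j (x) p s_j] over partitions of unity; the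
    same limit puts [V] in the von Neumann tensor product.

    (i) [V_S] is the integrated operator of [F], and [Phi f] that of
    [s |-> rep (f (s _))].  Coefficients of [F] are dense in [C(S)] by
    Stone-Weierstrass, since [0] is not in [S] and all mixed tensor powers
    occur; on a coefficient [w o F] the convolution of [m] and [l] is
    [w (M_m M_l)] with [M_m = (m (x) id) V_S], which yields Fubini for
    separately continuous products, associativity and multiplicativity.

    (ii) Characters of [A] come from maximal cones in the ordered algebra of
    self-adjoint elements.  Whenever a character is a vector functional, it has
    an eigenvector with the same slices on [A^** (x) B(H)]; for eigenvectors
    [w] and [w'], [w (x) w'] is an eigenvector of every [Phi a], so the
    convolution of two characters is a character.  Take for [S] the set of all
    slices [(chi (x) id) V].

    (iii) If [s |-> s x] and [s |-> s^* x] are norm continuous on [S], then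
    [s |-> s k] and [s |-> k s] are norm continuous for compact [k], so the
    approximating tensors converge in norm.  Conversely, slicing
    [V (1 (x) theta_{x,x})] and [(1 (x) theta_{x,x}) V] at eigenvectors of the
    point evaluations gives the norm continuity. *)


(** * Hilbert spaces and bounded operators *)

(** A functional enters [lslice], [pairing2] and [conv] through vectors picked by [vectors], so
    every slice has to be shown to depend on the functional alone. For an integrated operator this
    is immediate, as its matrix entries only involve [a |-> <rep a u, v>]. In (ii), [V] and [Phi]
    are arbitrary elements of a bicommutant, and operators in the commutant of [rep] have to do that
    work.

    The weak limits need approximants whose norm does not grow with the size of the partition of
    unity. This forces the form [sum_j P_j Q_j P_j] with [sum_j P_j^2 = 1], where [P_j] comes from
    the square root of a function of the partition. The operators on tensor products and on [F(H)]
    themselves come from a norm estimate on finite combinations of generators, which is an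
    inequality between Gram matrices.

    In (ii) the characters must be norming: this gives the isometry of the Gelfand transform and
    also separates the points of [A] by functionals. Positivity is therefore expressed by the norm
    condition [|t - a| <= t]; its analytic input is an iteration for the square root of [1 - x], and
    the rest is ring identities together with the C*-identity. *)

Section HilbertBasics.
Variables (R : realType) (H : hilbert R).
Implicit Types (u v w : H) (c : R[i]).

Lemma dotDl u v w : dot (u + v) w = dot u w + dot v w.
Proof. exact: linearDl. Qed.
Lemma dotBl u v w : dot (u - v) w = dot u w - dot v w.
Proof. exact: linearBl. Qed.
Lemma dotDr u v w : dot u (v + w) = dot u v + dot u w.
Proof. exact: linearDr. Qed.
Lemma dotBr u v w : dot u (v - w) = dot u v - dot u w.
Proof. exact: linearBr. Qed.
Lemma dotZl c u v : dot (c *: u) v = c * dot u v.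
Proof. exact: linearZl_LR. Qed.
Lemma dotZr c u v : dot u (c *: v) = c^* * dot u v.
Proof. exact: linearZr_LR. Qed.
Lemma dot0l u : dot 0 u = 0 :> R[i].
Proof. exact: linear0l. Qed.
Lemma dot0r u : dot u 0 = 0 :> R[i].
Proof. exact: linear0r. Qed.
Lemma dotC u v : dot u v = (dot v u)^*.
Proof. by rewrite hermC mul1r. Qed.
Lemma dot_suml I r (P : pred I) (F : I -> H) v :
  dot (\sum_(i <- r | P i) F i) v = \sum_(i <- r | P i) dot (F i) v.
Proof. exact: linear_sumlz. Qed.
Lemma dot_sumr I r (P : pred I) (F : I -> H) u :
  dot u (\sum_(i <- r | P i) F i) = \sum_(i <- r | P i) dot u (F i).
Proof. exact: linear_sumr. Qed.
Lemma dot_ge0 u : 0 <= dot u u.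
Proof. exact: dnorm_ge0. Qed.

Lemma dot_ext u v : (forall w, dot u w = dot v w) -> u = v.
Proof.
move=> uv; apply/eqP; rewrite -subr_eq0 -(dnorm_eq0 dot).
by rewrite dotBl uv subrr.
Qed.

Lemma dot_extr u v : (forall w, dot w u = dot w v) -> u = v.
Proof. by move=> uv; apply: dot_ext => w; rewrite dotC uv -dotC. Qed.

Lemma cauchy_schwarz u v : `|dot u v| <= `|u| * `|v|.
Proof.
have [->|v0] := eqVneq v 0; first by rewrite dot0r !normr0 mulr0.
have vv0 : 0 < dot v v by rewrite dnorm_gt0.
rewrite -(@ler_pXn2r _ 2) ?nnegrE ?mulr_ge0// exprMn !dot_norm.
have := dot_ge0 (u - (dot u v / dot v v) *: v).
rewrite !(dotBl, dotBr, dotZl, dotZr) rmorphM/= fmorphV/= -(dotC v u) -(dotC v v).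
set d := dot v v; rewrite -/d in vv0.
rewrite (divfK (lt0r_neq0 vv0)) [dot u v / d * dot v u]mulrAC -mulrA subrr subr0.
by rewrite subr_ge0 mulrA mulrAC ler_pdivrMr// normCK -dotC mulrC.
Qed.

Lemma normr_le_dot u (M : R[i]) : 0 <= M ->
  (forall v, `|dot u v| <= M * `|v|) -> `|u| <= M.
Proof.
move=> M0 /(_ u); have [->|u0] := eqVneq u 0; first by rewrite normr0.
by rewrite -dot_norm normrX normr_id expr2 ler_pM2r// normr_gt0.
Qed.

Lemma parallelogram u v :
  `|u + v| ^+ 2 + `|u - v| ^+ 2 = 2 * (`|u| ^+ 2 + `|v| ^+ 2).
Proof. by rewrite !dot_norm !(dotBl, dotBr, dotDl, dotDr); ring. Qed.


End HilbertBasics.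

(** * Approximation and completeness in complex normed spaces *)

Section Adherence.
Variable R : realType.
Local Notation C := R[i].

Lemma natCE n : n%:R = (n%:R : R)%:C%C :> C.
Proof. by rewrite rmorph_nat. Qed.

Lemma half_double (E : lmodType C) (u : E) : 2^-1 *: (u + u) = u.
Proof.
by rewrite -mulr2n -(scaler_nat 2 u) scalerA mulVf ?scale1r// pnatr_eq0.
Qed.

Lemma gt0CP (e : C) : 0 < e -> exists2 r : R, 0 < r & e = r%:C%C.
Proof.
move=> e0; have eE : e = (complex.Re e)%:C%C by rewrite RRe_real// gtr0_real.
by exists (complex.Re e); rewrite // -ltcR -eE.
Qed.

Lemma normCP (E : normedModType C) (x : E) : exists2 r : R, 0 <= r & `|x| = r%:C%C.
Proof.
exists (complex.Re `|x|); last by rewrite RRe_real// ger0_real.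
by rewrite -lecR RRe_real ?normr_ge0// ger0_real.
Qed.

Lemma bound_gt0 (E F : normedModType C) (f : E -> F) :
  (exists M : C, forall x, `|f x| <= M * `|x|) ->
  exists2 M : C, 0 < M & forall x, `|f x| <= M * `|x|.
Proof.
move=> [M fM]; exists (`|M| + 1) => [|x]; first by rewrite ltr_wpDl.
have [x0|x0] := eqVneq `|x| 0.
  by have := fM x; rewrite x0 !mulr0.
have x1 : 0 < `|x| by rewrite lt_def x0 normr_ge0.
have M0 : 0 <= M.
  by rewrite -(pmulr_lge0 _ x1) (le_trans _ (fM x)).
by rewrite (le_trans (fM x))// ler_pM2r// (ger0_norm M0) lerDl.
Qed.

(* A hypothesis rather than a structure: [R[i]^o] carries no canonical       *)
(* instance of completeness.                                                 *)
Definition complete_space (E : normedModType C) :=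
  forall F : set_system E, ProperFilter F -> cauchy F -> cvg F.

Lemma complete_normed (E : completeNormedModType C) : complete_space E.
Proof. by move=> F FF; exact: cauchy_cvg. Qed.

(** The sets [P d] form the base of a Cauchy filter, so a limit is reached from approximate
    solutions carrying an error parameter, without choosing a sequence of them. Minimizing vectors,
    extensions by density and the surjectivity of the Gelfand transform are obtained in this way. *)
Lemma cauchy_family (E : normedModType C) (P : R -> set E) :
  complete_space E ->
  (forall d : R, 0 < d -> P d !=set0) ->
  (forall d d' : R, d <= d' -> P d `<=` P d') ->
  (forall e : C, 0 < e -> exists2 d : R, 0 < d &
     forall x y, P d x -> P d y -> `|x - y| <= e) ->
  exists k, forall e : C, 0 < e -> exists2 d : R, 0 < d &
    forall x, P d x -> `|k - x| <= e.
Proof.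
move=> cE P0 Pmono Pc.
pose F := filter_from [set d : R | 0 < d] P.
have FF : ProperFilter F.
  apply: filter_from_proper; last by move=> d; exact: P0.
  apply: filter_from_filter; first by exists 1; exact: ltr01.
  move=> d d' /= d0 d'0; exists (Num.min d d'); first by rewrite /= lt_min d0.
  move=> x Px; split.
    by apply: Pmono Px; rewrite ge_min lexx.
  by apply: Pmono Px; rewrite ge_min lexx orbT.
have Fc : cauchy F.
  apply/cauchyP => e e0.
  have [d d0 Pd] := Pc (e / 2) (divr_gt0 e0 (ltr0Sn _ _)).
  have [x Px] := P0 _ d0; exists x; exists d => // y Py.
  rewrite -ball_normE /= (le_lt_trans (Pd _ _ Px Py))//.
  by rewrite ltr_pdivrMr// ltr_pMr// ltr1n.
have /cvg_ex[k Fk] := cE F FF Fc.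
exists k => e e0.
have e2 : 0 < e / 2 by rewrite divr_gt0.
have [d d0 Pd] := Pc _ e2.
have [d' d'0] := Fk _ (nbhsx_ballx k _ e2); rewrite -ball_normE => Pd'.
exists (Num.min d d'); first by rewrite lt_min d0.
have [z Pz] : P (Num.min d d') !=set0 by apply: P0; rewrite lt_min d0.
move=> x Px; rewrite -(subrKA z) (le_trans (ler_normD _ _))// [leRHS]splitr.
rewrite lerD//.
  by rewrite ltW//; apply: Pd'; apply: Pmono Pz; rewrite ge_min lexx orbT.
by apply: Pd; [apply: Pmono Pz|apply: Pmono Px]; rewrite ge_min lexx.
Qed.

(** The norm closure, written with non-strict estimates so that it composes directly with norm
    inequalities; [denseP] links it to the topological [dense]. *)
Definition adherent (E : normedModType C) (K : set E) : set E :=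
  [set z | forall e : C, 0 < e -> exists2 x, K x & `|z - x| <= e].

Lemma sub_adherent (E : normedModType C) (K : set E) : K `<=` adherent K.
Proof. by move=> x Kx e /ltW e0; exists x; rewrite // subrr normr0. Qed.

Lemma adherentS (E : normedModType C) (K L : set E) :
  K `<=` L -> adherent K `<=` adherent L.
Proof. by move=> KL z Kz e /Kz[x /KL]; exists x. Qed.

Lemma adherentK (E : normedModType C) (K : set E) :
  adherent (adherent K) `<=` adherent K.
Proof.
move=> z Kz e e0; have e2 : 0 < e / 2 by rewrite divr_gt0.
have [y /(_ _ e2)[x Kx yx] zy] := Kz _ e2.
exists x => //; rewrite -(subrKA y) (le_trans (ler_normD _ _))// [leRHS]splitr.
exact: lerD.
Qed.

Lemma denseP (E : normedModType C) (K : set E) :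
  dense K <-> forall z, adherent K z.
Proof.
split=> [dK z e e0|aK O [z Oz] oO].
  have [||x [zx Kx]] := dK (ball z e).
  - by exists z; exact: ballxx.
  - exact: ball_open.
  by exists x => //; move: zx; rewrite -ball_normE => /ltW.
have /nbhs_ballP[e e0 zO] := open_nbhs_nbhs (conj oO Oz).
have e2 : 0 < e / 2 by rewrite divr_gt0.
have [x Kx zx] := aK z _ e2; exists x; split=> //; apply: zO.
by rewrite -ball_normE /= (le_lt_trans zx)// ltr_pdivrMr// ltr_pMr// ltr1n.
Qed.

(** A Lipschitz bound carries a norm estimate from a set to its closure. With [c = 0] this is how
    maps that agree on generators are shown to agree everywhere. *)
Lemma adherent_le (E F : normedModType C) (f : E -> F) (M c : C) (K : set E) z :
  0 <= M -> (forall x y, `|f x - f y| <= M * `|x - y|) ->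
  (forall x, K x -> `|f x| <= c) -> adherent K z -> `|f z| <= c.
Proof.
move=> M0 fM Kc Kz.
have [r r0 fr] := normCP (f z).
have c_real : c \is Num.real.
  by have [x /Kc fx _] := Kz 1 ltr01; rewrite ger0_real// (le_trans _ fx).
rewrite fr -[c]RRe_real// lecR; apply/ler_addgt0Pr => e e0.
rewrite -lecR rmorphD/= RRe_real// -fr.
have M1 : 0 < M + 1 by rewrite ltr_wpDl.
have e1 : 0 < e%:C%C / (M + 1) :> C by rewrite divr_gt0// ltcR.
have [x Kx zx] := Kz _ e1.
rewrite -[f z](subrK (f x)) addrC (le_trans (ler_normD _ _))// lerD ?Kc//.
rewrite (le_trans (fM _ _))// (@le_trans _ _ ((M + 1) * `|z - x|))//.
  by rewrite ler_wpM2r// lerDl.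
by rewrite mulrC -ler_pdivlMr.
Qed.

End Adherence.

(** * Vectors of minimal norm, orthogonal projection and the Riesz theorem *)

Section MinNorm.
Variables (R : realType) (H : hilbert R).
Local Notation C := R[i].

(** The parallelogram law makes near-minimizers close to each other; stability under midpoints is
    the form of convexity it uses. The uniqueness clause later forces a minimal vector to be fixed
    by every contraction that preserves the set. *)
Lemma min_norm (K : set H) : K !=set0 -> adherent K `<=` K ->
  (forall x y, K x -> K y -> K (2^-1 *: (x + y))) ->
  exists k, [/\ K k, forall x, K x -> `|k| <= `|x| &
    forall x, K x -> `|x| <= `|k| -> x = k].
Proof.
move=> [x0 Kx0] clK cvK.
pose N (x : H) : R := complex.Re `|x|.
have NE x : `|x| = (N x)%:C%C by rewrite RRe_real// normr_real.
have N0 x : 0 <= N x by rewrite -lecR -NE normr_ge0.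
pose D := N @` K; pose d := inf D.
have D_lb : has_lbound D by exists 0 => _ [x _ <-].
have D0 : D !=set0 by exists (N x0), x0.
have dN x : K x -> d <= N x by move=> Kx; apply: ge_inf => //; exists x.
have d0 : 0 <= d by apply: lb_le_inf => // _ [x _ <-].
have par x y : N (x + y) ^+ 2 + N (x - y) ^+ 2 = 2 * (N x ^+ 2 + N y ^+ 2).
  apply: complexI; rewrite (rmorphM (real_complex R)) !(rmorphD (real_complex R)).
  rewrite !(rmorphXn (real_complex R))/= -!NE.
  exact: parallelogram.
(* By the parallelogram law and [N (x + y) >= 2 d], the square is at most [4 (d + r)^2 - 4 d^2],
   which is the right-hand side. *)
have key x y r : K x -> K y -> N x <= d + r -> N y <= d + r -> 0 <= r ->
    N (x - y) ^+ 2 <= 4 * (r * (2 * d + r)).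
  move=> Kx Ky xr yr r0.
  have : 2 * d <= N (x + y).
    have /dN := cvK _ _ Kx Ky.
    rewrite /N normrZ normfV normr_nat -/(N _).
    rewrite [X in 2^-1 * X]NE natCE -fmorphV -rmorphM/=.
    by rewrite mulrC ler_pdivlMr// mulrC.
  have := par x y; have := N0 x; have := N0 y; nra.
have [k Hk] : exists k, forall e : C, 0 < e -> exists2 r : R, 0 < r &
    forall x, [set x | K x /\ N x <= d + r] x -> `|k - x| <= e.
  apply: cauchy_family; first exact: complete_normed.
  - move=> r r0; have [|_ [x Kx <-] xr] := @inf_adherent _ D r r0.
      by split.
    by exists x; split=> //; exact: ltW.
  - by move=> r r' rr' x [Kx xr]; split=> //; rewrite (le_trans xr)// lerD2l.
  move=> _ /gt0CP[e e0 ->].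
  (* For [r <= 1] the bound in [key] is at most [4 r (2 d + 1)], hence at most [e^2]. *)
  pose r := Num.min 1 (e ^+ 2 / (4 * (2 * d + 1))).
  have r0 : 0 < r by rewrite lt_min ltr01 divr_gt0 ?exprn_gt0// mulr_gt0//; lra.
  exists r => // x y [Kx xr] [Ky yr]; rewrite NE lecR.
  rewrite -(@ler_pXn2r _ 2) ?nnegrE ?N0 ?(ltW e0)//.
  rewrite (le_trans (key _ _ _ Kx Ky xr yr (ltW r0)))//.
  have r1 : r <= 1 by rewrite ge_min lexx.
  have re : r * (4 * (2 * d + 1)) <= e ^+ 2.
    by rewrite -ler_pdivlMr ?ge_min ?lexx ?orbT// mulr_gt0//; lra.
  by nra.
have kK : K k.
  apply: clK => e e0; have [r r0 Hr] := Hk _ e0.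
  have [|_ [x Kx <-] xr] := @inf_adherent _ D r r0; first by split.
  by exists x => //; apply: Hr; split=> //; exact: ltW.
have kd : N k <= d.
  apply/ler_addgt0Pr => e e0.
  have e2 : 0 < (e / 2)%:C%C :> C by rewrite ltcR divr_gt0.
  have [r r0 Hr] := Hk _ e2.
  have m0 : 0 < Num.min r (e / 2) by rewrite lt_min r0 divr_gt0.
  have [|_ [x Kx <-] xr] := @inf_adherent _ D _ m0; first by split.
  have : `|k - x| <= (e / 2)%:C%C.
    by apply: Hr; split=> //; rewrite (le_trans (ltW xr))// lerD2l ge_min lexx.
  have : N x <= d + e / 2 by rewrite (le_trans (ltW xr))// lerD2l ge_min lexx orbT.
  have : `|k| <= `|k - x| + `|x|.
    by rewrite -[X in `|X| <= _](subrK x) ler_normD.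
  rewrite !NE -rmorphD/= !lecR; lra.
exists k; split=> // [x /dN dx|x Kx].
  by rewrite !NE lecR (le_trans kd).
rewrite !NE lecR => xk.
have := key x k 0 Kx kK; rewrite addr0 mul0r mulr0 => /(_ (le_trans xk kd) kd (lexx _)).
move=> xk0; apply/eqP; rewrite -subr_eq0 -normr_le0 NE lecR.
by rewrite leNgt; apply/negP => xk1; have := exprn_gt0 2 xk1; rewrite ltNge xk0.
Qed.

Definition subspace_like (V : set H) :=
  V 0 /\ forall c x y, V x -> V y -> V (c *: x + y).

(** The coset [u + V] has a vector [k] of minimal norm, and [p = u - k]. Removing from [k] its
    component along some [v] in [V] stays in the coset, so minimality makes that component zero. *)
Lemma orth_proj (V : set H) : subspace_like V -> adherent V `<=` V ->
  forall u, exists2 p, V p & forall v, V v -> dot (u - p) v = 0.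
Proof.
move=> [V0 VL] clV u.
have VZ c x : V x -> V (c *: x) by move=> Vx; rewrite -[_ *: _]addr0; exact: VL.
have VD x y : V x -> V y -> V (x + y) by rewrite -{2}[x]scale1r; exact: VL.
pose K := [set x | V (u - x)].
have [|||k [Kk kmin _]] := @min_norm K.
  - by exists u; rewrite /K/= subrr.
  - move=> x Kx; apply: clV => e e0; have [y Ky xy] := Kx _ e0.
    by exists (u - y) => //; rewrite opprB addrC subrKA distrC.
  - move=> x y Kx Ky; rewrite /K/=.
    have -> : u - 2^-1 *: (x + y) = 2^-1 *: ((u - x) + (u - y)).
      by rewrite addrACA -opprD [RHS]scalerBr half_double.
    exact/VZ/VD.
exists (u - k) => // v Vv; rewrite opprB addrC subrK.
have [->|v0] := eqVneq v 0; first by rewrite dot0r.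
have vv0 : 0 < dot v v by rewrite dnorm_gt0.
have : `|k| <= `|k - (dot k v / dot v v) *: v|.
  by apply: kmin; rewrite /K/= opprB addrCA; apply: VL.
rewrite -(@ler_pXn2r _ 2) ?nnegrE// !dot_norm.
rewrite !(dotBl, dotBr, dotZl, dotZr) rmorphM/= fmorphV/= -(dotC v k) -(dotC v v).
rewrite (divfK (lt0r_neq0 vv0)) [dot k v / dot v v * dot v k]mulrAC -mulrA subrr subr0.
rewrite -subr_ge0 addrAC subrr sub0r oppr_ge0 mulrA mulrAC.
rewrite pmulr_lle0 ?invr_gt0// [dot v k]dotC mulrC -normCK.
by rewrite real_exprn_even_le0 ?normr_real//= normr_eq0 => /eqP.
Qed.

Lemma riesz (f : H -> C) : (forall c x y, f (c *: x + y) = c * f x + f y) ->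
  (exists M : C, forall x, `|f x| <= M * `|x|) ->
  exists y, forall x, f x = dot x y.
Proof.
move=> fL /(bound_gt0 (F := R[i]^o))[M M0 fM].
have f0 : f 0 = 0.
  by have := fL (-1) 0 0; rewrite scaler0 addr0 mulN1r addNr.
have fB x y : f (x - y) = f x - f y.
  by rewrite addrC -scaleN1r fL mulN1r addrC.
have [[x0 fx0]|nf] := pselect (exists x, f x != 0); last first.
  exists 0 => x; rewrite dot0r; apply/eqP/negP => /negP fx0.
  by apply: nf; exists x.
have [||p fp up] := orth_proj (V := [set x | f x = 0]) _ _ x0.
- by split=> // c x y /= fx fy; rewrite fL fx fy mulr0 addr0.
- move=> z zV /=; apply/eqP; rewrite -normr_le0.
  apply: (@adherent_le _ _ R[i]^o f M _ _ z (ltW M0) _ _ zV).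
    by move=> x y; rewrite -fB.
  by move=> x /= ->; rewrite normr0.
(* [u] spans the orthogonal complement of the kernel of [f], so [f] is the inner product with a
   multiple of [u]. *)
pose u := x0 - p.
have fu : f u = f x0 by rewrite fB fp subr0.
have u0 : u != 0 by apply: contra_neq fx0 => u0; rewrite -fu u0.
have uu0 : 0 < dot u u by rewrite dnorm_gt0.
exists ((f u / dot u u)^* *: u) => x.
rewrite dotZr conjCK.
have : dot u (x - (f x / f u) *: u) = 0.
  by apply: up; rewrite /= -scaleNr addrC fL mulNr divfK ?addNr// fu.
move/(congr1 (@conjC _)); rewrite conjC0 -dotC dotBl dotZl => /eqP.
rewrite subr_eq0 => /eqP ->; rewrite mulrACA mulVf ?gt_eqF//.
by rewrite mulr1 mulrCA divff ?mulr1// fu.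
Qed.

End MinNorm.

(** * Bounded operators obtained from forms and from generators *)

Section BoundedOperators.
Variable R : realType.
Local Notation C := R[i].

Lemma blinP (E F : normedModType C) (x y : blin E F) : x =1 y -> x = y.
Proof.
case: x y => [[f [[fa] [fz]]] fb] [[g [[ga] [gz]]] gb] /= /funext fg.
move: fa fz fb ga gz gb; rewrite {}fg => fa fz fb ga gz gb.
by rewrite (Prop_irrelevance fa ga) (Prop_irrelevance fz gz) (Prop_irrelevance fb gb).
Qed.

Lemma blinD (E F : normedModType C) (x : blin E F) u v : x (u + v) = x u + x v.
Proof. exact: raddfD. Qed.

Lemma blinB (E F : normedModType C) (x : blin E F) u v : x (u - v) = x u - x v.
Proof. exact: raddfB. Qed.

Lemma blinZ (E F : normedModType C) (x : blin E F) c u : x (c *: u) = c *: x u.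
Proof. exact: linearZ. Qed.

Lemma blin0 (E F : normedModType C) (x : blin E F) : x 0 = 0.
Proof. exact: raddf0. Qed.

Lemma blin_sum (E F : normedModType C) (x : blin E F) I r (P : pred I) (f : I -> E) :
  x (\sum_(i <- r | P i) f i) = \sum_(i <- r | P i) x (f i).
Proof. exact: raddf_sum. Qed.

Lemma blin_exists (E F : normedModType C) (f : E -> F) :
  (forall c x y, f (c *: x + y) = c *: f x + f y) ->
  (exists M : C, forall x, `|f x| <= M * `|x|) ->
  exists x : blin E F, forall u, x u = f u.
Proof.
move=> fL fM; pose fl := GRing.isLinear.Build _ _ _ _ f fL.
pose g : {linear E -> F} := HB.pack f fl.
by exists (@BLin R E F g fM).
Qed.

Lemma blin_gt0 (E F : normedModType C) (x : blin E F) :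
  exists2 M : C, 0 < M & forall u, `|x u| <= M * `|u|.
Proof. exact: bound_gt0 (blin_bounded x). Qed.

(** Riesz in the second variable gives the value at each [u]. Adjoints, both kinds of slices and the
    weak integrals [mop] are constructed from it. *)
Lemma op_of_form (H K : hilbert R) (B : H -> K -> C) (M : C) :
  (forall c u u' v, B (c *: u + u') v = c * B u v + B u' v) ->
  (forall c u v v', B u (c *: v + v') = c^* * B u v + B u v') ->
  (forall u v, `|B u v| <= M * `|u| * `|v|) -> 0 <= M ->
  exists x : blin H K, (forall u v, dot (x u) v = B u v) /\
    forall u, `|x u| <= M * `|u|.
Proof.
move=> Bl Br BM M0.
have Y u : exists y, forall v, B u v = dot y v.
  have [||y yB] := @riesz R K (fun v => (B u v)^*).
  - by move=> c v v'; rewrite Br rmorphD rmorphM/= conjCK.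
  - by exists (M * `|u|) => v; rewrite norm_conjC.
  by exists y => v; rewrite dotC -yB conjCK.
have [f fB] := choice Y.
have fM u : `|f u| <= M * `|u|.
  by apply: normr_le_dot => [|v]; rewrite ?mulr_ge0// -fB.
have [||x xf] := @blin_exists H K f.
- by move=> c u u'; apply: dot_ext => v; rewrite dotDl dotZl -!fB.
- by exists M.
by exists x; split=> u; rewrite xf// => v; rewrite fB.
Qed.

Section Extension.
Variables (E F : normedModType C) (I : Type).
Variables (e : I -> E) (f : I -> F) (M : C).

(** The generators may be linearly dependent: the estimate on finite combinations contains
    well-definedness, because a vanishing combination is sent to a vector of norm zero. What remains
    is extension by density to a complete target. *)
Lemma extend_gens : complete_space F -> 0 <= M ->
  (forall z, adherent (lin_span (range e)) z) ->
  (forall n (c : 'I_n -> C) (p : 'I_n -> I),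
     `|\sum_i c i *: f (p i)| <= M * `|\sum_i c i *: e (p i)|) ->
  exists x : blin E F, (forall i, x (e i) = f i) /\ forall u, `|x u| <= M * `|u|.
Proof.
move=> cF M0 etot eM.
pose G (z : E) (y : F) := exists n (c : 'I_n -> C) (p : 'I_n -> I),
  z = \sum_i c i *: e (p i) /\ y = \sum_i c i *: f (p i).
have GM z y : G z y -> `|y| <= M * `|z| by move=> [n [c [p [-> ->]]]].
have GL k z y z' y' : G z y -> G z' y' -> G (k *: z + z') (k *: y + y').
  move=> [n [c [p [-> ->]]]] [n' [c' [p' [-> ->]]]].
  exists (n + n')%N, (fun i : 'I_(n + n') =>
      match fintype.split i with inl a => k * c a | inr b => c' b end),
    (fun i : 'I_(n + n') =>
      match fintype.split i with inl a => p a | inr b => p' b end).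
  have lE (i : 'I_n) : fintype.split (lshift n' i) = inl i by exact: (unsplitK (inl i)).
  have rE (i : 'I_n') : fintype.split (rshift n i) = inr i by exact: (unsplitK (inr i)).
  split; rewrite big_split_ord/= scaler_sumr; congr (_ + _); apply: eq_bigr => i _;
    by rewrite ?lE ?rE ?scalerA.
have GB z y z' y' : G z y -> G z' y' -> G (z' - z) (y' - y).
  by move=> zy zy'; have := GL (-1) _ _ _ _ zy zy'; rewrite !scaleN1r ![- _ + _]addrC.
have Gd z (d : C) : 0 < d -> exists z' y, G z' y /\ `|z - z'| <= d.
  move=> d0; have [_ [n [c [p [pe ->]]]] zd] := etot z _ d0.
  have [q qe] : exists q : 'I_n -> I, forall i, p i = e (q i).
    by exists (fun i => s2val (cid2 (pe i))) => i; rewrite (s2valP' (cid2 (pe i))).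
  exists (\sum_i c i *: p i), (\sum_i c i *: f (q i)); split=> //.
  by exists n, c, q; split=> //; apply: eq_bigr => i _; rewrite qe.
have Y z : exists y, forall d : C, 0 < d -> exists z' y',
    [/\ G z' y', `|z - z'| <= d & `|y - y'| <= d].
  have [|||k Hk] := @cauchy_family R F
    (fun d => [set y | exists2 z', G z' y & `|z - z'| <= d%:C%C]) cF.
  - move=> d d0; have [|z' [y [zy zd]]] := Gd z d%:C%C; first by rewrite ltcR.
    by exists y, z'.
  - by move=> d d' dd' y [z' zy zd]; exists z'; rewrite ?(le_trans zd)// lecR.
  - move=> a a0; have M1 : 0 < M + 1 by rewrite ltr_wpDl.
    have /gt0CP[d d0 dE] : 0 < a / (M + 1) / 2 by rewrite !divr_gt0.
    exists d => // y y' [z1 zy zd] [z2 zy' zd'].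
    rewrite (le_trans (GM _ _ (GB _ _ _ _ zy' zy)))//.
    have : `|z1 - z2| <= a / (M + 1).
      rewrite -(subrKA z) (le_trans (ler_normD _ _))// [leRHS]splitr dE lerD//.
      by rewrite distrC.
    rewrite ler_pdivlMr// mulrC; apply: le_trans.
    by rewrite ler_wpM2r// lerDl.
  exists k => d d0; have [r r0 Hr] := Hk _ d0; have /gt0CP[d1 d10 dE] := d0.
  have m0 : 0 < (Num.min r d1)%:C%C :> C by rewrite ltcR lt_min r0.
  have [z' [y [zy zd]]] := Gd z _ m0.
  exists z', y; split=> //.
    by rewrite (le_trans zd)// dE lecR ge_min lexx orbT.
  by apply: Hr; exists z' => //; rewrite (le_trans zd)// lecR ge_min lexx.
have [g Hg] := choice Y.
have gG z y : G z y -> g z = y.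
  move=> zy; apply/eqP; rewrite -subr_eq0 -normr_le0.
  have M1 : 0 < M + 1 by rewrite ltr_wpDl.
  have [r r0 rE] := normCP (g z - y).
  rewrite rE lecR; apply/ler_addgt0Pr => a a0; rewrite add0r -lecR -rE.
  have a1 : 0 < a%:C%C / (M + 1) :> C by rewrite divr_gt0// ltcR.
  have [z' [y' [zy' zz' gy']]] := Hg z _ a1.
  rewrite -(subrKA y') (le_trans (ler_normD _ _))//.
  have := GM _ _ (GB _ _ _ _ zy zy'); rewrite (distrC z' z) => h.
  rewrite (@le_trans _ _ (a%:C%C / (M + 1) + M * (a%:C%C / (M + 1))))//.
    by rewrite lerD// (le_trans h)// ler_wpM2l.
  by rewrite -[X in X + _]mul1r -mulrDl [1 + M]addrC mulrC divfK// gt_eqF.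
have gL k z z' : g (k *: z + z') = k *: g z + g z'.
  apply/eqP; rewrite -subr_eq0 -normr_le0.
  have [r r0 rE] := normCP (g (k *: z + z') - (k *: g z + g z')).
  rewrite rE lecR; apply/ler_addgt0Pr => a a0; rewrite add0r -lecR -rE.
  (* Errors of size [t] at [z], [z'] and [k *: z + z'] contribute [(|k| + 2) t] through the values
     of [g] and [M (|k| + 2) t] through the graph [G]; their sum is [N t]. *)
  pose N := (M + 1) * (`|k| + 1 + 1).
  have N0 : 0 < N by rewrite mulr_gt0 // ltr_wpDl// addr_ge0.
  have a1 : 0 < a%:C%C / N :> C by rewrite divr_gt0// ltcR.
  have [z1 [y1 [G1 zz1 gy1]]] := Hg z _ a1.
  have [z2 [y2 [G2 zz2 gy2]]] := Hg z' _ a1.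
  have [z3 [y3 [G3 zz3 gy3]]] := Hg (k *: z + z') _ a1.
  have h : `|y3 - (k *: y1 + y2)| <= M * ((`|k| + 1 + 1) * (a%:C%C / N)).
    rewrite (le_trans (GM _ _ (GB _ _ _ _ (GL k _ _ _ _ G1 G2) G3)))// ler_wpM2l//.
    rewrite -(subrKA (k *: z + z')) addrC.
    have -> : k *: z + z' - (k *: z1 + z2) = k *: (z - z1) + (z' - z2).
      by rewrite scalerBr opprD addrACA.
    rewrite (le_trans (ler_normD _ _))// mulrDl mul1r lerD//; last by rewrite distrC.
    rewrite (le_trans (ler_normD _ _))// mulrDl mul1r lerD// normrZ.
    by rewrite ler_wpM2l.
  have -> : g (k *: z + z') - (k *: g z + g z') =
      (g (k *: z + z') - y3) - (k *: (g z - y1) + (g z' - y2)) +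
      (y3 - (k *: y1 + y2)).
    have -> : k *: (g z - y1) + (g z' - y2) = (k *: g z + g z') - (k *: y1 + y2).
      by rewrite scalerBr opprD addrACA.
    by rewrite opprB [RHS]addrAC !subrKA.
  have -> : a%:C%C = (a%:C%C / N + (`|k| + 1) * (a%:C%C / N)) +
      M * ((`|k| + 1 + 1) * (a%:C%C / N)) :> C.
    have -> : a%:C%C = N * (a%:C%C / N) by rewrite mulrC divfK// gt_eqF.
    by rewrite [N * _ / N]mulrC mulKf ?gt_eqF//; move: (_ / N) => t; rewrite /N; ring.
  rewrite (le_trans (ler_normD _ _))// lerD//.
  rewrite (le_trans (ler_normB _ _))// lerD//.
  rewrite (le_trans (ler_normD _ _))// mulrDl mul1r lerD// normrZ.
  by rewrite ler_wpM2l.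
have gM z : `|g z| <= M * `|z|.
  have [r r0 rE] := normCP (g z).
  have [s s0 sE] := normCP z.
  have [m m0 mE] : exists2 m : R, 0 <= m & M = m%:C%C.
    by exists (complex.Re M); [rewrite -lecR|]; rewrite RRe_real// ger0_real.
  rewrite rE sE mE -rmorphM lecR; apply/ler_addgt0Pr => a a0.
  have a1 : 0 < (a / (m + 1))%:C%C :> C by rewrite ltcR divr_gt0// ltr_wpDl.
  have [z1 [y1 [G1 zz1 gy1]]] := Hg z _ a1.
  have h1 : `|g z| <= `|g z - y1| + `|y1|.
    by rewrite -[X in `|X| <= _](subrK y1) ler_normD.
  have h2 : `|z1| <= `|z1 - z| + `|z|.
    by rewrite -[X in `|X| <= _](subrK z) ler_normD.
  have := le_trans h1 (lerD gy1 (le_trans (GM _ _ G1) (ler_wpM2l M0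
    (le_trans h2 (lerD _ (lexx _)))))).
  rewrite distrC => /(_ _ zz1).
  rewrite rE sE mE -(rmorphD (real_complex R)) -(rmorphM (real_complex R)).
  rewrite -(rmorphD (real_complex R)) lecR => h; rewrite (le_trans h)//.
  have -> : a = (m + 1) * (a / (m + 1)) by rewrite mulrC divfK// gt_eqF// ltr_wpDl.
  rewrite [(m + 1) * _ / _]mulrC mulKf ?gt_eqF ?ltr_wpDl//.
  by move: (a / _) => t; lra.
have [||x xg] := @blin_exists E F g; [by []|by exists M|].
exists x; split=> [i|u]; rewrite xg //; apply: gG.
by exists 1%N, (fun=> 1), (fun=> i); rewrite !big_ord1 !scale1r.
Qed.

End Extension.
End BoundedOperators.

(** * Tensor products and the Fock space *)

Section Adjoints.
Variable R : realType.
Local Notation C := R[i].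
Implicit Type H : hilbert R.

Lemma is_adjoint_sym H (x y : bop H) : is_adjoint x y -> is_adjoint y x.
Proof. by move=> xy u v; rewrite dotC -xy -dotC. Qed.

Lemma is_adjoint_inj H (x y z : bop H) : is_adjoint x y -> is_adjoint x z -> y = z.
Proof. by move=> xy xz; apply: blinP => v; apply: dot_extr => u; rewrite -xy xz. Qed.

Lemma adjointP H (x : bop H) : is_adjoint x (adjoint x).
Proof.
apply: (getPex (P := [set y | is_adjoint x y])).
have [M M0 xM] := blin_gt0 x.
have [||||y [yx _]] := @op_of_form R H H (fun u v => dot u (x v)) M; last first.
- by exists y; apply: is_adjoint_sym => u v; rewrite yx.
- exact: ltW.
- move=> u v; rewrite mulrAC; apply: le_trans (cauchy_schwarz _ _) _.
  by rewrite [leLHS]mulrC ler_wpM2r.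
- by move=> c u v v'; rewrite blinD blinZ dotDr dotZr.
- by move=> c u u' v; rewrite dotDl dotZl.
Qed.

Lemma adjoint_uniq H (x y : bop H) : is_adjoint x y -> adjoint x = y.
Proof. exact: is_adjoint_inj (adjointP x). Qed.

Lemma adjoint_comp H (x y : bop H) :
  adjoint (blin_comp x y) = blin_comp (adjoint y) (adjoint x).
Proof. by apply: adjoint_uniq => u v; rewrite /= !adjointP. Qed.

Lemma dot_adjoint H (x : bop H) u v : dot (adjoint x u) v = dot u (x v).
Proof. by rewrite (is_adjoint_sym (adjointP x)). Qed.

Lemma adjoint_bound H (x : bop H) (M : C) : 0 <= M ->
  (forall u, `|x u| <= M * `|u|) -> forall u, `|adjoint x u| <= M * `|u|.
Proof.
move=> M0 xM u; apply: normr_le_dot => [|v]; first by rewrite mulr_ge0.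
rewrite dot_adjoint (le_trans (cauchy_schwarz _ _))//.
by rewrite mulrAC [leRHS]mulrC ler_wpM2l.
Qed.

Lemma total_ext H (G : set H) (z z' : H) : dense (lin_span G) ->
  (forall g, G g -> dot z g = dot z' g) -> z = z'.
Proof.
move=> /denseP dG zz'; apply/eqP; rewrite -subr_eq0 -normr_le0.
apply: normr_le_dot => // v; rewrite mul0r.
apply: (@adherent_le _ H R[i]^o (dot (z - z')) `|z - z'| 0 _ v _ _ _ (dG v)) => //.
  by move=> x y; rewrite -dotBr cauchy_schwarz.
move=> _ [n [c [p [pG ->]]]].
rewrite dot_sumr big1 ?normr0// => i _.
by rewrite dotZr dotBl zz'// subrr mulr0.
Qed.

Lemma total_ext_op (E F : normedModType C) (G : set E) (x y : blin E F) :
  dense (lin_span G) -> (forall g, G g -> x g = y g) -> x = y.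
Proof.
move=> /denseP dG xy; apply: blinP => v; apply/eqP; rewrite -subr_eq0 -normr_le0.
have [M M0 xM] := blin_gt0 x; have [N N0 yN] := blin_gt0 y.
apply: (@adherent_le _ E F (fun v => x v - y v) (M + N) 0 _ v _ _ _ (dG v)) => //.
- by rewrite addr_ge0// ltW.
- move=> u w; have -> : x u - y u - (x w - y w) = x (u - w) - y (u - w).
    by rewrite !blinB !opprB [y w - x w]addrC addrACA [- y u + y w]addrC.
  by rewrite (le_trans (ler_normB _ _))// mulrDl lerD.
move=> _ [n [c [p [pG ->]]]]; rewrite !blin_sum -sumrB big1 ?normr0// => i _.
by rewrite !blinZ xy ?subrr.
Qed.

End Adjoints.

(** * Gram matrices, Schur products and the Loewner order *)

Section Kernels.
Variable R : realType.
Local Notation C := R[i].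

Definition psd n (K : 'I_n -> 'I_n -> C) :=
  forall c : 'I_n -> C, 0 <= \sum_i \sum_j c i * (c j)^* * K i j.

(** An explicit factorization over a finite index type. This certificate of positivity is stable
    under entrywise products and turns the Schur product theorem into a rearrangement of sums. *)
Definition gramlike n (K : 'I_n -> 'I_n -> C) :=
  exists (J : finType) (a : J -> 'I_n -> C),
    forall i j, K i j = \sum_r a r i * (a r j)^*.

Lemma gramlike_mul n (K L : 'I_n -> 'I_n -> C) :
  gramlike K -> gramlike L -> gramlike (fun i j => K i j * L i j).
Proof.
move=> [J [a Ka]] [J' [b Lb]].
exists (J * J')%type, (fun r i => a r.1 i * b r.2 i) => i j.
rewrite Ka Lb big_distrlr/= pair_bigA/=; apply: eq_bigr => r _.
by rewrite rmorphM/= mulrACA.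
Qed.

Lemma gramlike_add n (K L : 'I_n -> 'I_n -> C) :
  gramlike K -> gramlike L -> gramlike (fun i j => K i j + L i j).
Proof.
move=> [J [a Ka]] [J' [b Lb]].
exists (J + J')%type, (fun r i => match r with inl s => a s i | inr s => b s i end).
by move=> i j; rewrite Ka Lb big_sumType.
Qed.

Lemma gramlike_conj n (K : 'I_n -> 'I_n -> C) :
  gramlike K -> gramlike (fun i j => (K i j)^*).
Proof.
move=> [J [a Ka]]; exists J, (fun r i => (a r i)^*) => i j.
by rewrite Ka rmorph_sum; apply: eq_bigr => r _; rewrite rmorphM.
Qed.

Lemma gramlike_rank1 n (a : 'I_n -> C) : gramlike (fun i j => a i * (a j)^*).
Proof. by exists unit, (fun=> a) => i j; rewrite (big_pred1 tt)// => -[]. Qed.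

Lemma gramlike1 n : gramlike (fun _ _ : 'I_n => 1).
Proof.
have [J [a aE]] := gramlike_rank1 (fun _ : 'I_n => 1).
by exists J, a => i j; rewrite -aE conjC1 mulr1.
Qed.

Lemma gramlike_eq n (f : 'I_n -> nat) :
  gramlike (fun i j => (f i == f j)%:R).
Proof.
pose N := (\max_i f i).+1; have fN i : (f i < N)%N by rewrite ltnS leq_bigmax.
exists 'I_N, (fun (r : 'I_N) i => (f i == r :> nat)%:R) => i j.
rewrite (bigD1 (Ordinal (fN i)))//= eqxx mul1r big1 ?addr0.
  by rewrite eq_sym conjC_nat.
move=> r; rewrite -val_eqE/= eq_sym => /negPf ->.
by rewrite mul0r.
Qed.

(** Gram-Schmidt: split off the component along the first vector and apply induction to the
    orthogonal remainders, the first of which is zero. *)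
Lemma gramlike_dot (H : hilbert R) n (v : 'I_n -> H) :
  gramlike (fun i j => dot (v i) (v j) : C).
Proof.
elim: n v => [|n IH] v; first by exists void, (fun=> fun=> 0) => -[].
(* If the first vector is zero, [0^-1 = 0] makes [e] zero and nothing is split off. *)
pose e := `|v ord0|^-1 *: v ord0.
pose v' i := v i - dot (v i) e *: e.
have e0 : v' ord0 = 0.
  rewrite /v' /e dotZr geC0_conj ?invr_ge0// scalerA -dot_norm.
  have [->|v0] := eqVneq (v ord0) 0; first by rewrite scaler0 subrr.
  by rewrite mulrAC -expr2 -exprMn mulVf ?normr_eq0// expr1n scale1r subrr.
have ee i : dot (v' i) e = 0.
  have [v0|v0] := eqVneq (v ord0) 0.
    by rewrite /e v0 scaler0 dot0r.
  rewrite dotBl dotZl; have -> : dot e e = 1 :> C.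
    rewrite -dot_norm normrZ normfV normr_id mulVf ?expr1n//.
    by rewrite normr_eq0.
  by rewrite mulr1 subrr.
have [J [a aE]] := IH (fun i => v' (lift ord0 i)).
pose b r i := if unlift ord0 i is Some i' then a r i' else 0.
have bE i j : dot (v' i) (v' j) = \sum_r b r i * (b r j)^*.
  rewrite /b; case: unliftP => [i' ->|->]; last first.
    by rewrite e0 dot0l big1// => r _; rewrite mul0r.
  case: unliftP => [j' ->|->]; first exact: aE.
  by rewrite e0 dot0r big1// => r _; rewrite conjC0 mulr0.
have [J' [d dE]] : gramlike (fun i j => dot (v i) e * (dot (v j) e)^* +
    \sum_r b r i * (b r j)^*).
  by apply: gramlike_add; [exact: gramlike_rank1|exists J, b].
exists J', d => i j; rewrite -dE -bE.
have vE k : v k = dot (v k) e *: e + v' k by rewrite addrC subrK.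
have e1 k : dot (v k) e * dot e e = dot (v k) e :> C.
  have [v0|v0] := eqVneq (v ord0) 0; first by rewrite /e v0 scaler0 dot0r mul0r.
  have -> : dot e e = 1 :> C; last by rewrite mulr1.
  by rewrite -dot_norm normrZ normfV normr_id mulVf ?expr1n// normr_eq0.
clear bE aE e0; clearbody v'; clearbody e.
rewrite {1}(vE i) {1}(vE j) dotDl !dotDr !dotZl !dotZr ee mulr0 add0r.
by rewrite [dot e (v' j)]dotC ee conjC0 mulr0 addr0 mulrCA e1 mulrC.
Qed.

(** Schur product: each vector [a r] of the factorization of [K] is absorbed into the coefficients
    of the quadratic form of [L]. *)
Lemma psd_mul n (K L : 'I_n -> 'I_n -> C) :
  gramlike K -> psd L -> psd (fun i j => K i j * L i j).
Proof.
move=> [J [a Ka]] pL c.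
have -> : \sum_i \sum_j c i * (c j)^* * (K i j * L i j) =
    \sum_r \sum_i \sum_j (c i * a r i) * (c j * a r j)^* * L i j.
  rewrite [RHS]exchange_big/=; apply: eq_bigr => i _.
  rewrite [RHS]exchange_big/=; apply: eq_bigr => j _.
  rewrite Ka mulr_suml mulr_sumr; apply: eq_bigr => r _.
  by rewrite rmorphM/=; ring.
by apply: sumr_ge0 => r _; exact: pL.
Qed.

Lemma psd_add n (K L : 'I_n -> 'I_n -> C) :
  psd K -> psd L -> psd (fun i j => K i j + L i j).
Proof.
move=> pK pL c; apply: le_trans (addr_ge0 (pK c) (pL c)) _.
rewrite -big_split/=; apply: ler_sum => i _; rewrite -big_split/=.
by apply: ler_sum => j _; rewrite mulrDr.
Qed.

Lemma eq_psd n (K L : 'I_n -> 'I_n -> C) : K =2 L -> psd K -> psd L.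
Proof.
move=> KL pK c; apply: le_trans (pK c) _.
by apply: ler_sum => i _; apply: ler_sum => j _; rewrite KL.
Qed.

Lemma psd_conj n (K : 'I_n -> 'I_n -> C) : psd K -> psd (fun i j => (K i j)^*).
Proof.
move=> pK c; have p := pK (fun i => (c i)^*).
suff -> : \sum_i \sum_j c i * (c j)^* * (K i j)^* =
    (\sum_i \sum_j (c i)^* * (c j)^*^* * K i j)^* by rewrite geC0_conj.
rewrite rmorph_sum; apply: eq_bigr => i _; rewrite rmorph_sum.
by apply: eq_bigr => j _; rewrite !rmorphM/= !conjCK.
Qed.

(** The Loewner order, restricted to kernels with a factorization so that it is compatible with
    entrywise products. *)
Definition gle n (K L : 'I_n -> 'I_n -> C) :=
  [/\ gramlike K, gramlike L & psd (fun i j => L i j - K i j)].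

Lemma gle_refl n (K : 'I_n -> 'I_n -> C) : gramlike K -> gle K K.
Proof.
move=> gK; split=> // c; rewrite big1// => i _; rewrite big1// => j _.
by rewrite subrr mulr0.
Qed.

Lemma gle_mul n (K L K' L' : 'I_n -> 'I_n -> C) : gle K L -> gle K' L' ->
  gle (fun i j => K i j * K' i j) (fun i j => L i j * L' i j).
Proof.
move=> [gK gL pKL] [gK' gL' pKL']; split; try exact: gramlike_mul.
(* The decomposition is [L L' - K K' = L (L' - K') + K' (L - K)]. *)
apply: eq_psd (psd_add (psd_mul gL pKL') (psd_mul gK' pKL)) => i j.
by ring.
Qed.

Lemma gle_add n (K L K' L' : 'I_n -> 'I_n -> C) : gle K L -> gle K' L' ->
  gle (fun i j => K i j + K' i j) (fun i j => L i j + L' i j).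
Proof.
move=> [gK gL pKL] [gK' gL' pKL']; split; try exact: gramlike_add.
by apply: eq_psd (psd_add pKL pKL') => i j; ring.
Qed.

Lemma gle_conj n (K L : 'I_n -> 'I_n -> C) : gle K L ->
  gle (fun i j => (K i j)^*) (fun i j => (L i j)^*).
Proof.
move=> [gK gL pKL]; split; try exact: gramlike_conj.
by apply: eq_psd (psd_conj pKL) => i j; rewrite rmorphB.
Qed.

Lemma gle_prod n N (K L : nat -> 'I_n -> 'I_n -> C) :
  (forall k, gle (K k) (L k)) ->
  gle (fun i j => \prod_(k < N) K k i j) (fun i j => \prod_(k < N) L k i j).
Proof.
move=> KL; elim: N => [|N IH].
  have -> : (fun i j => \prod_(k < 0) K k i j) = fun _ _ => 1.
    by apply/funext => i; apply/funext => j; rewrite big_ord0.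
  have -> : (fun i j => \prod_(k < 0) L k i j) = fun _ _ => 1.
    by apply/funext => i; apply/funext => j; rewrite big_ord0.
  exact/gle_refl/gramlike1.
have -> : (fun i j => \prod_(k < N.+1) K k i j) =
    fun i j => (\prod_(k < N) K k i j) * K N i j.
  by apply/funext => i; apply/funext => j; rewrite big_ord_recr.
have -> : (fun i j => \prod_(k < N.+1) L k i j) =
    fun i j => (\prod_(k < N) L k i j) * L N i j.
  by apply/funext => i; apply/funext => j; rewrite big_ord_recr.
exact: gle_mul.
Qed.

Lemma gram_norm (H : hilbert R) n (c : 'I_n -> C) (v : 'I_n -> H) :
  `|\sum_i c i *: v i| ^+ 2 = \sum_i \sum_j c i * (c j)^* * dot (v i) (v j).
Proof.
rewrite dot_norm dot_suml; apply: eq_bigr => i _.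
rewrite dotZl dot_sumr mulr_sumr; apply: eq_bigr => j _.
by rewrite dotZr mulrA.
Qed.

(** A norm bound is read as an inequality of Gram matrices, the form in which it can be multiplied
    over the legs of a tensor. [gle_norm] reads the product back as the estimate demanded by
    [extend_gens]. *)
Lemma gle_op (H H' : hilbert R) (x : blin H H') (M : C) n (v : 'I_n -> H) :
  0 <= M -> (forall u, `|x u| <= M * `|u|) ->
  gle (fun i j => dot (x (v i)) (x (v j))) (fun i j => M ^+ 2 * dot (v i) (v j)).
Proof.
move=> M0 xM; split; first exact: gramlike_dot.
  have [J [a aE]] := gramlike_mul (gramlike_rank1 (fun=> M)) (gramlike_dot v).
  by exists J, a => i j; rewrite -aE geC0_conj// expr2.
move=> c.
have -> : \sum_i \sum_j c i * (c j)^* *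
    (M ^+ 2 * dot (v i) (v j) - dot (x (v i)) (x (v j))) =
    (M * `|\sum_i c i *: v i|) ^+ 2 - `|x (\sum_i c i *: v i)| ^+ 2.
  rewrite exprMn gram_norm blin_sum.
  have -> : \sum_i x (c i *: v i) = \sum_i c i *: x (v i).
    by apply: eq_bigr => i _; rewrite blinZ.
  rewrite gram_norm mulr_sumr -sumrB; apply: eq_bigr => i _.
  by rewrite mulr_sumr -sumrB; apply: eq_bigr => j _; ring.
by rewrite subr_ge0 ler_pXn2r ?nnegrE ?mulr_ge0.
Qed.

Lemma gle_norm (H H' : hilbert R) (M : C) n (v : 'I_n -> H) (v' : 'I_n -> H') :
  0 <= M -> gle (fun i j => dot (v' i) (v' j)) (fun i j => M ^+ 2 * dot (v i) (v j)) ->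
  forall c, `|\sum_i c i *: v' i| <= M * `|\sum_i c i *: v i|.
Proof.
move=> M0 [_ _ /(_ _)] h c; rewrite -(@ler_pXn2r _ 2) ?nnegrE ?mulr_ge0//.
rewrite exprMn !gram_norm -subr_ge0; apply: le_trans (h c) _.
rewrite mulr_sumr -sumrB; apply: ler_sum => i _.
by rewrite mulr_sumr -sumrB; apply: ler_sum => j _; rewrite mulrBr mulrCA.
Qed.

End Kernels.

Section TensorOperators.
Variables (R : realType) (K H : hilbert R) (T : htensor K H).
Local Notation C := R[i].

Lemma tens_ext (z z' : T) :
  (forall u h, dot z (tens T u h) = dot z' (tens T u h)) -> z = z'.
Proof. by move=> zz'; apply: total_ext (@tens_total _ _ _ T) _ => _ [u [h ->]]. Qed.

Lemma tens_op_ext (E : normedModType C) (x y : blin T E) :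
  (forall u h, x (tens T u h) = y (tens T u h)) -> x = y.
Proof. by move=> xy; apply: total_ext_op (@tens_total _ _ _ T) _ => _ [u [h ->]]. Qed.

Lemma tens_form_ext (x y : bop T) :
  (forall u h v k, dot (x (tens T u h)) (tens T v k) = dot (y (tens T u h)) (tens T v k)) ->
  x = y.
Proof. by move=> xy; apply: tens_op_ext => u h; apply: tens_ext => v k. Qed.

Lemma tensDl u u' h : tens T (u + u') h = tens T u h + tens T u' h.
Proof. by apply: tens_ext => v k; rewrite dotDl !tens_dot dotDl mulrDl. Qed.
Lemma tensDr u h h' : tens T u (h + h') = tens T u h + tens T u h'.
Proof. by apply: tens_ext => v k; rewrite dotDl !tens_dot dotDl mulrDr. Qed.
Lemma tensZl c u h : tens T (c *: u) h = c *: tens T u h.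
Proof. by apply: tens_ext => v k; rewrite dotZl !tens_dot dotZl mulrA. Qed.
Lemma tensZr c u h : tens T u (c *: h) = c *: tens T u h.
Proof. by apply: tens_ext => v k; rewrite dotZl !tens_dot dotZl mulrCA. Qed.
Lemma tens0l h : tens T 0 h = 0.
Proof. by rewrite -(scale0r 0) tensZl scale0r. Qed.
Lemma tens0r u : tens T u 0 = 0.
Proof. by rewrite -(scale0r 0) tensZr scale0r. Qed.
Lemma tens_suml I r (P : pred I) (f : I -> K) h :
  tens T (\sum_(i <- r | P i) f i) h = \sum_(i <- r | P i) tens T (f i) h.
Proof. exact: (big_morph (fun u => tens T u h) (fun u u' => tensDl u u' h) (tens0l h)). Qed.
Lemma norm_tens u h : `|tens T u h| = `|u| * `|h|.
Proof.
apply: (@pexpIrn _ 2); rewrite ?nnegrE ?mulr_ge0//.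
by rewrite exprMn !dot_norm tens_dot.
Qed.

Lemma tens_adherent z : adherent (lin_span (range (fun p => tens T p.1 p.2))) z.
Proof.
have := (denseP _).1 (@tens_total _ _ _ T) z; apply: adherentS.
move=> _ [n [c [p [pT ->]]]]; exists n, c, p; split=> // i.
by have [u [h ->]] := pT i; exists (u, h).
Qed.

(** The Gram matrix of elementary tensors is the entrywise product of the Gram matrices of the legs,
    so [gle_mul] yields the estimate for [extend_gens]. *)
Lemma tens_op_exists (x : bop K) (y : bop H) (M N : C) :
  0 <= M -> 0 <= N -> (forall u, `|x u| <= M * `|u|) ->
  (forall h, `|y h| <= N * `|h|) ->
  exists t : bop T, is_tens_op x y t /\ forall z, `|t z| <= M * N * `|z|.
Proof.
move=> M0 N0 xM yN.
have [|||n c p|t [te tM]] := @extend_gens R T T (K * H)%type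
  (fun p => tens T p.1 p.2) (fun p => tens T (x p.1) (y p.2)) (M * N).
- exact: complete_normed.
- by rewrite mulr_ge0.
- exact: tens_adherent.
- apply: gle_norm; rewrite ?mulr_ge0//.
  have := gle_mul (gle_op (fun i => (p i).1) M0 xM) (gle_op (fun i => (p i).2) N0 yN).
  congr gle; apply/funext => i; apply/funext => j; rewrite !tens_dot//.
  by rewrite exprMn mulrACA.
by exists t; split=> // u h; rewrite (te (u, h)).
Qed.

Lemma is_tens_op_inj (x : bop K) (y : bop H) (t t' : bop T) :
  is_tens_op x y t -> is_tens_op x y t' -> t = t'.
Proof. by move=> tE t'E; apply: tens_op_ext => u h; rewrite tE t'E. Qed.

Definition tens_op (x : bop K) (y : bop H) : bop T :=
  get [set t | is_tens_op x y t].

Lemma tens_opP (x : bop K) (y : bop H) : is_tens_op x y (tens_op x y).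
Proof.
have [M M0 xM] := blin_gt0 x; have [N N0 yN] := blin_gt0 y.
have [t [tE _]] := tens_op_exists (ltW M0) (ltW N0) xM yN.
by apply: (getPex (P := [set t | is_tens_op x y t])); exists t.
Qed.

Lemma tens_opE (x : bop K) (y : bop H) u h : tens_op x y (tens T u h) = tens T (x u) (y h).
Proof. exact: tens_opP. Qed.

Lemma tens_op_uniq (x : bop K) (y : bop H) t : is_tens_op x y t -> t = tens_op x y.
Proof. by move=> tE; exact: is_tens_op_inj tE (tens_opP x y). Qed.

Lemma tens_op_bound (x : bop K) (y : bop H) (M N : C) :
  0 <= M -> 0 <= N -> (forall u, `|x u| <= M * `|u|) ->
  (forall h, `|y h| <= N * `|h|) ->
  forall z, `|tens_op x y z| <= M * N * `|z|.
Proof.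
move=> M0 N0 xM yN; have [t [tE tM]] := tens_op_exists M0 N0 xM yN.
by rewrite -(tens_op_uniq tE).
Qed.

Lemma tens_op_adjoint (x : bop K) (y : bop H) :
  adjoint (tens_op x y) = tens_op (adjoint x) (adjoint y).
Proof.
apply: tens_form_ext => u h v k.
by rewrite dot_adjoint !tens_opE !tens_dot !dot_adjoint.
Qed.

End TensorOperators.

(** * Contractions acting on the Fock space *)

Section FockOperators.
Variables (R : realType) (H : hilbert R) (F : fock H).
Local Notation C := R[i].

Record fock_gen := FockGen {
  fgm : nat; fgn : nat; fgxi : 'I_fgm -> H; fgeta : 'I_fgn -> H;
  fg_gt0 : (0 < fgm + fgn)%N }.

Definition fock_vec (p : fock_gen) : F := fock_emb F (@fgxi p) (@fgeta p).

Definition fock_map (x : bop H) (p : fock_gen) : fock_gen :=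
  FockGen (x \o @fgxi p) (x \o @fgeta p) (fg_gt0 p).

Definition pad m (xi : 'I_m -> H) (k : nat) : H :=
  if insub k is Some i then xi i else 0.

(** The inner product of the [k]-th entries where both exist, and [1] past the end of both tuples. A
    family of generators of different degrees thus gets the same number [N] of factors, each of
    which is a Gram kernel. *)
Definition slot m m' (xi : 'I_m -> H) (xi' : 'I_m' -> H) k : C :=
  dot (pad xi k) (pad xi' k) + (m <= k)%N%:R * (m' <= k)%N%:R.

Lemma pad_comp m (xi : 'I_m -> H) (x : bop H) k : pad (x \o xi) k = x (pad xi k).
Proof. by rewrite /pad; case: insub => [i|]//=; rewrite blin0. Qed.

Lemma prod_slot m (xi xi' : 'I_m -> H) N : (m <= N)%N ->
  \prod_(k < N) slot xi xi' k = \prod_i dot (xi i) (xi' i).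
Proof.
move=> mN; pose f k := slot xi xi' k.
rewrite -(big_mkord xpredT f) (big_cat_nat (n := m))//= big_mkord.
rewrite [X in _ * X]big1_seq ?mulr1.
  apply: eq_bigr => i _; rewrite /f /slot /pad.
  have -> : insub (i : nat) = Some i by exact: valK.
  by rewrite leqNgt ltn_ord mul0r addr0.
move=> k /andP[_]; rewrite mem_index_iota => /andP[mk _]; rewrite /f /slot /pad.
have -> : insub k = None :> option 'I_m by rewrite insubF// ltnNge mk.
by rewrite dot0l mk add0r mulr1.
Qed.

Lemma fock_vec_dot N (p q : fock_gen) :
  (fgm p <= N)%N -> (fgn p <= N)%N ->
  dot (fock_vec p) (fock_vec q) = (fgm p == fgm q)%:R * (fgn p == fgn q)%:R *
    (\prod_(k < N) slot (@fgxi p) (@fgxi q) k *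
     \prod_(k < N) (slot (@fgeta p) (@fgeta q) k)^*).
Proof.
move=> mN nN; have [mm|mm] := eqVneq (fgm p) (fgm q); last first.
  rewrite !mul0r fock_orth ?fg_gt0//.
  by move=> [] /eqP; rewrite (negPf mm).
have [nn|nn] := eqVneq (fgn p) (fgn q); last first.
  rewrite mulr0 !mul0r fock_orth ?fg_gt0//.
  by move=> [] _ /eqP; rewrite (negPf nn).
rewrite !mul1r; case: q mm nn => m' n' xi' eta' mn' /= mm nn.
case: p mm nn mN nN => m n xi eta mn /= mm nn; move: xi' eta' mn'.
rewrite -mm -nn => xi' eta' mn' mN nN.
rewrite /fock_vec/= fock_dot// prod_slot//; congr (_ * _).
by rewrite -!rmorph_prod (prod_slot _ _ nN).
Qed.

Lemma fock_adherent z : adherent (lin_span (range fock_vec)) z.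
Proof.
have := (denseP _).1 (@fock_total _ _ F) z; apply: adherentS.
move=> _ [n [c [p [pF ->]]]]; exists n, c, p; split=> // i.
by have [m [n' [xi [eta [mn ->]]]]] := pF i; exists (FockGen xi eta mn).
Qed.

Lemma fock_op_exists (x : bop H) : contractive x ->
  exists y : bop F, (forall p, y (fock_vec p) = fock_vec (fock_map x p)) /\ contractive y.
Proof.
move=> cx; have xM u : `|x u| <= 1 * `|u| by rewrite mul1r.
have [|n c p|y [yE yc]] := @extend_gens R F F fock_gen
    fock_vec (fun p => fock_vec (fock_map x p)) 1 (@complete_normed _ _) ler01.
- exact: fock_adherent.
- apply: gle_norm => //.
  pose N := (\max_i maxn (fgm (p i)) (fgn (p i)))%N.
  have mN i : (fgm (p i) <= N)%N.
    by rewrite (leq_trans _ (leq_bigmax i))// leq_maxl.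
  have nN i : (fgn (p i) <= N)%N.
    by rewrite (leq_trans _ (leq_bigmax i))// leq_maxr.
  (* The inner products decrease by [gle_op], and the indicator of being past the end is unchanged
     by the operator. *)
  have slotP (m : 'I_n -> nat) (xi : forall i, 'I_(m i) -> H) k :
      gle (fun i j => slot (x \o xi i) (x \o xi j) k) (fun i j => slot (xi i) (xi j) k).
    have := gle_add (gle_op (fun i => pad (xi i) k) ler01 xM)
      (gle_refl (gramlike_rank1 (fun i => (m i <= k)%N%:R : C))).
    congr gle; apply/funext => i; apply/funext => j; rewrite /slot ?pad_comp conjC_nat//.
    by rewrite expr1n mul1r.
  have := gle_mul (gle_refl (gramlike_mul (gramlike_eq R (fun i => fgm (p i)))
      (gramlike_eq R (fun i => fgn (p i)))))
    (gle_mul (gle_prod N (slotP _ (fun i => @fgxi (p i))))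
      (gle_prod N (fun k => gle_conj (slotP _ (fun i => @fgeta (p i)) k)))).
  congr gle; apply/funext => i; apply/funext => j.
    by rewrite (@fock_vec_dot N _ _ (mN i : (fgm (fock_map x (p i)) <= N)%N) (nN i)).
  by rewrite expr1n mul1r (fock_vec_dot _ (mN i) (nN i)).
by exists y; split=> // u; rewrite -[leRHS]mul1r.
Qed.

Lemma fock_opP (x : bop H) : contractive x ->
  (forall p, fock_op F x (fock_vec p) = fock_vec (fock_map x p)) /\
  contractive (fock_op F x).
Proof.
move=> cx; have [y [yE yc]] := fock_op_exists cx.
have fE p : fock_op F x (fock_vec p) = fock_vec (fock_map x p).
  case: p => m n xi eta mn.
  apply: (getPex (P := [set y : bop F | forall m n (xi : 'I_m -> H) (eta : 'I_n -> H),
    (0 < m + n)%N -> y (fock_emb F xi eta) = fock_emb F (x \o xi) (x \o eta)])) => //.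
  by exists y => m' n' xi' eta' mn'; exact: (yE (FockGen xi' eta' mn')).
split=> //; suff -> : fock_op F x = y by [].
apply: total_ext_op (@fock_total _ _ F) _ => _ [m [n [xi [eta [mn ->]]]]].
by rewrite -/(fock_vec (FockGen xi eta mn)) fE yE.
Qed.

Lemma fock_op_comp (x y : bop H) : contractive x -> contractive y ->
  fock_op F (blin_comp x y) = blin_comp (fock_op F x) (fock_op F y).
Proof.
move=> cx cy; have cxy : contractive (blin_comp x y).
  by move=> u; rewrite /= (le_trans (cx _)).
apply: total_ext_op (@fock_total _ _ F) _ => _ [m [n [xi [eta [mn ->]]]]].
rewrite /= -/(fock_vec (FockGen xi eta mn)).
by rewrite (fock_opP cxy).1 (fock_opP cy).1 (fock_opP cx).1.
Qed.

End FockOperators.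

(** * Representations and continuous functions *)

Section StarRepresentations.
Variables (R : realType) (A : cstar_algebra R) (H : hilbert R) (f : A -> bop H).
Local Notation C := R[i].
Hypothesis fhom : star_hom f.

Let fL := let: And3 h _ _ := fhom in h.
Let fM := let: And3 _ h _ := fhom in h.
Let fS := let: And3 _ _ h := fhom in h.

Lemma star_homP k a b u : f (k *: a + b) u = k *: f a u + f b u.
Proof. exact: fL. Qed.
Lemma star_homD a b u : f (a + b) u = f a u + f b u.
Proof. by rewrite -{1}[a]scale1r fL scale1r. Qed.
Lemma star_hom0 u : f 0 u = 0.
Proof. by apply: (@addrI _ (f 0 u)); rewrite -star_homD !addr0. Qed.
Lemma star_homZ k a u : f (k *: a) u = k *: f a u.
Proof. by rewrite -[k *: a]addr0 fL star_hom0 addr0. Qed.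
Lemma star_homB a b u : f (a - b) u = f a u - f b u.
Proof. by rewrite star_homD -scaleN1r star_homZ scaleN1r. Qed.
Lemma star_hom_sum I r (P : pred I) (a : I -> A) u :
  f (\sum_(i <- r | P i) a i) u = \sum_(i <- r | P i) f (a i) u.
Proof. exact: (big_morph (f^~ u) (fun a b => star_homD a b u) (star_hom0 u)). Qed.
Lemma star_homM a b u : f (cmul a b) u = f a (f b u).
Proof. by rewrite fM. Qed.
Lemma star_hom_dot a u v : dot (f a u) v = dot u (f (cstar a) v).
Proof. exact: fS. Qed.
Lemma star_hom_norm a u : `|f a u| ^+ 2 = dot (f (cmul (cstar a) a) u) u.
Proof. by rewrite star_homM [RHS]dotC -star_hom_dot dot_norm -dotC. Qed.

Lemma cstar_unit e : is_unit e -> cstar e = e :> A.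
Proof.
move=> eU; have h := (eU (cstar e)).2; have := congr1 (@cstar R A) h.
by rewrite cstarM !cstarK h.
Qed.

Lemma star_hom_unit e u : is_unit e -> dot (f e u) u = `|f e u| ^+ 2.
Proof. by move=> eU; rewrite star_hom_norm (cstar_unit eU) (eU e).1. Qed.

Lemma star_hom_unit_contr e : is_unit e -> contractive (f e).
Proof.
move=> eU u; have := cauchy_schwarz (f e u) u.
rewrite star_hom_unit// normrX normr_id expr2.
have [->|fu] := eqVneq (f e u) 0; first by rewrite normr0.
by rewrite ler_pM2l// normr_gt0.
Qed.

(** For [|a| < 1] the identity [e = a^* a + b^* b] gives [f (a^* a) <= f e <= 1]. The hypothesis on
    [b] isolates the functional calculus involved: a pointwise square root on [C(X)], an iteration
    in a commutative algebra. *)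
Lemma star_hom_bound e : is_unit e ->
  (forall a : A, `|a| < 1 -> exists b : A, cmul (cstar b) b = e - cmul (cstar a) a) ->
  forall a u, `|f a u| <= `|a| * `|u|.
Proof.
move=> eU sq a u.
have main (b : A) : `|b| < 1 -> `|f b u| <= `|u|.
  move=> b1; have [c cE] := sq b b1.
  rewrite -(@ler_pXn2r _ 2) ?nnegrE// star_hom_norm.
  have -> : cmul (cstar b) b = e - cmul (cstar c) c by rewrite cE opprB addrC subrK.
  rewrite star_homB dotBl -star_hom_norm lerBlDr.
  rewrite star_hom_unit// (@le_trans _ _ (`|u| ^+ 2))//; last by rewrite lerDl exprn_ge0.
  by rewrite ler_pXn2r ?nnegrE//; exact: star_hom_unit_contr.
have [r r0 rE] := normCP (f a u); have [s s0 sE] := normCP a; have [t t0 tE] := normCP u.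
rewrite rE sE tE -(rmorphM (real_complex R)) lecR.
apply/ler_addgt0Pr => d d0.
have t1 : 0 < t + 1 by rewrite ltr_wpDl.
(* Slightly more than the norm of [a], so that [a / k] falls under [main]; the excess costs at most
   [d] after multiplication by [|u| = t]. *)
pose k : R := s + d / (t + 1).
have k0 : 0 < k by rewrite ltr_wpDl// divr_gt0.
have : `|f ((k%:C%C)^-1 *: a) u| <= `|u|.
  apply: main; rewrite normrZ normfV sE ger0_norm ?lecR ?(ltW k0)//.
  rewrite mulrC ltr_pdivrMr ?ltcR// mul1r ltcR ltrDl.
  by rewrite divr_gt0.
rewrite star_homZ normrZ normfV ger0_norm ?lecR ?(ltW k0)// mulrC.
rewrite ler_pdivrMr ?ltcR// rE tE -(rmorphM (real_complex R)) lecR => h.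
rewrite (le_trans h)// mulrDr [t * s]mulrC lerD2l mulrCA ler_piMr ?(ltW d0)//.
by rewrite ler_pdivrMr// mul1r lerDl.
Qed.

End StarRepresentations.

Lemma continuous_sum (K : numFieldType) (V : normedModType K) (X : topologicalType)
    I (r : seq I) (F : I -> X -> V) :
  (forall i, continuous (F i)) -> continuous (fun x => \sum_(i <- r) F i x).
Proof.
move=> Fc; elim: r => [|i r IH].
  rewrite (_ : (fun x => _) = fun=> 0); first exact: cst_continuous.
  by apply/funext => x; rewrite big_nil.
rewrite (_ : (fun x => _) = fun x => F i x + \sum_(j <- r) F j x).
  by move=> x; apply: cvgD; [exact: Fc|exact: IH].
by apply/funext => x; rewrite big_cons.
Qed.

(** * Continuous functions and partitions of unity on a compact space *)

Section Compactness.
Variables (R : realType) (X : topologicalType).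
Local Notation C := R[i]^o.
Hypothesis cX : compact [set: X].

(** The filter of finite sequences ordered by inclusion converts the near-covering form of
    compactness into a finite subcover. *)
Lemma compact_fin_cover (O : X -> set X) : (forall x, nbhs x (O x)) ->
  exists s : seq X, forall y, exists2 x, x \in s & O x y.
Proof.
move=> xO.
pose F := filter_from [set: seq X] (fun s => [set t : seq X | {subset s <= t}]).
have FF : ProperFilter F.
  apply: filter_from_proper; last by move=> s _; exists s => x.
  apply: filter_from_filter; first by exists [::].
  move=> s t _ _; exists (s ++ t) => // w /= stw.
  by split=> x xs; apply: stw; rewrite mem_cat xs ?orbT.
have := (compact_near_coveringP _).1 cX (seq X) F
  (fun s y => exists2 x, x \in s & O x y) _.
case=> [x _|s _ sO].
  exists (O x, [set t : seq X | x \in t]) => /=.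
    by split; [exact: xO|exists [:: x] => // t /= xt; apply: xt; rewrite mem_head].
  by move=> [y t] [/= Oy xt]; exists x.
by exists s => y; apply: (sO s).
Qed.

Lemma continuous_normP (f : X -> C) :
  continuous f <-> forall x (e : R[i]), 0 < e -> \forall y \near x, `|f x - f y| <= e.
Proof. split=> fc x; last by apply/cvgrPdist_le; exact: fc.
by have /cvgrPdist_le := fc x. Qed.

Lemma continuous_in_cb (f : X -> C) : continuous f -> f \in @cb R X.
Proof.
move=> cf; apply/cbP; split=> //.
have [|s sf] := @compact_fin_cover (fun x => [set y | `|f x - f y| <= 1]).
  by move=> x; exact: (continuous_normP f).1.
exists (\sum_(x <- s) (`|f x| + 1)) => y; have [x xs fxy] := sf y.
rewrite (big_rem x)//= (@le_trans _ _ (`|f x| + 1))//; last first.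
  by rewrite lerDl sumr_ge0// => z _; rewrite addr_ge0.
rewrite -[f y](subrK (f x)) addrC (le_trans (ler_normD _ _))// lerD2l.
by rewrite distrC.
Qed.

Definition mkcb (f : X -> C) (cf : continuous f) : cbfun R X :=
  CbFun (continuous_in_cb cf).

Lemma cb_continuous (f : cbfun R X) : continuous (f : X -> C).
Proof. by have [] := cbP _ (cbfun_cb f). Qed.

Lemma sintE (m : dual (cb_algebra R X)) (g : X -> C) (h : cbfun R X) :
  (forall x, g x = h x) -> sint m g = m h.
Proof.
move=> gh; rewrite /sint; congr (m _); apply/val_inj.
have -> : g = h by exact/funext.
by rewrite val_insubd (cbfun_cb h).
Qed.

Lemma continuous_Re (f : X -> C) : continuous f -> continuous (fun x => complex.Re (f x) : R^o).
Proof.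
move=> fc x; apply/cvgrPdist_le => e e0.
have := (continuous_normP f).1 fc x e%:C%C; rewrite ltcR => /(_ e0).
apply: filterS => y; rewrite -lecR; apply: le_trans.
by rewrite -raddfB/= normc_ge_Re.
Qed.

Lemma continuous_real (f : X -> R) : continuous (f : X -> R^o) ->
  continuous (fun x => (f x)%:C%C : C).
Proof.
move=> fc; apply/continuous_normP => x _ /gt0CP[e e0 ->].
have /cvgrPdist_le/(_ _ e0) := fc x; apply: filterS => y.
rewrite -rmorphB/= normc_def/= expr0n/= addr0 sqrtr_sqr.
by rewrite lecR.
Qed.

Lemma cb_sqrt (f : cbfun R X) : (forall x, 0 <= f x) ->
  exists g : cbfun R X, forall x, 0 <= g x /\ g x * g x = f x.
Proof.
move=> f0; have gc : continuous (fun x => (Num.sqrt (complex.Re (f x)))%:C%C : C).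
  apply: continuous_real => x.
  apply: (@continuous_comp _ _ _ (fun x => complex.Re (f x) : R^o) (@Num.sqrt R)).
    exact/continuous_Re/cb_continuous.
  exact: sqrt_continuous.
exists (mkcb gc) => x /=; rewrite lecR sqrtr_ge0; split=> //.
rewrite -rmorphM/= -expr2 sqr_sqrtr ?RRe_real ?ger0_real//.
by rewrite -lecR RRe_real ?ger0_real.
Qed.

(** [d] is a gauge made from the finitely many functions to be controlled, and the partition
    consists of the normalized bumps [max (0, e - d s_k)]. *)
Lemma partition_unity (d : X -> X -> R) (e : R) : 0 < e ->
  (forall x, continuous (d x : X -> R^o)) -> (forall x, d x x = 0) ->
  exists n (phi : 'I_n -> cbfun R X) (s : 'I_n -> X),
    [/\ forall k x, 0 <= phi k x, forall x, \sum_k phi k x = 1 &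
        forall k x, phi k x != 0 -> d (s k) x < e].
Proof.
move=> e0 dc dxx.
have [|s sd] := @compact_fin_cover (fun x => [set y | d x y < e]).
  move=> x; have /cvgrPdist_lt/(_ _ e0) := dc x x; apply: filterS => y /=.
  by rewrite dxx sub0r normrN; apply: le_lt_trans; exact: ler_norm.
pose h (k : 'I_(size s)) x : R := Num.max 0 (e - d (tnth (in_tuple s) k) x).
have hc k : continuous (h k : X -> R^o).
  move=> x; apply: (@continuous_max R X (fun=> 0) (fun x => e - d _ x)).
    exact: cst_continuous.
  by apply: continuousB; [exact: cst_continuous|exact: dc].
have h0 k x : 0 <= h k x by rewrite le_max lexx.
pose S x := \sum_k h k x.
have S0 x : 0 < S x.
  have [y ys dy] := sd x.
  have ys' : (index y s < size s)%N by rewrite index_mem.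
  rewrite /S (bigD1 (Ordinal ys'))//= ltr_pwDl ?sumr_ge0//.
  by rewrite lt_max/= (tnth_nth y)/= nth_index// subr_gt0 dy orbT.
have Sc : continuous (S : X -> R^o).
  exact: (@continuous_sum R R^o).
have pc k : continuous (fun x => (h k x / S x)%:C%C : C).
  apply: continuous_real => x; apply: cvgM; first exact: hc.
  by apply: cvgV; [rewrite gt_eqF|exact: Sc].
exists (size s), (fun k => mkcb (pc k)), (tnth (in_tuple s)); split.
- by move=> k x /=; rewrite lecR divr_ge0// ltW.
- by move=> x /=; rewrite -rmorph_sum/= -mulr_suml divff ?(gt_eqF (S0 x)).
- move=> k x /=; apply: contraR; rewrite -leNgt => dx.
  by rewrite /h max_l ?mul0r// subr_le0.
Qed.

End Compactness.

Section UniversalRepresentation.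
Variables (R : realType) (A : cstar_algebra R) (U : univ_rep A).
Local Notation C := R[i].

Lemma rep_unit e : is_unit e -> forall u, rep U e u = u.
Proof.
move=> eU; suff -> : rep U e = blin_id U by [].
apply: total_ext_op (@rep_nondegenerate _ _ U) _ => _ [a [u ->]] /=.
by rewrite -(star_homM (rep_star_hom U)) (eU a).1.
Qed.

Lemma rep_bidual a : @bidual R A U (rep U a).
Proof. by move=> y yc; rewrite -yc//; exists a. Qed.

Lemma vectorsP (m : dual A) a :
  m a = dot (rep U a (vectors U m).1) (vectors U m).2.
Proof.
apply: (getPex (P := [set p : U * U | forall a, m a = dot (rep U a p.1) p.2])).
by have [u [v mE]] := rep_vector U m; exists (u, v).
Qed.

Lemma vector_functional e u v : is_unit e ->
  (forall a : A, `|a| < 1 -> exists b : A, cmul (cstar b) b = e - cmul (cstar a) a) ->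
  exists m : dual A, forall a, m a = dot (rep U a u) v.
Proof.
move=> eU sq; apply: (@blin_exists R A R[i]^o (fun a => dot (rep U a u) v)).
  by move=> k a b; rewrite star_homP ?dotDl ?dotZl//; exact: rep_star_hom.
exists (`|u| * `|v|) => a; rewrite (le_trans (cauchy_schwarz _ _))//.
rewrite mulrC mulrAC [X in _ <= X]mulrC ler_wpM2l//.
rewrite [leRHS]mulrC.
by apply: star_hom_bound eU sq a u; exact: rep_star_hom.
Qed.

End UniversalRepresentation.

(** * Weak limits of bounded operators on a tensor product *)

Section WeakLimits.
Variables (R : realType) (K H : hilbert R) (T : htensor K H).
Local Notation C := R[i].

Lemma normr_le_dot_dense (E : hilbert R) (G : set E) (u : E) (M : C) :
  (forall z, adherent G z) -> 0 <= M ->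
  (forall v, G v -> `|dot u v| <= M * `|v|) -> `|u| <= M.
Proof.
move=> dG M0 uG; apply: normr_le_dot => // v.
have [m m0 mE] : exists2 m : R, 0 <= m & M = m%:C%C.
  by exists (complex.Re M); [rewrite -lecR|]; rewrite RRe_real// ger0_real.
have [r r0 rE] := normCP u; have [s s0 sE] := normCP v.
have [t t0 tE] := @normCP R R[i]^o (dot u v).
rewrite tE sE mE -(rmorphM (real_complex R)) lecR; apply/ler_addgt0Pr => d d0.
have d1 : 0 < (d / (r + m + 1))%:C%C :> C.
  by rewrite ltcR divr_gt0// ltr_wpDl// addr_ge0.
have [w Gw vw] := dG v _ d1.
have h1 : `|dot u v| <= `|u| * `|v - w| + `|dot u w|.
  rewrite -{1}[v](subrK w) dotDr (le_trans (ler_normD _ _))// lerD2r.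
  exact: cauchy_schwarz.
have h2 : `|w| <= `|v - w| + `|v|.
  by rewrite -[X in `|X| <= _](subrK v) (le_trans (ler_normD _ _))// distrC.
have [q q0 qE] := normCP (v - w).
have := le_trans h1 (lerD (lexx _) (le_trans (uG _ Gw) (ler_wpM2l M0 h2))).
move: vw; rewrite tE rE sE mE qE !(=^~ (rmorphM (real_complex R), rmorphD (real_complex R))) !lecR.
move=> vw h; rewrite (le_trans h)//.
have : q * (r + m + 1) <= d by rewrite -ler_pdivlMr// ltr_wpDl// addr_ge0.
by nra.
Qed.

(** A form approximated on every finite set of elementary tensors by operators of norm at most [M]
    is itself bounded by [M] on their span, hence comes from an operator [V]. As [V] is a weak limit
    of members of [XX], whatever commutes with [XX] commutes with [V]; this is how [V] enters a
    bicommutant. *)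
Lemma weak_limit_op (b : K * H -> K * H -> C) (M : C) (XX : set (bop T)) :
  0 <= M ->
  (forall n (p : 'I_n -> K * H) (e : C), 0 < e -> exists X : bop T,
    [/\ XX X, forall z, `|X z| <= M * `|z| &
      forall i j, `|dot (X (tens T (p i).1 (p i).2)) (tens T (p j).1 (p j).2)
        - b (p i) (p j)| <= e]) ->
  exists V : bop T, [/\ forall p q, dot (V (tens T p.1 p.2)) (tens T q.1 q.2) = b p q,
    forall z, `|V z| <= M * `|z| &
    forall c, (forall X, XX X -> blin_comp c X = blin_comp X c) ->
      blin_comp c V = blin_comp V c].
Proof.
move=> M0 happ; pose t (p : K * H) := tens T p.1 p.2.
have dT := @tens_adherent R K H T.
have limit (x y : C) : (forall e : C, 0 < e -> `|x| <= y + e) -> 0 <= y -> `|x| <= y.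
  move=> xy y0; have [r r0 rE] := @normCP R R[i]^o x.
  have yE : y = (complex.Re y)%:C%C by rewrite RRe_real// ger0_real.
  rewrite rE yE lecR; apply/ler_addgt0Pr => d d0.
  have := xy d%:C%C; rewrite ltcR => /(_ d0).
  by rewrite rE yE -(rmorphD (real_complex R)) lecR.
have bound n (c : 'I_n -> C) (p : 'I_n -> K * H) n' (c' : 'I_n' -> C) (q : 'I_n' -> K * H) :
    `|\sum_i \sum_j c i * (c' j)^* * b (p i) (q j)| <=
    M * `|\sum_i c i *: t (p i)| * `|\sum_j c' j *: t (q j)|.
  apply: limit => [e e0|]; last by rewrite !mulr_ge0.
  pose S := \sum_i \sum_j `|c i| * `|c' j|.
  have S0 : 0 <= S by apply: sumr_ge0 => i _; apply: sumr_ge0 => j _; rewrite mulr_ge0.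
  have S1 : 0 < S + 1 by rewrite ltr_wpDl.
  (* A single approximant has to match [b] between the two lists, hence the concatenation. *)
  pose pq (i : 'I_(n + n')) := match fintype.split i with inl a => p a | inr a => q a end.
  have [X [_ XM Xb]] := happ _ pq _ (divr_gt0 e0 S1).
  have Xb' i j : `|dot (X (t (p i))) (t (q j)) - b (p i) (q j)| <= e / (S + 1).
    have := Xb (lshift n' i) (rshift n j).
    have lE : fintype.split (lshift n' i) = inl i by exact: (unsplitK (inl i)).
    have rE : fintype.split (rshift n j) = inr j by exact: (unsplitK (inr j)).
    by rewrite /pq lE rE.
  have -> : \sum_i \sum_j c i * (c' j)^* * b (p i) (q j) =
      dot (X (\sum_i c i *: t (p i))) (\sum_j c' j *: t (q j)) -
      \sum_i \sum_j c i * (c' j)^* * (dot (X (t (p i))) (t (q j)) - b (p i) (q j)).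
    rewrite blin_sum dot_suml -sumrB; apply: eq_bigr => i _.
    rewrite blinZ dotZl dot_sumr mulr_sumr -sumrB; apply: eq_bigr => j _.
    by rewrite dotZr; ring.
  rewrite (le_trans (ler_normB _ _))// lerD//.
    by rewrite (le_trans (cauchy_schwarz _ _))// ler_wpM2r.
  rewrite (@le_trans _ _ (S * (e / (S + 1))))//.
    rewrite (le_trans (ler_norm_sum _ _ _))// /S mulr_suml ler_sum// => i _.
    rewrite (le_trans (ler_norm_sum _ _ _))// mulr_suml ler_sum// => j _.
    by rewrite !normrM norm_conjC ler_wpM2l// mulr_ge0.
  rewrite mulrA ler_pdivrMr// mulrC ler_wpM2l ?lerDl//.
  exact: ltW.
(* For fixed [p], the functional with values conjugate to [b p q] on [t q] extends by density, and
   its Riesz vector is the value of [V] at [t p]. *)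
have Y p : exists y : T, forall q, dot y (t q) = b p q.
  have [|||f [fE fM]] := @extend_gens R T R[i]^o (K * H)%type t (fun q => (b p q)^*)
      (M * `|t p|) (@cplx_complete R).
  - by rewrite mulr_ge0.
  - exact: dT.
  - move=> n c q; have := bound 1%N (fun=> 1) (fun=> p) n c q.
    rewrite !big_ord1 scale1r -[X in `|X| <= _ -> _]conjCK norm_conjC rmorph_sum => h.
    rewrite (le_trans _ h)// le_eqVlt; apply/orP; left; apply/eqP; congr `|_|.
    by apply: eq_bigr => i _; rewrite mul1r rmorphM/= conjCK.
  have [||y yE] := @riesz R T f.
  - by move=> c x y; rewrite blinD blinZ.
  - by exists (M * `|t p|).
  by exists y => q; rewrite dotC -yE fE conjCK.
have [f fE] := choice Y.
have [|V [VE VM]] := @extend_gens R T T (K * H)%type t f M (@complete_normed _ _) M0 dT.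
  move=> n c p; apply: (normr_le_dot_dense dT); first by rewrite mulr_ge0.
  move=> _ [n' [c' [q [qT ->]]]].
  have [q' qE] : exists q' : 'I_n' -> K * H, forall i, q i = t (q' i).
    by exists (fun i => s2val (cid2 (qT i))) => i; exact: esym (s2valP' (cid2 (qT i))).
  have -> : \sum_i c' i *: q i = \sum_i c' i *: t (q' i).
    by apply: eq_bigr => i _; rewrite qE.
  have -> : dot (\sum_i c i *: f (p i)) (\sum_i c' i *: t (q' i)) =
      \sum_i \sum_j c i * (c' j)^* * b (p i) (q' j).
    rewrite dot_suml; apply: eq_bigr => i _.
    rewrite dotZl dot_sumr mulr_sumr; apply: eq_bigr => j _.
    by rewrite dotZr fE mulrA.
  exact: bound.
have Vb p q : dot (V (t p)) (t q) = b p q by rewrite VE fE.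
exists V; split=> // c cX.
have mul_small (k e : C) : 0 <= k -> 0 < e -> k * (e / (k + 1)) <= e.
  move=> k0 e0; rewrite mulrA ler_pdivrMr ?ltr_wpDl// mulrC ler_wpM2l ?lerDl//.
  exact: ltW.
have div1_gt0 (k e : C) : 0 <= k -> 0 < e -> 0 < e / (k + 1).
  by move=> k0 e0; rewrite divr_gt0// ltr_wpDl.
have span_t z (e : C) : 0 < e -> exists n (a : 'I_n -> C) (r : 'I_n -> K * H),
    `|z - \sum_i a i *: t (r i)| <= e.
  move=> e0; have [_ [n [a [r [rT ->]]]] zr] := dT z _ e0.
  exists n, a, (fun i => s2val (cid2 (rT i))).
  rewrite (_ : \sum_i _ = \sum_i a i *: r i)//; apply: eq_bigr => i _.
  by congr (_ *: _); exact: (s2valP' (cid2 (rT i))).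
(* Vectors such as [c (t p)] are not elementary tensors. Both arguments are replaced by finite
   combinations, and [L] collects the tensors that these involve. *)
have close z z' (e : C) : 0 < e -> exists (L : seq (K * H)) (d : R), 0 < d /\
    forall X : bop T, (forall z, `|X z| <= M * `|z|) ->
      (forall p q, p \in L -> q \in L -> `|dot (X (t p)) (t q) - b p q| <= d%:C%C) ->
      `|dot (V z - X z) z'| <= e.
  move=> e0; have e3 : 0 < e / 2 / 2 by rewrite !divr_gt0.
  have k0 : 0 <= (M + M) * `|z'| by rewrite mulr_ge0// addr_ge0.
  have [n [a [r zy]]] := span_t z _ (div1_gt0 _ _ k0 e3).
  set y := \sum_i a i *: t (r i) in zy.
  have l0 : 0 <= (M + M) * `|y| by rewrite mulr_ge0// addr_ge0.
  have [n' [a' [r' zy']]] := span_t z' _ (div1_gt0 _ _ l0 e3).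
  set y' := \sum_i a' i *: t (r' i) in zy'.
  pose S := \sum_i \sum_j `|a i| * `|a' j|.
  have S0 : 0 <= S by apply: sumr_ge0 => i _; apply: sumr_ge0 => j _; rewrite mulr_ge0.
  have /gt0CP[d d0 dE] := div1_gt0 _ _ S0 (divr_gt0 e0 (ltr0Sn C 1)).
  exists (codom r ++ codom r'), d; split=> // X XM Xb.
  have DM w : `|V w - X w| <= (M + M) * `|w|.
    by rewrite (le_trans (ler_normB _ _))// mulrDl lerD.
  have -> : dot (V z - X z) z' = dot (V (z - y) - X (z - y)) z' +
      dot (V y - X y) (z' - y') + dot (V y - X y) y'.
    have -> : V (z - y) - X (z - y) = (V z - X z) - (V y - X y).
      by rewrite !blinB !opprB [X y - X z]addrC [X y - V y]addrC addrACA.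
    by rewrite -addrA -dotDr subrK [X in _ = X + _]dotBl subrK.
  rewrite [e]splitr (le_trans (ler_normD _ _))// lerD//.
    rewrite [e / 2]splitr (le_trans (ler_normD _ _))// lerD//.
      rewrite (le_trans (cauchy_schwarz _ _))// (le_trans (ler_wpM2r _ (DM _)))//.
      rewrite mulrAC (le_trans _ (mul_small _ _ k0 e3))// ler_wpM2l//.
    rewrite (le_trans (cauchy_schwarz _ _))// (le_trans (ler_wpM2r _ (DM _)))//.
    by rewrite (le_trans _ (mul_small _ _ l0 e3))// ler_wpM2l.
  rewrite (le_trans _ (mul_small _ _ S0 (divr_gt0 e0 (ltr0Sn C 1))))// dE /S mulr_suml.
  have -> : dot (V y - X y) y' = \sum_i \sum_j a i * (a' j)^* *
      (b (r i) (r' j) - dot (X (t (r i))) (t (r' j))).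
    rewrite /y !blin_sum -sumrB dot_suml; apply: eq_bigr => i _.
    rewrite !blinZ -scalerBr dotZl /y' dot_sumr mulr_sumr; apply: eq_bigr => j _.
    by rewrite dotZr dotBl Vb mulrA.
  rewrite (le_trans (ler_norm_sum _ _ _))// ler_sum// => i _.
  rewrite (le_trans (ler_norm_sum _ _ _))// mulr_suml ler_sum// => j _.
  rewrite !normrM norm_conjC ler_wpM2l ?mulr_ge0// distrC.
  by apply: Xb; rewrite mem_cat codom_f ?orbT.
apply: tens_form_ext => u h v k /=; rewrite -!/(t (_, _)).
set p := (u, h); set q := (v, k).
apply/eqP; rewrite -subr_eq0 -normr_le0; apply: limit => // e e0; rewrite add0r.
have e2 : 0 < e / 2 by rewrite divr_gt0.
have [L1 [d1 [d10 H1]]] := close (t p) (adjoint c (t q)) _ e2.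
have [L2 [d2 [d20 H2]]] := close (c (t p)) (t q) _ e2.
have d0 : 0 < (Num.min d1 d2)%:C%C :> C by rewrite ltcR lt_min d10.
have [X [XXX XM Xb]] := happ _ (tnth (in_tuple (L1 ++ L2))) _ d0.
have Xb' p' q' : p' \in L1 ++ L2 -> q' \in L1 ++ L2 ->
    `|dot (X (t p')) (t q') - b p' q'| <= (Num.min d1 d2)%:C%C.
  by move=> /(tnthP (in_tuple _))[i ->] /(tnthP (in_tuple _))[j ->]; exact: Xb.
have := H1 X XM; have := H2 X XM.
have -> : dot (c (V (t p))) (t q) - dot (V (c (t p))) (t q) =
    dot (V (t p) - X (t p)) (adjoint c (t q)) - dot (V (c (t p)) - X (c (t p))) (t q).
  rewrite !dotBl -!adjointP; have := congr1 (fun x : bop T => x (t p)) (cX X XXX).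
  by move=> /= ->; rewrite opprB addrA subrK.
move=> h2 h1; rewrite [e]splitr (le_trans (ler_normB _ _))// lerD//.
  apply: h1 => p' q' p'L q'L; rewrite (le_trans (Xb' _ _ _ _)) ?mem_cat ?p'L ?q'L//.
  by rewrite lecR ge_min lexx.
apply: h2 => p' q' p'L q'L; rewrite (le_trans (Xb' _ _ _ _)) ?mem_cat ?p'L ?q'L ?orbT//.
by rewrite lecR ge_min lexx orbT.
Qed.

End WeakLimits.

(** * Operator fields over a compact space *)

Section BlinCombinations.
Variables (R : realType) (E F : normedModType R[i]).
Local Notation C := R[i].

(** [blin] carries no module structure, so a linear combination of operators is described by its
    values; [predual_lin] is stated in the same way. *)
Lemma blin_lin_exists (k : C) (x y : blin E F) :
  exists w : blin E F, forall u, w u = k *: x u + y u.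
Proof.
apply: blin_exists => [c u v|].
  by rewrite !blinD !blinZ !scalerDr !scalerA mulrC addrACA.
have [M M0 xM] := blin_gt0 x; have [N N0 yN] := blin_gt0 y.
exists (`|k| * M + N) => u; rewrite (le_trans (ler_normD _ _))// mulrDl lerD//.
by rewrite normrZ -mulrA ler_wpM2l.
Qed.

Lemma blin_sub_exists (x y : blin E F) : exists w : blin E F, forall u, w u = x u - y u.
Proof.
by have [w wE] := blin_lin_exists (-1) y x; exists w => u; rewrite wE scaleN1r addrC.
Qed.

Lemma blin_sum_exists n (x : 'I_n -> blin E F) :
  exists w : blin E F, forall u, w u = \sum_i x i u.
Proof.
elim: n x => [|n IH] x; first by exists (blin_zero E F) => u; rewrite big_ord0.
have [w wE] := IH (fun i => x (lift ord0 i)).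
have [w' w'E] := blin_lin_exists 1 (x ord0) w.
by exists w' => u; rewrite w'E scale1r wE big_ord_recl.
Qed.

End BlinCombinations.

Section RankOne.
Variables (R : realType) (H : hilbert R).

Lemma rank1_exists (x y : H) : exists t : bop H, forall z, t z = dot z y *: x.
Proof.
apply: blin_exists => [c u v|]; first by rewrite dotDl dotZl scalerDl scalerA.
exists (`|x| * `|y|) => u; rewrite normrZ mulrC -mulrA ler_wpM2l// [leRHS]mulrC.
exact: cauchy_schwarz.
Qed.

Definition rank1 (x y : H) : bop H := sval (cid (rank1_exists x y)).

Lemma rank1E x y z : rank1 x y z = dot z y *: x.
Proof. exact: (svalP (cid (rank1_exists x y))). Qed.

Lemma adjoint_rank1 x y : adjoint (rank1 x y) = rank1 y x.
Proof.
by apply: adjoint_uniq => u v; rewrite !rank1E dotZl dotZr -dotC mulrC.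
Qed.

Lemma rank1_bound x y z : `|rank1 x y z| <= `|x| * `|y| * `|z|.
Proof.
rewrite rank1E normrZ mulrC -mulrA ler_wpM2l// mulrC.
exact: cauchy_schwarz.
Qed.

End RankOne.

Section FunctionAlgebra.
Variables (R : realType) (X : topologicalType).
Local Notation C := R[i].
Local Notation A := (cb_algebra R X).
Hypothesis cX : compact [set: X].

Definition cb_one : cbfun R X := mkcb cX (@cst_continuous X R[i]^o 1).

Lemma cb_one_unit : is_unit (cb_one : A).
Proof. by move=> a; split; apply: cbfun_inj => x /=; rewrite ?mul1r ?mulr1. Qed.

Lemma cb_unit_eq (e : A) : is_unit e -> e = cb_one :> cbfun R X.
Proof. by move=> eU; rewrite -[LHS](cb_one_unit e).2 (eU _).1. Qed.

Lemma cb_sq_complement (a : A) : `|a| < 1 ->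
  exists b : A, cmul (cstar b) b = (cb_one : A) - cmul (cstar a) a.
Proof.
move=> a1; pose f : cbfun R X := (cb_one : A) - cmul (cstar a) a.
have fE x : f x = 1 - `|(a : cbfun R X) x| ^+ 2 by rewrite /f normCKC.
have [|g gE] := cb_sqrt cX (f := f).
  move=> x; rewrite fE subr_ge0 exprn_ile1//.
  by rewrite (le_trans (cb_norm_ge _ _))// ltW.
exists g; apply: cbfun_inj => x /=; have [g0 gg] := gE x.
by rewrite geC0_conj// gg.
Qed.

Lemma cb_star_hom_bound (H : hilbert R) (f : A -> bop H) : star_hom f ->
  forall a u, `|f a u| <= `|a| * `|u|.
Proof. by move=> fh; exact: star_hom_bound fh _ cb_one_unit cb_sq_complement. Qed.

Lemma cb_le_norm (f : cbfun R X) (M : C) : 0 <= M -> (forall x, `|f x| <= M) -> `|f : A| <= M.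
Proof. exact: cb_norm_le. Qed.

Lemma cb_sumE I r (P : pred I) (f : I -> cbfun R X) x :
  (\sum_(i <- r | P i) f i : cbfun R X) x = \sum_(i <- r | P i) f i x.
Proof. by elim/big_rec2: _ => // i y1 y2 _ <-. Qed.

End FunctionAlgebra.

(** * Integrated operators of weakly continuous fields *)

Section FieldOperators.
Variables (R : realType) (X : topologicalType).
Local Notation C := R[i].
Local Notation A := (cb_algebra R X).
Hypothesis cX : compact [set: X].
Variables (U : univ_rep A) (H : hilbert R) (T : htensor U H).

Let rh := rep_star_hom U.

Lemma rep_bound (a : A) u : `|rep U a u| <= `|a| * `|u|.
Proof. exact: cb_star_hom_bound. Qed.

Lemma rep_close (f g : cbfun R X) (e : C) u v : 0 <= e ->
  (forall x, `|f x - g x| <= e) ->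
  `|dot (rep U f u) v - dot (rep U g u) v| <= e * `|u| * `|v|.
Proof.
move=> e0 fg; rewrite -dotBl -(star_homB rh).
rewrite (le_trans (cauchy_schwarz _ _))// ler_wpM2r//.
rewrite (le_trans (rep_bound _ _))// ler_wpM2r//.
exact: cb_le_norm.
Qed.

Definition wot_continuous (p : X -> bop H) :=
  forall h k, continuous (fun s => dot (p s h) k : R[i]^o).

(** Quantifying over a bounded continuous [g] with the right values keeps continuity proofs out of
    the definition. The entries of [V] depend on [u] and [v] only through the functional
    [a |-> <rep a u, v>]. *)
Definition is_field_op (p : X -> bop H) (V : bop T) :=
  forall u h v k (g : cbfun R X), (forall s, g s = dot (p s h) k) ->
    dot (V (tens T u h)) (tens T v k) = dot (rep U g u) v.

Lemma field_approx (p : X -> bop H) (pc : wot_continuous p) (M : C) : 0 <= M ->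
  (forall s h, `|p s h| <= M * `|h|) ->
  forall n (q : 'I_n -> U * H) (e : C), 0 < e -> exists W : bop T,
    [/\ exists m (phi : 'I_m -> A) (s : 'I_m -> X), forall z,
          W z = \sum_a tens_op T (rep U (phi a)) (p (s a)) z,
        forall z, `|W z| <= M * `|z| &
        forall i j, `|dot (W (tens T (q i).1 (q i).2)) (tens T (q j).1 (q j).2)
          - dot (rep U (mkcb cX (pc (q i).2 (q j).2)) (q i).1) (q j).1| <= e].
Proof.
move=> M0 pM n q e e0.
pose S := \sum_i \sum_j `|(q i).1| * `|(q j).1|.
have S0 : 0 <= S by apply: sumr_ge0 => i _; apply: sumr_ge0 => j _; rewrite mulr_ge0.
have /gt0CP[d d0 dE] : 0 < e / (S + 1) by rewrite divr_gt0// ltr_wpDl.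
pose c i j : cbfun R X := mkcb cX (pc (q i).2 (q j).2).
(* The gauge adds the variations of all coefficients attached to [q], so each function of the
   partition is supported where every one of them is nearly constant. *)
pose D s s' : R := \sum_i \sum_j complex.Re `|c i j s - c i j s'|.
have Dc s : continuous (D s : X -> R^o).
  apply: (@continuous_sum R R^o) => i; apply: (@continuous_sum R R^o) => j.
  apply: continuous_Re => s'.
  apply: (@continuous_comp _ _ _ (fun s' => c i j s - c i j s' : R[i]^o) (fun z => `|z| : R[i]^o)).
    apply: (@continuousB R[i] R[i]^o); first exact: cst_continuous.
    exact: cb_continuous.
  exact: norm_continuous.
have Dss s : D s s = 0.
  by apply: big1 => i _; apply: big1 => j _; rewrite subrr normr0.
have [m [phi [s [phi0 phi1 phiD]]]] := partition_unity cX d0 Dc Dss.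
have phic a i j x : phi a x != 0 -> `|c i j (s a) - c i j x| <= d%:C%C.
  move=> /phiD; rewrite -[`|_|]RRe_real ?normr_real// lecR => /ltW; apply: le_trans.
  have r0 i' j' : 0 <= complex.Re `|c i' j' (s a) - c i' j' x|.
    by rewrite -lecR RRe_real ?normr_real ?normr_ge0.
  rewrite /D (bigD1 i isT)/= [X in _ <= X + _](bigD1 j isT)/= -addrA lerDl addr_ge0//.
    by apply: sumr_ge0 => j' _; exact: r0.
  by apply: sumr_ge0 => i' _; apply: sumr_ge0 => j' _; exact: r0.
(* Square roots of the partition write [W] as [sum_a P_a Q_a P_a] with [P_a] self-adjoint and
   [sum_a P_a^2 = 1]. This keeps the norm at most [M], however many terms there are. *)
have [psi psiE] : exists psi : 'I_m -> cbfun R X, forall a x,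
    0 <= psi a x /\ psi a x * psi a x = phi a x.
  exists (fun a => sval (cid (cb_sqrt cX (phi0 a)))) => a.
  exact: (svalP (cid (cb_sqrt cX (phi0 a)))).
have psi_star a : cstar (psi a : A) = psi a :> A.
  by apply: cbfun_inj => x /=; rewrite geC0_conj//; have [] := psiE a x.
have psi_sq a : cmul (psi a : A) (psi a) = phi a :> A.
  by apply: cbfun_inj => x /=; have [] := psiE a x.
have [W WE] := blin_sum_exists (fun a => tens_op T (rep U (phi a)) (p (s a))).
pose P a := tens_op T (rep U (psi a)) (blin_id H).
pose Q a := tens_op T (blin_id U) (p (s a)).
have PQP a z : tens_op T (rep U (phi a)) (p (s a)) z = P a (Q a (P a z)).
  suff -> : tens_op T (rep U (phi a)) (p (s a)) =
      blin_comp (P a) (blin_comp (Q a) (P a)) by [].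
  apply: tens_op_ext => u h.
  by rewrite /= !tens_opE/= -psi_sq (star_homM rh).
have Padj a z z' : dot (P a z) z' = dot z (P a z').
  rewrite adjointP tens_op_adjoint; congr (dot _ (tens_op _ _ _ _)).
    by apply: adjoint_uniq => u v; rewrite (star_hom_dot rh) psi_star.
  exact: adjoint_uniq.
have PP z : \sum_a `|P a z| ^+ 2 = `|z| ^+ 2.
  have [Y YE] := blin_sum_exists (fun a => blin_comp (P a) (P a)).
  have : Y = blin_id T.
    apply: tens_op_ext => u h; rewrite YE /=.
    transitivity (tens T (rep U (cb_one R cX : A) u) h); last first.
      by rewrite (rep_unit (@cb_one_unit R X cX)).
    have -> : (cb_one R cX : A) = \sum_a (phi a : A).
      by apply: cbfun_inj => x; rewrite cb_sumE phi1.
    rewrite (star_hom_sum rh) tens_suml; apply: eq_bigr => a _.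
    by rewrite !tens_opE/= -psi_sq (star_homM rh).
  move=> /(congr1 (fun Y : bop T => dot (Y z) z)) /=.
  rewrite YE dot_suml -dot_norm => <-; apply: eq_bigr => a _ /=.
  by rewrite Padj dot_norm.
have QM a z : `|Q a z| <= M * `|z|.
  have := @tens_op_bound R U H T (blin_id U) (p (s a)) 1 M ler01 M0 _ (pM _) z.
  by rewrite mul1r; apply => u; rewrite mul1r.
have form z z' : `|dot (W z) z'| <= M / 2 * (`|z| ^+ 2 + `|z'| ^+ 2).
  rewrite WE dot_suml (le_trans (ler_norm_sum _ _ _))//.
  rewrite -(PP z) -(PP z') -big_split mulr_sumr ler_sum// => a _.
  rewrite PQP Padj (le_trans (cauchy_schwarz _ _))//.
  rewrite (le_trans (ler_wpM2r _ (QM _ _)))// -!mulrA ler_wpM2l//.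
  rewrite ler_pdivlMl// -subr_ge0.
  have -> : `|P a z| ^+ 2 + `|P a z'| ^+ 2 - 2 * (`|P a z| * `|P a z'|) =
    (`|P a z| - `|P a z'|) ^+ 2 by ring.
  by rewrite real_exprn_even_ge0// rpredB// normr_real.
exists W; split.
- by exists m, phi, s.
- move=> z; have [Wz0|Wz0] := eqVneq `|W z| 0; first by rewrite Wz0 mulr_ge0.
  have Wz : 0 < `|W z| by rewrite lt_def Wz0 normr_ge0.
  have [z0|z0] := eqVneq `|z| 0.
    by move/eqP: z0; rewrite normr_eq0 => /eqP ->; rewrite blin0 !normr0 mulr0.
  have zp : 0 < `|z| by rewrite lt_def z0 normr_ge0.
  (* Rescaling [W z] to the norm of [z] turns the additive bound [form] into the multiplicative
     one. *)
  have := form z ((`|z| / `|W z|) *: W z).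
  rewrite dotZr -dot_norm normrM normrX normr_id norm_conjC ger0_norm ?divr_ge0//.
  rewrite expr2 mulrA divfK// normrZ ger0_norm ?divr_ge0// divfK//.
  have -> : M / 2 * (`|z| ^+ 2 + `|z| ^+ 2) = `|z| * (M * `|z|) by field.
  by rewrite ler_pM2l.
move=> i j.
have -> : dot (W (tens T (q i).1 (q i).2)) (tens T (q j).1 (q j).2) =
    dot (rep U (\sum_a c i j (s a) *: (phi a : A)) (q i).1) (q j).1.
  rewrite WE (star_hom_sum rh) !dot_suml; apply: eq_bigr => a _.
  by rewrite tens_opE tens_dot (star_homZ rh) dotZl mulrC.
rewrite (le_trans (@rep_close _ _ d%:C%C _ _ _ _))//.
- by rewrite lecR ltW.
- move=> x; rewrite cb_sumE -[X in _ - X]mul1r -(phi1 x) mulr_suml -sumrB.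
  rewrite (le_trans (ler_norm_sum _ _ _))//.
  rewrite -[leRHS]mul1r -(phi1 x) mulr_suml ler_sum// => a _.
  have -> : (c i j (s a) *: (phi a : A) : cbfun R X) x - phi a x * c i j x =
      phi a x * (c i j (s a) - c i j x) by rewrite mulrBr; congr (_ - _); rewrite mulrC.
  rewrite normrM ger0_norm//.
  have [->|p0] := eqVneq (phi a x) 0; first by rewrite !mul0r.
  by rewrite ler_wpM2l// phic.
rewrite -dE -mulrA (@le_trans _ _ (e / (S + 1) * S))//.
  rewrite ler_wpM2l ?divr_ge0 ?(ltW e0) ?addr_ge0//.
  rewrite /S (bigD1 i isT)/= [X in _ <= X + _](bigD1 j isT)/= -addrA lerDl.
  apply: addr_ge0; apply: sumr_ge0 => i' _.
    by rewrite mulr_ge0.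
  by apply: sumr_ge0 => j' _; rewrite mulr_ge0.
by rewrite mulrAC ler_pdivrMr ?ltr_wpDl// ler_wpM2l ?lerDl ?(ltW e0).
Qed.

Lemma field_op_exists (p : X -> bop H) (M : C) : wot_continuous p -> 0 <= M ->
  (forall s h, `|p s h| <= M * `|h|) -> exists V : bop T,
  [/\ is_field_op p V, forall z, `|V z| <= M * `|z| &
    forall N : set (bop H), (forall s, N (p s)) -> vn_tensor (@bidual R A U) N V].
Proof.
move=> pc M0 pM.
have [V [Vb VM Vc]] := weak_limit_op
  (b := fun q q' => dot (rep U (mkcb cX (pc q.2 q'.2)) q.1) q'.1)
  M0 (field_approx pc M0 pM).
exists V; split=> // [u h v k g gE|N Np c cP].
  rewrite (Vb (u, h) (v, k)) /=; congr (dot (rep U _ u) v).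
  by apply: cbfun_inj => s; rewrite gE.
apply: Vc => W [m [phi [s WE]]]; apply: blinP => z /=.
rewrite !WE blin_sum; apply: eq_bigr => a _.
have cE : blin_comp (tens_op T (rep U (phi a)) (p (s a))) c =
    blin_comp c (tens_op T (rep U (phi a)) (p (s a))).
  apply: cP; exists (rep U (phi a)), (p (s a)); split=> //.
    exact: rep_bidual.
  exact: tens_opP.
exact: (congr1 (fun x : bop T => x z) (esym cE)).
Qed.

Lemma field_op_uniq (p : X -> bop H) V V' : wot_continuous p ->
  is_field_op p V -> is_field_op p V' -> V = V'.
Proof.
move=> pc pV pV'; apply: tens_form_ext => u h v k.
by rewrite (pV _ _ _ _ (mkcb cX (pc h k)))// (pV' _ _ _ _ (mkcb cX (pc h k))).
Qed.

Lemma field_op_bound (p : X -> bop H) V (M : C) : wot_continuous p ->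
  is_field_op p V -> 0 <= M -> (forall s h, `|p s h| <= M * `|h|) ->
  forall z, `|V z| <= M * `|z|.
Proof.
move=> pc pV M0 pM; have [V' [pV' V'M _]] := field_op_exists pc M0 pM.
by rewrite (field_op_uniq pc pV pV').
Qed.

Lemma field_op_adjoint (p : X -> bop H) V : is_field_op p V ->
  is_field_op (fun s => adjoint (p s)) (adjoint V).
Proof.
move=> pV u h v k g gE; rewrite dot_adjoint dotC (pV _ _ _ _ (cstar (g : A))).
  by rewrite (star_hom_dot rh) cstarK -dotC.
by move=> s /=; rewrite gE dot_adjoint -dotC.
Qed.

Lemma field_op_sub (p q r : X -> bop H) (V V' W : bop T) : wot_continuous p -> wot_continuous q ->
  is_field_op p V -> is_field_op q V' -> (forall s h, r s h = p s h - q s h) ->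
  (forall z, W z = V z - V' z) -> is_field_op r W.
Proof.
move=> pc qc pV qV' rE WE u h v k g gE; rewrite WE dotBl.
rewrite (pV _ _ _ _ (mkcb cX (pc h k)))// (qV' _ _ _ _ (mkcb cX (qc h k)))//.
rewrite -dotBl -(star_homB rh); congr (dot (rep U _ u) v).
by apply: cbfun_inj => s; rewrite gE rE dotBl.
Qed.

(** Composition is not jointly continuous for the weak operator topology. Strong continuity of [q]
    lets [W (u (x) h)] be approximated in norm by finite sums of tensors [rep phi_a u (x) q s_a h],
    on which the entries of [V] are known. *)
Lemma field_op_comp (p q : X -> bop H) V W (M : C) :
  wot_continuous p -> is_field_op p V ->
  0 <= M -> (forall s h, `|p s h| <= M * `|h|) ->
  wot_continuous q -> is_field_op q W ->
  (forall s h, continuous (fun s' => complex.Re `|q s h - q s' h| : R^o)) ->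
  is_field_op (fun s => blin_comp (p s) (q s)) (blin_comp V W).
Proof.
move=> pc pV M0 pM qc qW qs u h v k g gE /=.
have [hz|h0] := eqVneq h 0.
  rewrite hz in gE *; rewrite tens0r !blin0 dot0l; have -> : g = 0.
    by apply: cbfun_inj => s; rewrite gE blin0 dot0l.
  by rewrite (star_hom0 rh) dot0l.
apply/eqP; rewrite -subr_eq0 -normr_le0.
have [r r0 rE] := @normCP R R[i]^o (dot (V (W (tens T u h))) (tens T v k) - dot (rep U g u) v).
rewrite rE lecR; apply/ler_addgt0Pr => e e0; rewrite add0r -lecR -rE.
pose N := M * `|u| * `|v| * `|k|.
have N0 : 0 <= N by rewrite !mulr_ge0.
have eC : 0 < e%:C%C / 2 :> C by rewrite divr_gt0// ltcR.
have /gt0CP[d d0 dE] : 0 < e%:C%C / 2 / (N + 1) :> C by rewrite divr_gt0// ltr_wpDl.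
have d0' : 0 <= d%:C%C :> C by rewrite lecR ltW.
have dN : d%:C%C * N <= e%:C%C / 2 :> C.
  by rewrite -dE mulrAC ler_pdivrMr ?ltr_wpDl// ler_wpM2l ?lerDl ?(ltW eC).
pose D s s' : R := complex.Re `|q s h - q s' h|.
have Dss s : D s s = 0 by rewrite /D subrr normr0.
have [m [phi [s [phi0 phi1 phiD]]]] := partition_unity cX d0 (fun s => qs s h) Dss.
have phiq a x : phi a x != 0 -> `|q (s a) h - q x h| <= d%:C%C.
  by move=> /phiD/ltW; rewrite -lecR RRe_real ?normr_real.
pose y := \sum_a tens T (rep U (phi a) u) (q (s a) h).
pose rr x := q x h - \sum_a phi a x *: q (s a) h.
have rd x : `|rr x| <= d%:C%C.
  rewrite /rr -{1}[q x h]scale1r -(phi1 x) scaler_suml -sumrB.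
  rewrite (le_trans (ler_norm_sum _ _ _))//.
  rewrite -[leRHS]mul1r -(phi1 x) mulr_suml ler_sum// => a _.
  rewrite -scalerBr normrZ ger0_norm// distrC.
  have [->|p0] := eqVneq (phi a x) 0; first by rewrite !mul0r.
  by rewrite ler_wpM2l// phiq.
have rc k' : continuous (fun x => dot (rr x) k' : R[i]^o).
  rewrite (_ : (fun x => _) = fun x => dot (q x h) k' - \sum_a phi a x * dot (q (s a) h) k').
    have sc : continuous (fun x => \sum_a phi a x * dot (q (s a) h) k' : R[i]^o).
      apply: (@continuous_sum R[i] R[i]^o) => a x.
      by apply: cvgM; [exact: cb_continuous|exact: cvg_cst].
    by move=> x; apply: (@cvgB R[i] R[i]^o); [exact: qc|exact: sc].
  apply/funext => x; rewrite dotBl dot_suml; congr (_ - _).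
  by apply: eq_bigr => a _; rewrite dotZl.
have Wy : `|W (tens T u h) - y| <= d%:C%C * `|u|.
  (* [h1] satisfies [<h, h1> = 1] and [|h1| |h| = 1]. The rank-one field [t] therefore maps [h] to
     the remainder [rr], and its integrated operator carries the small bound over without loss. The
     case [h = 0] was treated separately for this. *)
  pose h1 := (dot h h)^-1 *: h.
  have hh : 0 < dot h h by rewrite dnorm_gt0.
  have hh1 : dot h h1 = 1 :> C.
    by rewrite dotZr fmorphV/= -dotC mulVf// gt_eqF.
  have hn : `|h1| * `|h| = 1.
    rewrite normrZ normfV ger0_norm// -dot_norm -mulrA -expr2 dot_norm mulVf//.
    by rewrite gt_eqF.
  pose t x := rank1 (rr x) h1.
  have tM x z : `|t x z| <= d%:C%C * `|h1| * `|z|.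
    rewrite (le_trans (rank1_bound _ _ _))// ler_wpM2r// ler_wpM2r//.
  have tc : wot_continuous t.
    move=> z k'; rewrite (_ : (fun x => _) = fun x => dot z h1 * dot (rr x) k').
      by move=> x; apply: cvgM; [exact: cvg_cst|exact: rc].
    by apply/funext => x; rewrite /t rank1E dotZl.
  have [|Z [tZ ZM _]] := field_op_exists tc _ tM; first by rewrite mulr_ge0.
  have -> : W (tens T u h) - y = Z (tens T u h).
    apply: tens_ext => v' k'; rewrite dotBl (qW _ _ _ _ (mkcb cX (qc h k')))//.
    rewrite (tZ _ _ _ _ (mkcb cX (tc h k')))// /y dot_suml.
    have -> : \sum_a dot (tens T (rep U (phi a) u) (q (s a) h)) (tens T v' k') =
        dot (rep U (\sum_a dot (q (s a) h) k' *: (phi a : A)) u) v'.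
      rewrite (star_hom_sum rh) dot_suml; apply: eq_bigr => a _.
      by rewrite tens_dot (star_homZ rh) dotZl mulrC.
    rewrite -dotBl -(star_homB rh); congr (dot (rep U _ u) v').
    apply: cbfun_inj => x; rewrite /= /t rank1E hh1 scale1r dotBl dot_suml.
    congr (_ - _); rewrite cb_sumE; apply: eq_bigr => a _.
    by rewrite dotZl mulrC.
  rewrite (le_trans (ZM _))// norm_tens -mulrA [`|h1| * _]mulrCA hn mulr1.
  by [].
have -> : dot (V (W (tens T u h))) (tens T v k) - dot (rep U g u) v =
    dot (V (W (tens T u h) - y)) (tens T v k) +
    (dot (V y) (tens T v k) - dot (rep U g u) v).
  by rewrite blinB dotBl addrA subrK.
rewrite [e%:C%C]splitr (le_trans (ler_normD _ _))// lerD//.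
  rewrite (le_trans (cauchy_schwarz _ _))// norm_tens.
  have VM := field_op_bound pc pV M0 pM.
  rewrite (@le_trans _ _ (M * (d%:C%C * `|u|) * (`|v| * `|k|)))//.
    by rewrite ler_wpM2r ?mulr_ge0// (le_trans (VM _))// ler_wpM2l.
  by rewrite (le_trans _ dN)// /N le_eqVlt; apply/orP; left; apply/eqP; ring.
have -> : dot (V y) (tens T v k) =
    dot (rep U (\sum_a cmul (mkcb cX (pc (q (s a) h) k) : A) (phi a : A)) u) v.
  rewrite /y blin_sum dot_suml (star_hom_sum rh) dot_suml; apply: eq_bigr => a _.
  by rewrite (pV _ _ _ _ (mkcb cX (pc (q (s a) h) k)))// (star_homM rh).
rewrite (le_trans (@rep_close _ _ (M * d%:C%C * `|k|) _ _ _ _))//.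
- by rewrite !mulr_ge0.
- move=> x; have -> : (\sum_a cmul (mkcb cX (pc (q (s a) h) k) : A) (phi a : A) : cbfun R X) x
      - g x = dot (p x (- rr x)) k.
    rewrite cb_sumE gE /rr opprB blinB dotBl blin_sum dot_suml; congr (_ - _).
    by apply: eq_bigr => a _; rewrite blinZ dotZl /= mulrC.
  rewrite (le_trans (cauchy_schwarz _ _))// ler_wpM2r//.
  by rewrite (le_trans (pM _ _))// normrN ler_wpM2l.
by rewrite (le_trans _ dN)// /N le_eqVlt; apply/orP; left; apply/eqP; ring.
Qed.

End FieldOperators.

(** * Slices, preduals and operator topologies *)

Section Slices.
Variables (R : realType) (K H : hilbert R) (T : htensor K H).
Local Notation C := R[i].

Lemma vec_slice_exists (V : bop T) (M : C) u v : 0 <= M ->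
  (forall z, `|V z| <= M * `|z|) -> exists W : bop H,
  (forall h k, dot (W h) k = dot (V (tens T u h)) (tens T v k)) /\
  forall h, `|W h| <= M * `|u| * `|v| * `|h|.
Proof.
move=> M0 VM; apply: op_of_form; last by rewrite !mulr_ge0.
- by move=> c h h' k; rewrite tensDr tensZr blinD blinZ dotDl dotZl.
- by move=> c h k k'; rewrite tensDr tensZr dotDr dotZr.
move=> h k; rewrite (le_trans (cauchy_schwarz _ _))// norm_tens.
rewrite (le_trans (ler_wpM2r _ (VM _))) ?mulr_ge0// norm_tens.
by rewrite le_eqVlt; apply/orP; left; apply/eqP; ring.
Qed.

Lemma vec_sliceP (V : bop T) u v h k :
  dot (vec_slice V u v h) k = dot (V (tens T u h)) (tens T v k).
Proof.
have [M M0 VM] := blin_gt0 V.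
have [W [WE _]] := vec_slice_exists u v (ltW M0) VM.
apply: (getPex (P := [set W : bop H | forall h k,
  dot (W h) k = dot (V (tens T u h)) (tens T v k)])).
by exists W.
Qed.

Lemma vec_slice_bound (V : bop T) (M : C) u v : 0 <= M ->
  (forall z, `|V z| <= M * `|z|) ->
  forall h, `|vec_slice V u v h| <= M * `|u| * `|v| * `|h|.
Proof.
move=> M0 VM; have [W [WE WM]] := vec_slice_exists u v M0 VM.
suff -> : vec_slice V u v = W by [].
by apply: blinP => h; apply: dot_ext => k; rewrite vec_sliceP WE.
Qed.

Lemma vec_slice_eq (V : bop T) u v (W : bop H) :
  (forall h k, dot (V (tens T u h)) (tens T v k) = dot (W h) k) -> vec_slice V u v = W.
Proof.
by move=> VW; apply: blinP => h; apply: dot_ext => k; rewrite vec_sliceP VW.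
Qed.

End Slices.

(** * Normal functionals *)

Section Preduals.
Variables (R : realType) (H : hilbert R).
Local Notation C := R[i].

(** The tails are controlled by [2 |h| |k| <= |h|^2 + |k|^2] and square-summability: uniformly on
    bounded sets of operators, a normal functional is close to a finite sum of vector functionals.
    Linearity, boundedness and continuity of normal functionals are derived from this. *)
Lemma predual_approx (w : predual H) (e : C) : 0 < e ->
  exists N (h k : 'I_N -> H), forall (x : bop H) (M : C), 0 <= M ->
    (forall u, `|x u| <= M * `|u|) -> `|w x - \sum_i dot (x (h i)) (k i)| <= M * e.
Proof.
move=> e0; have [h [k [hc kc wE]]] := predual_normal w.
have tail (f : nat -> H) (d : C) : 0 < d -> cvgn (series (fun n => `|f n| ^+ 2 : R[i]^o)) ->
    exists N, forall n, (N <= n)%N -> \sum_(N <= j < n) `|f j| ^+ 2 <= d.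
  move=> d0 /cvg_ex[l fl].
  have d2 : 0 < d / 2 by rewrite divr_gt0.
  have [N _ HN] := (@cvgrPdist_le _ R[i]^o _ _ _ _ _).1 fl _ d2.
  exists N => n Nn; have := HN n Nn; have := HN N (leqnn N).
  rewrite /series/= => lN ln.
  have : `|\sum_(N <= j < n) `|f j| ^+ 2| <= d.
    have -> : \sum_(N <= j < n) `|f j| ^+ 2 =
        (l - \sum_(0 <= j < N) `|f j| ^+ 2) - (l - \sum_(0 <= j < n) `|f j| ^+ 2).
      by rewrite [X in _ = _ - (l - X)](big_cat_nat (n := N))//=; ring.
    by rewrite [d]splitr (le_trans (ler_normB _ _))// lerD.
  by rewrite ger0_norm// sumr_ge0// => j _; rewrite exprn_ge0.
have e2 : 0 < e / 2 by rewrite divr_gt0.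
have [N1 hN1] := tail h _ e2 hc; have [N2 kN2] := tail k _ e2 kc.
pose N := maxn N1 N2.
have hN n : \sum_(N <= j < n) `|h j| ^+ 2 <= e / 2.
  have [nN|Nn] := leqP n N; first by rewrite big_geq// ltW.
  apply: le_trans (hN1 n (leq_trans (leq_maxl _ _) (ltnW Nn))).
  rewrite [leRHS](big_cat_nat (n := N)) ?leq_maxl ?(ltnW Nn)//= lerDr.
  by rewrite sumr_ge0// => j _; rewrite exprn_ge0.
have kN n : \sum_(N <= j < n) `|k j| ^+ 2 <= e / 2.
  have [nN|Nn] := leqP n N; first by rewrite big_geq// ltW.
  apply: le_trans (kN2 n (leq_trans (leq_maxr _ _) (ltnW Nn))).
  rewrite [leRHS](big_cat_nat (n := N)) ?leq_maxr ?(ltnW Nn)//= lerDr.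
  by rewrite sumr_ge0// => j _; rewrite exprn_ge0.
exists N, h, k => x M M0 xM.
have [r r0 rE] := @normCP R R[i]^o (w x - \sum_(i < N) dot (x (h i)) (k i)).
have [m MeE] : exists m, M * e = m%:C%C.
  by exists (complex.Re (M * e)); rewrite RRe_real// ger0_real// mulr_ge0// ltW.
rewrite rE MeE lecR; apply/ler_addgt0Pr => d d0.
rewrite -lecR (rmorphD (real_complex R))/= -MeE -rE [leRHS]addrC.
have d0' : 0 < d%:C%C :> C by rewrite ltcR.
have [N' _ HN'] := (@cvgrPdist_le _ R[i]^o _ _ _ _ _).1 (wE x) _ d0'.
pose n := maxn N N'.
have := HN' n (leq_maxr _ _); rewrite /series/= => wn.
rewrite -(subrKA (\sum_(0 <= j < n) dot (x (h j)) (k j))) (le_trans (ler_normD _ _))// lerD//.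
have -> : \sum_(0 <= j < n) dot (x (h j)) (k j) =
    \sum_(i < N) dot (x (h i)) (k i) + \sum_(N <= j < n) dot (x (h j)) (k j).
  by rewrite (big_cat_nat (n := N)) ?leq_maxl//= big_mkord.
rewrite addrAC subrr add0r.
rewrite (le_trans (ler_norm_sum _ _ _))//.
rewrite (@le_trans _ _ (\sum_(N <= j < n) M / 2 * (`|h j| ^+ 2 * 2 / 2 + `|k j| ^+ 2)))//.
  apply: ler_sum => j _; rewrite (le_trans (cauchy_schwarz _ _))//.
  rewrite (le_trans (ler_wpM2r _ (xM _)))// -!mulrA ler_wpM2l//.
  rewrite divff ?pnatr_eq0// mulr1 ler_pdivlMl// -subr_ge0.
  have -> : `|h j| ^+ 2 + `|k j| ^+ 2 - 2 * (`|h j| * `|k j|) = (`|h j| - `|k j|) ^+ 2 by ring.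
  by rewrite real_exprn_even_ge0// rpredB// normr_real.
rewrite -mulr_sumr -mulrA ler_wpM2l// ler_pdivrMl// mulr_natl mulr2n.
have -> : \sum_(N <= i < n) (`|h i| ^+ 2 * 2 / 2 + `|k i| ^+ 2) =
    \sum_(N <= i < n) `|h i| ^+ 2 + \sum_(N <= i < n) `|k i| ^+ 2.
  rewrite -big_split/=; apply: eq_bigr => i _.
  by rewrite mulfK// pnatr_eq0.
rewrite (le_trans (lerD (hN n) (kN n)))// -splitr lerDl.
exact: ltW.
Qed.

Lemma vec_predual N (h k : 'I_N -> H) :
  exists w : predual H, forall x, w x = \sum_i dot (x (h i)) (k i).
Proof.
pose ext (f : 'I_N -> H) n : H := if insub n is Some i then f i else 0.
have extE f (i : 'I_N) : ext f i = f i by rewrite /ext (valK i).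
have extN f n : (N <= n)%N -> ext f n = 0.
  by move=> Nn; rewrite /ext insubF// ltnNge Nn.
have ser (f : nat -> C) : (forall n, (N <= n)%N -> f n = 0) ->
    series (f : nat -> R[i]^o) @ \oo --> (\sum_(i < N) f i : R[i]^o).
  move=> f0; apply/cvgrPdist_le => e e0; exists N => // n /= Nn.
  rewrite /series/= (big_cat_nat (n := N))//= big_mkord.
  have -> : \sum_(N <= i < n) f i = 0.
    by apply: big1_seq => j /andP[_]; rewrite mem_index_iota => /andP[Nj _]; exact: f0.
  by rewrite addr0 subrr normr0 ltW.
have wP : exists h' k' : nat -> H,
    [/\ cvgn (series (fun n => `|h' n| ^+ 2 : R[i]^o)),
        cvgn (series (fun n => `|k' n| ^+ 2 : R[i]^o)) &
        forall x : bop H, series (fun n => dot (x (h' n)) (k' n) : R[i]^o) @ \oo -->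
          (\sum_i dot (x (h i)) (k i) : R[i]^o)].
  exists (ext h), (ext k); split.
  - apply/cvg_ex; eexists; apply: (ser (fun n => `|ext h n| ^+ 2)) => n Nn.
    by rewrite extN// normr0 expr0n.
  - apply/cvg_ex; eexists; apply: (ser (fun n => `|ext k n| ^+ 2)) => n Nn.
    by rewrite extN// normr0 expr0n.
  - move=> x; have -> : \sum_i dot (x (h i)) (k i) = \sum_(i < N) dot (x (ext h i)) (ext k i).
      by apply: eq_bigr => i _; rewrite !extE.
    apply: (ser (fun n => dot (x (ext h n)) (ext k n))) => n Nn.
    by rewrite extN// blin0 dot0l.
by exists (Predual wP).
Qed.

Lemma predual_le (w : predual H) : exists2 c : C, 0 < c &
  forall (x : bop H) (M : C), 0 <= M -> (forall u, `|x u| <= M * `|u|) -> `|w x| <= M * c.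
Proof.
have [N [h [k wE]]] := predual_approx w ltr01.
exists (\sum_i `|h i| * `|k i| + 1) => [|x M M0 xM].
  by rewrite ltr_wpDl// sumr_ge0// => i _; rewrite mulr_ge0.
rewrite -[w x](subrK (\sum_i dot (x (h i)) (k i))) addrC (le_trans (ler_normD _ _))//.
rewrite mulrDr lerD//; last exact: wE.
rewrite (le_trans (ler_norm_sum _ _ _))// mulr_sumr ler_sum// => i _.
by rewrite (le_trans (cauchy_schwarz _ _))// mulrA ler_wpM2r.
Qed.

Lemma approx_eq (a b : C) : (forall e : C, 0 < e -> `|a - b| <= e) -> a = b.
Proof.
move=> ab; apply/eqP; rewrite -subr_eq0 -normr_le0.
have [r r0 rE] := @normCP R R[i]^o (a - b).
rewrite rE lecR; apply/ler_addgt0Pr => d d0; rewrite add0r -lecR -rE.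
by apply: ab; rewrite ltcR.
Qed.

Lemma predual_lin (w : predual H) (k : C) (x y z : bop H) :
  (forall u, z u = k *: x u + y u) -> w z = k * w x + w y.
Proof.
move=> zE; apply: approx_eq => e e0.
have [M M0 xM] := blin_gt0 x; have [M' M'0 yM] := blin_gt0 y.
pose Q := (`|k| * M + M') + (`|k| * M + M') .
have L0 : 0 < `|k| * M + M' by rewrite ltr_wpDl// mulr_ge0// ltW.
have Q0 : 0 < Q by rewrite addr_gt0.
have zM u : `|z u| <= (`|k| * M + M') * `|u|.
  rewrite zE (le_trans (ler_normD _ _))// mulrDl lerD// normrZ -mulrA.
  by rewrite ler_wpM2l.
have [N [h [g wE]]] := predual_approx w (divr_gt0 e0 Q0).
pose S (x : bop H) := \sum_i dot (x (h i)) (g i).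
have SE : S z = k * S x + S y.
  rewrite /S mulr_sumr -big_split/=; apply: eq_bigr => i _.
  by rewrite zE dotDl dotZl.
have -> : w z - (k * w x + w y) = (w z - S z) - (k * (w x - S x) + (w y - S y)).
  by rewrite SE; ring.
have -> : e = (`|k| * M + M') * (e / Q) + (`|k| * M + M') * (e / Q).
  by rewrite -mulrDl -/Q mulrC divfK// gt_eqF.
rewrite (le_trans (ler_normB _ _))// lerD ?wE ?(ltW L0)//.
rewrite (le_trans (ler_normD _ _))// mulrDl lerD ?wE ?(ltW M'0)//.
by rewrite normrM -mulrA ler_wpM2l// wE// ltW.
Qed.

(** On bounded sets the weak operator topology already controls every normal functional, by
    [predual_approx]. *)
Lemma predual_continuous (X : topologicalType) (p : X -> bop H) (M : C) (w : predual H) :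
  0 <= M -> (forall s u, `|p s u| <= M * `|u|) -> wot_continuous p ->
  continuous (fun s => w (p s) : R[i]^o).
Proof.
move=> M0 pM pc; apply/continuous_normP => x e e0.
have e3 : 0 < e / 2 / 2 by rewrite !divr_gt0.
have d0 : 0 < e / 2 / 2 / (M + 1) by rewrite divr_gt0// ltr_wpDl.
have [N [h [k wE]]] := predual_approx w d0.
have Md : M * (e / 2 / 2 / (M + 1)) <= e / 2 / 2.
  by rewrite mulrA ler_pdivrMr ?ltr_wpDl// mulrC ler_wpM2l ?lerDl ?(ltW e3).
have sc : continuous (fun s => \sum_i dot (p s (h i)) (k i) : R[i]^o).
  by apply: (@continuous_sum R[i] R[i]^o) => i; exact: pc.
have := (continuous_normP _).1 sc x (e / 2) (divr_gt0 e0 (ltr0Sn _ _)).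
apply: filterS => y xy.
have wd z : `|w (p z) - \sum_i dot (p z (h i)) (k i)| <= e / 2 / 2.
  by rewrite (le_trans (wE _ _ M0 (pM z))).
rewrite -(subrKA (\sum_i dot (p x (h i)) (k i))) [e]splitr.
rewrite -[X in _ + X](subrKA (\sum_i dot (p y (h i)) (k i))).
rewrite addrCA [e / 2 + _]addrC (le_trans (ler_normD _ _))// addrC lerD//.
by rewrite [e / 2]splitr (le_trans (ler_normD _ _))// lerD// distrC.
Qed.

End Preduals.

(** * The weak-star and strong-star topologies on operators *)

Section OperatorTopologies.
Variables (R : realType) (H : hilbert R).
Local Notation C := R[i].

Lemma continuous_ptws (Z : topologicalType) (I : Type) (V : topologicalType)
    (f : Z -> {ptws I -> V}) :
  (forall i, continuous (fun z => f z i)) -> continuous f.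
Proof.
move=> fc z; apply/cvg_sup => i O [_ [[W oW <-] /= Wz]] /filterS; apply.
by apply: fc; exact: open_nbhs_nbhs.
Qed.

Lemma ptws_eval (I : Type) (V : topologicalType) (i : I) :
  continuous (fun f : {ptws I -> V} => f i).
Proof.
move=> f; have /cvg_sup/(_ i) fi : f --> f by exact: cvg_id.
move=> O Of; apply: fi.
exact: (@initial_continuous _ _ (fun f : I -> V => f i) f O Of).
Qed.

Lemma continuous_weak (Z : topologicalType) (f : Z -> bop H) :
  (forall w : predual H, continuous (fun z => w (f z) : R[i]^o)) ->
  continuous (f : Z -> bop_top weak_star H).
Proof. by move=> fc; apply: continuous_comp_initial; exact: continuous_ptws. Qed.

Lemma continuous_strong (Z : topologicalType) (f : Z -> bop H) :
  (forall u, continuous (fun z => f z u)) ->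
  (forall u, continuous (fun z => adjoint (f z) u)) ->
  continuous (f : Z -> bop_top strong_star H).
Proof.
move=> fc fc'; apply: continuous_comp_initial; apply: continuous_ptws => u z.
by apply: cvg_pair; [exact: fc|exact: fc'].
Qed.

Lemma weak_eval (w : predual H) : continuous (w : bop_top weak_star H -> R[i]^o).
Proof.
move=> x.
have c1 : continuous (@op_embed R weak_star H : bop_top weak_star H -> op_target weak_star H).
  exact: initial_continuous.
have c2 : continuous (fun f : op_target weak_star H => f w).
  exact: ptws_eval.
exact: (continuous_comp (c1 x) (c2 _)).
Qed.

Lemma strong_eval u : continuous (fun x : bop_top strong_star H => (x : bop H) u).
Proof.
move=> x.
have c1 : continuous (@op_embed R strong_star H : bop_top strong_star H -> op_target strong_star H).
  exact: initial_continuous.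
have c2 : continuous (fun f : op_target strong_star H => f u).
  exact: ptws_eval.
have c3 : continuous (fst : H * H -> H) by move=> y; exact: cvg_fst.
exact: (continuous_comp (continuous_comp (c1 x) (c2 _)) (c3 _)).
Qed.

Lemma strong_eval_adjoint u :
  continuous (fun x : bop_top strong_star H => adjoint (x : bop H) u).
Proof.
move=> x.
have c1 : continuous (@op_embed R strong_star H : bop_top strong_star H -> op_target strong_star H).
  exact: initial_continuous.
have c2 : continuous (fun f : op_target strong_star H => f u).
  exact: ptws_eval.
have c3 : continuous (snd : H * H -> H) by move=> y; exact: cvg_snd.
exact: (continuous_comp (continuous_comp (c1 x) (c2 _)) (c3 _)).
Qed.

Variables (tau : op_topology) (S : set (bop H)).

Lemma sub_val_continuous : continuous (@sub_val R tau H S : _ -> bop_top tau H).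
Proof. exact: initial_continuous. Qed.

Lemma continuous_sub (Z : topologicalType) (f : Z -> sub_top tau S) :
  continuous (fun z => sub_val (f z) : bop_top tau H) -> continuous f.
Proof. by move=> fc; apply: continuous_comp_initial. Qed.

Lemma compact_sub_top : compact (S : set (bop_top tau H)) ->
  compact [set: sub_top tau S].
Proof.
move=> cS F FF _; pose G := (@sub_val R tau H S : _ -> bop_top tau H) @ F.
have GS : G S.
  apply: (@filterE _ F) => s; exact: (set_mem (valP s)).
have [x [Sx xG]] := cS G _ GS.
pose s : sub_top tau S := exist _ x (mem_set Sx).
exists s; split=> // A B FA [_ [[W oW <-] /= Ws] WB].
have GA : G (@sub_val R tau H S @` A).
  by apply: (@filterS _ F) FA => y Ay; exists y.
have [z [[y Ay yz] Wz]] := xG _ W GA (open_nbhs_nbhs (conj oW Ws)).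
exists y; split=> //; apply: WB.
have : W (sub_val y) by rewrite yz.
by [].
Qed.

Lemma sub_val_mem (s : sub_top tau S) : S (sub_val s).
Proof. exact: (set_mem (valP s)). Qed.

Lemma sub_val_inj : injective (@sub_val R tau H S).
Proof. exact: val_inj. Qed.

(** Both topologies refine the weak operator topology, so results stated for [wot_continuous] fields
    cover both values of [tau]. *)
Lemma sub_val_wot : wot_continuous (@sub_val R tau H S).
Proof.
move=> h k; have := sub_val_continuous; case: tau => c; last first.
  apply/continuous_normP => s e e0.
  have k1 : 0 < `|k| + 1 by rewrite ltr_wpDl.
  have := continuous_comp (c s) (@strong_eval h _).
  move=> /cvgrPdist_le/(_ _ (divr_gt0 e0 k1)).
  apply: filterS => v; rewrite -dotBl ler_pdivlMr// => h'.
  rewrite (le_trans (cauchy_schwarz _ _))// (le_trans _ h')// ler_wpM2l//.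
  by rewrite lerDl.
have [w wE] := vec_predual (fun _ : 'I_1 => h) (fun=> k).
have <- : (fun s : sub_top weak_star S => w (sub_val s) : R[i]^o) =
    fun s => dot (sub_val s h) k by apply/funext => x; rewrite wE big_ord1.
by move=> s; exact: (continuous_comp (c s) (@weak_eval w _)).
Qed.

End OperatorTopologies.

(** * The Stone-Weierstrass theorem *)

Section StoneWeierstrass.
Variables (R : realType) (X : topologicalType).
Local Notation C := R[i].
Local Notation A := (cb_algebra R X).
Hypothesis cX : compact [set: X].
Variable D : set A.
Hypothesis D0 : D 0.
Hypothesis DD : forall f g, D f -> D g -> D (f + g).
Hypothesis DZ : forall k f, D f -> D (k *: f).
Hypothesis DM : forall f g, D f -> D g -> D (cmul f g).
Hypothesis DS : forall f, D f -> D (cstar f).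
Hypothesis Dsep : forall x y : X, x <> y ->
  exists2 f : A, D f & (f : cbfun R X) x <> (f : cbfun R X) y.
Hypothesis Dnz : forall x : X, exists2 f : A, D f & (f : cbfun R X) x <> 0.

Let B := @adherent R A D.

Let BD f g : B f -> B g -> B (f + g).
Proof.
move=> Bf Bg e e0; have e2 : 0 < e / 2 by rewrite divr_gt0.
have [f' Df' ff'] := Bf _ e2; have [g' Dg' gg'] := Bg _ e2.
exists (f' + g'); first exact: DD.
by rewrite opprD addrACA [e]splitr (le_trans (ler_normD _ _))// lerD.
Qed.

Let BZ k f : B f -> B (k *: f).
Proof.
move=> Bf e e0; have k1 : 0 < `|k| + 1 by rewrite ltr_wpDl.
have [f' Df' ff'] := Bf _ (divr_gt0 e0 k1).
exists (k *: f'); first exact: DZ.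
rewrite -scalerBr normrZ (le_trans (ler_wpM2l _ ff'))//.
by rewrite mulrCA ler_piMr ?(ltW e0)// ler_pdivrMr// mul1r lerDl.
Qed.

Let BM f g : B f -> B g -> B (cmul f g).
Proof.
move=> Bf Bg e e0; have e2 : 0 < e / 2 by rewrite divr_gt0.
have f1 : 0 < `|f| + 1 by rewrite ltr_wpDl.
have [g' Dg' gg'] := Bg _ (divr_gt0 e2 f1).
have g1 : 0 < `|g'| + 1 by rewrite ltr_wpDl.
have [f' Df' ff'] := Bf _ (divr_gt0 e2 g1).
exists (cmul f' g'); first exact: DM.
have -> : cmul f g - cmul f' g' = cmul f (g - g') + cmul (f - f') g' :> A.
  apply: cbfun_inj => x.
  pose ev (h : A) := (h : cbfun R X) x.
  have h : ev f * ev g - ev f' * ev g' = ev f * (ev g - ev g') + (ev f - ev f') * ev g'.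
    by ring.
  exact: h.
rewrite [e]splitr (le_trans (ler_normD _ _))// lerD// (le_trans (cnormM _ _))//.
  rewrite (le_trans (ler_wpM2l _ gg'))// mulrCA ler_piMr ?(ltW e2)//.
  by rewrite ler_pdivrMr// mul1r lerDl.
rewrite (le_trans (ler_wpM2r _ ff'))// mulrAC ler_pdivrMr//.
by rewrite ler_wpM2l ?lerDl// ltW.
Qed.

(** The real functions in the closure of [D]: the lattice operations take place here, while [D]
    itself is complex. *)
Let Br (h : X -> R) := exists2 f : A, B f & forall x, (f : cbfun R X) x = (h x)%:C%C.

Let BrD h h' : Br h -> Br h' -> Br (fun x => h x + h' x).
Proof.
move=> [f Bf fE] [f' Bf' fE']; exists (f + f'); first exact: BD.
by move=> x; rewrite (rmorphD (real_complex R))/= -fE -fE'.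
Qed.

Let BrZ k h : Br h -> Br (fun x => k * h x).
Proof.
move=> [f Bf fE]; exists (k%:C%C *: f); first exact: BZ.
by move=> x; rewrite (rmorphM (real_complex R))/= -fE.
Qed.

Let BrM h h' : Br h -> Br h' -> Br (fun x => h x * h' x).
Proof.
move=> [f Bf fE] [f' Bf' fE']; exists (cmul f f'); first exact: BM.
by move=> x; rewrite (rmorphM (real_complex R))/= -fE -fE'.
Qed.

Let Br0 : Br (fun=> 0).
Proof. by exists 0 => //; exact: sub_adherent. Qed.

Let Br_lim (f : cbfun R X) h : (forall x, f x = (h x)%:C%C) ->
  (forall e : R, 0 < e -> exists2 h', Br h' & forall x, `|h x - h' x| <= e) -> Br h.
Proof.
move=> fE hB; exists f => //; apply: adherentK => _ /gt0CP[e e0 ->].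
have [h' [f' Bf' f'E] hh'] := hB e e0.
exists f' => //; apply: cb_le_norm; first by rewrite lecR ltW.
move=> x; have -> : (f - f' : cbfun R X) x = (h x - h' x)%:C%C.
  by rewrite (rmorphB (real_complex R))/= -fE -f'E.
by rewrite normc_def/= expr0n/= addr0 sqrtr_sqr lecR.
Qed.

Let Br_cont h : Br h -> continuous (h : X -> R^o).
Proof.
move=> [f _ fE]; have -> : h = fun x => complex.Re ((f : cbfun R X) x).
  by apply/funext => x; rewrite fE.
exact/continuous_Re/cb_continuous.
Qed.

(* The iteration [q <- q + (t ^ 2 - q ^ 2) / 2] increases to [|t|] uniformly on *)
(* [-1, 1], and its iterates are polynomials in [t] without constant term.   *)
Fixpoint abs_iter (n : nat) (t : R) : R :=
  if n is m.+1 then abs_iter m t + (t ^+ 2 - abs_iter m t ^+ 2) / 2 else 0.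

Lemma abs_iter_bound n t : `|t| <= 1 ->
  0 <= abs_iter n t <= `|t| /\ `|t| - abs_iter n t <= `|t| * (1 - `|t| / 2) ^+ n.
Proof.
move=> t1; elim: n => [|n [/andP[q0 qt] IH]] /=.
  by rewrite lexx normr_ge0 subr0 expr0 mulr1 lexx.
have -> : t ^+ 2 = `|t| ^+ 2 by rewrite real_normK ?num_real.
set q := abs_iter n t in q0 qt IH *; set y := `|t| in t1 qt IH *.
have y0 : 0 <= y by rewrite normr_ge0.
split; first by apply/andP; split; nra.
(* The error is multiplied by [1 - (y + q) / 2] at each step, which is at most [1 - y / 2]. *)
have -> : y - (q + (y ^+ 2 - q ^+ 2) / 2) = (1 - (y + q) / 2) * (y - q) by field.
rewrite (exprS (1 - y / 2)) mulrCA.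
apply: le_trans (ler_wpM2l _ IH); last by lra.
rewrite ler_wpM2r ?subr_ge0//; lra.
Qed.

(** With [a = y / 2], Bernoulli's inequality gives [(1 - a)^n (1 + n a) <= 1]. The resulting rate
    [2 / n] is uniform down to [y = 0], where the ratio of the geometric factor tends to [1]. *)
Lemma abs_iter_rate n (y : R) : 0 <= y <= 1 -> n%:R * (y * (1 - y / 2) ^+ n) <= 2.
Proof.
move=> /andP[y0 y1]; pose a := y / 2.
have a0 : 0 <= a by rewrite divr_ge0.
have a1 : 0 <= 1 - a by rewrite /a; lra.
have bern : (1 - a) ^+ n * (1 + n%:R * a) <= 1.
  elim: n => [|n IH]; first by rewrite expr0 mul0r addr0 mulr1.
  rewrite exprSr -mulrA; apply: le_trans IH; rewrite ler_wpM2l ?exprn_ge0//.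
  have n0 : 0 <= n%:R :> R by [].
  by rewrite -natr1; nra.
have p0 : 0 <= (1 - a) ^+ n by rewrite exprn_ge0.
have -> : y = 2 * a by rewrite /a; field.
have -> : 2 * a / 2 = a by field.
by move: (_ ^+ n) p0 bern => p p0 bern; nra.
Qed.

Let Br_abs h : Br h -> Br (fun x => `|h x|).
Proof.
move=> hB; have [f Bf fE] := hB.
have [M M0 fM] : exists2 M : R, 0 < M & forall x, `|h x| <= M.
  have [r r0 rE] := normCP f; exists (r + 1) => [|x]; first by rewrite ltr_wpDl.
  have := cb_norm_ge (f : cbfun R X) x; rewrite -cb_normE rE fE.
  rewrite normc_def/= expr0n/= addr0 sqrtr_sqr lecR => /le_trans; apply.
  by rewrite lerDl.
have hc : continuous (fun x => (`|h x|)%:C%C : R[i]^o).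
  apply: continuous_real => x.
  by apply: cvg_norm; exact: Br_cont.
apply: (Br_lim (f := mkcb cX hc)) => // e e0.
pose g x := M^-1 * h x.
have gB : Br g by exact: BrZ.
have g1 x : `|g x| <= 1.
  by rewrite normrM normfV (gtr0_norm M0) ler_pdivrMl// mulr1.
have qB n : Br (fun x => abs_iter n (g x)).
  elim: n => [|n IH] //=; apply: BrD => //.
  have -> : (fun x => (g x ^+ 2 - abs_iter n (g x) ^+ 2) / 2) =
      fun x => 2^-1 * (g x * g x) + (- 2^-1) * (abs_iter n (g x) * abs_iter n (g x)).
    by apply/funext => x; rewrite !expr2; ring.
  by apply: BrD; apply: BrZ; exact: BrM.
have eM : 0 <= 2 * M / e by rewrite divr_ge0 ?mulr_ge0 ?ltW.
pose n := Num.bound (2 * M / e).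
have en := archi_boundP eM; rewrite -/n in en.
have n0 : 0 < n%:R :> R by exact: le_lt_trans en.
exists (fun x => M * abs_iter n (g x)); first exact: BrZ.
move=> x; have [/andP[q0 qg] qr] := abs_iter_bound n (g1 x).
have hg : `|h x| = M * `|g x|.
  by rewrite normrM normfV (gtr0_norm M0) mulVKf ?gt_eqF.
rewrite hg -mulrBr normrM (gtr0_norm M0) ger0_norm ?subr_ge0//.
have := @abs_iter_rate n `|g x|; rewrite normr_ge0 g1 => /(_ isT) rate.
have : n%:R * (`|g x| - abs_iter n (g x)) <= 2.
  by rewrite (le_trans _ rate)// ler_wpM2l.
rewrite -ler_pdivlMl// => h2; rewrite (le_trans (ler_wpM2l (ltW M0) h2))//.
rewrite mulrCA -ler_pdivlMl ?invr_gt0// invrK.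
rewrite ltr_pdivrMr// in en.
by rewrite [M * 2]mulrC ltW.
Qed.

Let BrB h h' : Br h -> Br h' -> Br (fun x => h x - h' x).
Proof.
move=> hB hB'; have := BrD hB (BrZ (-1) hB').
by congr Br; apply/funext => x; rewrite mulN1r.
Qed.

Let Br_min h h' : Br h -> Br h' -> Br (fun x => Num.min (h x) (h' x)).
Proof.
move=> hB hB'; have := BrZ 2^-1 (BrB (BrD hB hB') (Br_abs (BrB hB hB'))).
by congr Br; apply/funext => x; rewrite minr_absE mulrC.
Qed.

(** [D] is not assumed to contain constants, so the combination [k = g f - f(y) g] has no constant
    term. It vanishes at [y] and equals [g(x) (f(x) - f(y))] at [x]; then [|k|^2] is normalized. *)
Let Br_peak x y : x <> y -> exists2 h, Br h & h x = 1 /\ h y = 0.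
Proof.
move=> xy; have [f Df fxy] := Dsep xy; have [g Dg gx] := Dnz x.
pose f' : cbfun R X := f; pose g' : cbfun R X := g.
pose k : cbfun R X := cmul g f + (- f' y) *: g.
have Dk : D k by apply: DD; [exact: DM|exact: DZ].
have kE z : k z = g' z * f' z - f' y * g' z by rewrite -mulNr.
have ky : k y = 0 by rewrite kE mulrC subrr.
have kx : k x != 0.
  rewrite kE [f' y * _]mulrC -mulrBr mulf_neq0//; first exact/eqP.
  by rewrite subr_eq0; exact/eqP.
pose l : cbfun R X := (`|k x| ^+ 2)^-1 *: cmul (cstar (k : A)) (k : A).
have Dl : D l by apply: DZ; apply: DM => //; exact: DS.
have lE z : l z = (`|k x| ^+ 2)^-1 * `|k z| ^+ 2 by rewrite [X in _ = _ * X]normCKC.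
exists (fun z => complex.Re (l z)).
  exists l => [|z]; first exact: sub_adherent.
  by rewrite RRe_real// ger0_real// lE mulr_ge0 ?invr_ge0 ?exprn_ge0.
by rewrite !lE ky normr0 expr0n mulr0 mulVf ?expf_neq0 ?normr_eq0.
Qed.

Let Br_one x : exists2 h, Br h & h x = 1.
Proof.
have [g Dg gx] := Dnz x; pose k : cbfun R X := g.
pose l : cbfun R X := (`|k x| ^+ 2)^-1 *: cmul (cstar (k : A)) (k : A).
have Dl : D l by apply: DZ; apply: DM => //; exact: DS.
have lE z : l z = (`|k x| ^+ 2)^-1 * `|k z| ^+ 2 by rewrite [X in _ = _ * X]normCKC.
exists (fun z => complex.Re (l z)).
  exists l => [|z]; first exact: sub_adherent.
  by rewrite RRe_real// ger0_real// lE mulr_ge0 ?invr_ge0 ?exprn_ge0.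
by rewrite lE mulVf// expf_neq0// normr_eq0; exact/eqP.
Qed.

Let Br_interp x y (r : X -> R) : exists2 h, Br h & h x = r x /\ h y = r y.
Proof.
have [<-|/eqP xy] := eqVneq x y.
  have [h hB hx] := Br_one x; exists (fun z => r x * h z); first exact: BrZ.
  by rewrite hx mulr1.
have [h hB [hx hy]] := Br_peak xy; have [k kB [ky kx]] := Br_peak (nesym xy).
exists (fun z => r x * h z + r y * k z); first by apply: BrD; exact: BrZ.
by rewrite hx hy kx ky !mulr1 !mulr0 addr0 add0r.
Qed.

Let Br_min_seq (g : X -> X -> R) (s : seq X) : (forall y, Br (g y)) -> s != [::] ->
  exists2 m, Br m & forall z, (forall y, y \in s -> m z <= g y z) /\
    exists2 y, y \in s & m z = g y z.
Proof.
move=> gB; elim: s => // y [|y' s] IH _.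
  exists (g y) => // z; split=> [w|]; first by rewrite inE => /eqP ->.
  by exists y; rewrite ?inE.
have [m mB mP] := IH isT.
exists (fun z => Num.min (g y z) (m z)); first exact: Br_min.
move=> z; have [mle [w ws mw]] := mP z; split=> [v|].
  rewrite inE => /orP[/eqP ->|vs]; first by rewrite ge_min lexx.
  by rewrite ge_min mle ?orbT.
rewrite /Num.min; case: ifP => _; first by exists y; rewrite ?mem_head.
by exists w; rewrite // inE ws orbT.
Qed.

(** The minimum, over a finite subcover, of functions agreeing with [r] at [x] and at one more
    point: exact at [x] and below [r + e] everywhere. [Br_all] then takes a maximum of such
    functions, written as minus a minimum. *)
Let Br_below (r : X -> R) (e : R) x : continuous (r : X -> R^o) -> 0 < e ->
  exists2 g, Br g & g x = r x /\ forall y, g y < r y + e.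
Proof.
move=> rc e0.
pose g y := s2val (cid2 (Br_interp x y r)).
have gB y : Br (g y) by exact: (s2valP (cid2 (Br_interp x y r))).
have [gx gy] : (forall y, g y x = r x) /\ (forall y, g y y = r y).
  by split=> y; have [] := s2valP' (cid2 (Br_interp x y r)).
have [|s sP] := compact_fin_cover cX (O := fun y => [set z | g y z < r z + e]).
  move=> y; have dc : continuous (fun z => r z - g y z : R^o).
    by move=> z; apply: (@cvgB R R^o); [exact: rc|exact: Br_cont].
  have /cvgrPdist_lt/(_ _ e0) := dc y; apply: filterS => z /=.
  by rewrite gy subrr sub0r normrN ltr_norml => /andP[+ _]; lra.
have [x0 x0s _] := sP x.
have [|m mB mP] := @Br_min_seq g s gB; first by apply: contraTneq x0s => ->.
exists m => //; split=> [|y].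
  by have [_ [y _ ->]] := mP x; exact: gx.
have [z zs gz] := sP y; have [mle _] := mP y.
exact: le_lt_trans (mle _ zs) gz.
Qed.

Let Br_all (f : cbfun R X) (r : X -> R) : (forall x, f x = (r x)%:C%C) -> Br r.
Proof.
move=> fE; have rc : continuous (r : X -> R^o).
  have -> : r = fun x => complex.Re (f x) by apply/funext => x; rewrite fE.
  exact/continuous_Re/cb_continuous.
apply: (Br_lim fE) => e e0.
pose g x := s2val (cid2 (Br_below x rc e0)).
have gB x : Br (g x) by exact: (s2valP (cid2 (Br_below x rc e0))).
have [gx gy] : (forall x, g x x = r x) /\ (forall x y, g x y < r y + e).
  by split=> x; have [] := s2valP' (cid2 (Br_below x rc e0)).
have [|s sP] := compact_fin_cover cX (O := fun x => [set z | r z - e < g x z]).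
  move=> x; have dc : continuous (fun z => r z - g x z : R^o).
    by move=> z; apply: (@cvgB R R^o); [exact: rc|exact: Br_cont].
  have /cvgrPdist_lt/(_ _ e0) := dc x; apply: filterS => z /=.
  by rewrite gx subrr sub0r normrN ltr_norml => /andP[_]; lra.
have ngB x : Br (fun z => - g x z).
  by have := BrZ (-1) (gB x); congr Br; apply/funext => z; rewrite mulN1r.
have [s0|s0] := eqVneq s [::].
  by exists (fun=> 0) => // x; have [y] := sP x; rewrite s0.
have [m mB mP] := Br_min_seq ngB s0.
exists (fun z => - m z).
  by have := BrZ (-1) mB; congr Br; apply/funext => z; rewrite mulN1r.
move=> z; have [mle [y ys my]] := mP z; have [x xs gz] := sP z.
move: gz; have := mle _ xs; have := gy y z; rewrite my ler_norml /= => h1 h2 gz.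
by apply/andP; split; lra.
Qed.

Theorem stone_weierstrass (f : A) : @adherent R A D f.
Proof.
pose f' : cbfun R X := f.
have fc : continuous (f' : X -> R[i]^o) := @cb_continuous _ _ f'.
have [|fr Bfr frE] := @Br_all (mkcb cX (continuous_real (continuous_Re fc)))
  (fun x => complex.Re (f' x)); first by [].
have fc' : continuous (fun x => 'i%C * f' x : R[i]^o).
  by move=> x; apply: cvgM; [exact: cvg_cst|exact: fc].
have [|fi Bfi fiE] := @Br_all (mkcb cX (continuous_real (continuous_Re fc')))
  (fun x => complex.Re ('i%C * f' x)); first by [].
(* [Re (i z) = - Im z], so [z = Re z - i Re (i z)]. *)
have -> : f = fr + (- 'i%C) *: fi.
  apply: cbfun_inj => x; have := frE x; have := fiE x => /= h1 h2.
  transitivity ((fr : cbfun R X) x + (- 'i%C) * (fi : cbfun R X) x); last by [].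
  rewrite h1 h2 -/f'; case: (f' x) => a b; apply/eqP; rewrite eq_complex /=.
  by apply/andP; split; apply/eqP; ring.
exact: (BD Bfr (BZ (- 'i%C) Bfi)).
Qed.

End StoneWeierstrass.

(** * Convolution on a compact semitopological semigroup *)

Section SemigroupFunctions.
Variables (R : realType) (X : topologicalType) (H : hilbert R).
Local Notation C := R[i].
Local Notation A := (cb_algebra R X).
Hypothesis cX : compact [set: X].
Variable p : X -> bop H.
Hypothesis pc : wot_continuous p.
Hypothesis p1 : forall s, contractive (p s).
Implicit Types (m l : dual A) (w : predual H).

Let pM s h : `|p s h| <= 1 * `|h|.
Proof. by rewrite mul1r; exact: p1. Qed.

Lemma cb_uniform_limit (f : X -> C) :
  (forall e : C, 0 < e -> exists2 g : X -> C, continuous (g : X -> R[i]^o) &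
    forall x, `|f x - g x| <= e) -> continuous (f : X -> R[i]^o).
Proof.
move=> fg; apply/continuous_normP => x e e0.
have e3 : 0 < e / 2 / 2 by rewrite !divr_gt0.
have [g gc fgE] := fg _ e3.
have := (continuous_normP _).1 gc x (e / 2) (divr_gt0 e0 (ltr0Sn _ _)).
apply: filterS => y xy; have -> : f x - f y = (f x - g x) + (g x - g y) - (f y - g y) by ring.
have -> : e = e / 2 / 2 + e / 2 + e / 2 / 2 by field.
by rewrite (le_trans (ler_normB _ _))// lerD// (le_trans (ler_normD _ _))// lerD.
Qed.

Definition coef w : cbfun R X := mkcb cX (@predual_continuous R H X p 1 w ler01 pM (@pc)).

Lemma mop_exists m : exists M : bop H,
  (forall h k (f : cbfun R X), (forall s, f s = dot (p s h) k) -> dot (M h) k = m f).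
Proof.
have [c c0 mc] := blin_gt0 m.
pose f h k : cbfun R X := mkcb cX (@pc h k).
have mP k a b : m (k *: a + b) = k * m a + m b by rewrite blinD blinZ.
have [||||M [ME _]] := @op_of_form R H H (fun h k => m (f h k)) c; last first.
- exists M => h k g gE; rewrite ME; congr (m _).
  by apply: cbfun_inj => s; rewrite gE.
- exact: ltW.
- move=> h k; rewrite (le_trans (mc _))// -mulrA ler_wpM2l ?(ltW c0)//.
  apply: cb_le_norm; first by rewrite mulr_ge0.
  by move=> s; rewrite (le_trans (cauchy_schwarz _ _))// ler_wpM2r//; exact: p1.
- move=> k h v v'; rewrite -mP; congr (m _).
  by apply: cbfun_inj => s /=; rewrite dotDr dotZr.
- move=> k h h' v; rewrite -mP; congr (m _).
  by apply: cbfun_inj => s /=; rewrite blinD blinZ dotDl dotZl.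
Qed.

(** The weak integral of [p] against [m]. It is the slice of the integrated operator at [m], see
    [field_op_lslice]. *)
Definition mop m : bop H := sval (cid (mop_exists m)).

Lemma mopE m h k (f : cbfun R X) : (forall s, f s = dot (p s h) k) -> dot (mop m h) k = m f.
Proof. exact: (svalP (cid (mop_exists m))). Qed.

(** A normal functional passes through the weak integral because it is uniformly close to finitely
    many vector functionals. The factors [x] and [y] accommodate translations and a second
    integration. *)
Lemma mop_coef m w (x y : bop H) (f : cbfun R X) :
  (forall s, f s = w (blin_comp x (blin_comp (p s) y))) ->
  m f = w (blin_comp x (blin_comp (mop m) y)).
Proof.
move=> fE; apply: approx_eq => e e0.
have [c c0 mc] := blin_gt0 m.
have [M M0 xM] := blin_gt0 x; have [N N0 yN] := blin_gt0 y; have [L L0 mL] := blin_gt0 (mop m).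
pose Q := c * (M * N) + M * (L * N).
have Q0 : 0 < Q by rewrite addr_gt0// !mulr_gt0.
have xyM s u : `|blin_comp x (blin_comp (p s) y) u| <= M * N * `|u|.
  by rewrite /= (le_trans (xM _))// -mulrA ler_wpM2l ?(ltW M0)// (le_trans (p1 _ _)).
have xmM u : `|blin_comp x (blin_comp (mop m) y) u| <= M * (L * N) * `|u|.
  rewrite /= (le_trans (xM _))// -mulrA ler_wpM2l ?(ltW M0)// (le_trans (mL _))//.
  by rewrite -mulrA ler_wpM2l ?(ltW L0).
have [n [h [k wE]]] := predual_approx w (divr_gt0 e0 Q0).
pose g i : cbfun R X := mkcb cX (@pc (y (h i)) (adjoint x (k i))).
have gE i s : g i s = dot (blin_comp x (blin_comp (p s) y) (h i)) (k i).
  by rewrite /= [RHS]adjointP.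
pose G : A := \sum_i (g i : A).
have -> : m f - w (blin_comp x (blin_comp (mop m) y)) = m (f - G : A) +
    (\sum_i dot (blin_comp x (blin_comp (mop m) y) (h i)) (k i) -
     w (blin_comp x (blin_comp (mop m) y))).
  rewrite blinB /G blin_sum addrA; congr (_ - _).
  rewrite -[LHS](subrK (\sum_i m (g i : A))); congr (_ + _).
  by apply: eq_bigr => i _; rewrite /= [RHS]adjointP (mopE m (f := g i)).
have -> : e = c * (M * N * (e / Q)) + M * (L * N) * (e / Q).
  by rewrite mulrA -mulrDl -/Q mulrC divfK// gt_eqF.
rewrite (le_trans (ler_normD _ _))// lerD//; last first.
  by rewrite distrC wE// !mulr_ge0 ?ltW.
rewrite (le_trans (mc _))// ler_wpM2l ?(ltW c0)//; apply: cb_le_norm.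
  by rewrite mulr_ge0 ?(ltW (divr_gt0 e0 Q0))// mulr_ge0// ltW.
move=> s; have -> : (f - G : cbfun R X) s = f s - \sum_i g i s by rewrite -cb_sumE.
under eq_bigr do rewrite gE.
by rewrite fE wE// mulr_ge0 ?ltW.
Qed.

Lemma mop_coef0 m w (f : cbfun R X) : (forall s, f s = w (p s)) -> m f = w (mop m).
Proof.
move=> fE; have idE (x : bop H) : blin_comp (blin_id H) (blin_comp x (blin_id H)) = x.
  exact: blinP.
by rewrite (@mop_coef m w (blin_id H) (blin_id H)) ?idE// => s; rewrite idE.
Qed.

Hypothesis pdense : forall f : A,
  @adherent R A [set g : A | exists w, forall s, (g : cbfun R X) s = w (p s)] f.

Lemma dual_eq m l : (forall w (f : cbfun R X), (forall s, f s = w (p s)) -> m f = l f) ->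
  forall f, m f = l f.
Proof.
move=> ml f; have [c c0 mc] := blin_gt0 m; have [d d0 ld] := blin_gt0 l.
apply: approx_eq => e e0; have cd : 0 < c + d by rewrite addr_gt0.
have [g [w gE] fg] := pdense f (divr_gt0 e0 cd).
have -> : m f - l f = m (f - g) - l (f - g).
  by rewrite !blinB (ml w g gE) opprB addrA subrK.
have -> : e = c * (e / (c + d)) + d * (e / (c + d)).
  by rewrite -mulrDl mulrC divfK// gt_eqF.
rewrite (le_trans (ler_normB _ _))// lerD//.
  by rewrite (le_trans (mc _))// ler_wpM2l// ltW.
by rewrite (le_trans (ld _))// ler_wpM2l// ltW.
Qed.

Variable mul : X -> X -> X.
Hypothesis mul_cl : forall t, continuous (fun s => mul s t).
Hypothesis mul_cr : forall s, continuous (mul s).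
Hypothesis pmul : forall s t, p (mul s t) = blin_comp (p s) (p t).

Lemma trl_continuous (f : cbfun R X) t : continuous (fun s => f (mul s t) : R[i]^o).
Proof. by move=> s; exact: (continuous_comp (@mul_cl t s) (@cb_continuous _ _ f _)). Qed.
Lemma trr_continuous (f : cbfun R X) s : continuous (fun t => f (mul s t) : R[i]^o).
Proof. by move=> t; exact: (continuous_comp (@mul_cr s t) (@cb_continuous _ _ f _)). Qed.

Definition trl (f : A) t : A := mkcb cX (@trl_continuous f t).
Definition trr (f : A) s : A := mkcb cX (@trr_continuous f s).

Lemma trl_norm f t : `|trl f t| <= `|f|.
Proof. by apply: cb_le_norm => // s; exact: (cb_norm_ge (f : cbfun R X) (mul s t)). Qed.
Lemma trr_norm f s : `|trr f s| <= `|f|.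
Proof. by apply: cb_le_norm => // t; exact: (cb_norm_ge (f : cbfun R X) (mul s t)). Qed.
Lemma trlP k f g t : trl (k *: f + g) t = k *: trl f t + trl g t.
Proof. exact: cbfun_inj. Qed.
Lemma trrP k f g s : trr (k *: f + g) s = k *: trr f s + trr g s.
Proof. exact: cbfun_inj. Qed.
Lemma trlB f g t : trl (f - g) t = trl f t - trl g t.
Proof. exact: cbfun_inj. Qed.
Lemma trrB f g s : trr (f - g) s = trr f s - trr g s.
Proof. exact: cbfun_inj. Qed.

Lemma trl_coef m w (f : cbfun R X) t : (forall s, f s = w (p s)) ->
  m (trl f t) = w (blin_comp (mop m) (p t)).
Proof.
move=> fE; rewrite (@mop_coef m w (blin_id H) (p t)).
  by congr (w _); exact: blinP.
by move=> s; rewrite /= fE pmul; congr (w _); exact: blinP.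
Qed.

Lemma trr_coef m w (f : cbfun R X) s : (forall t, f t = w (p t)) ->
  m (trr f s) = w (blin_comp (p s) (mop m)).
Proof.
move=> fE; rewrite (@mop_coef m w (p s) (blin_id H)).
  by congr (w _); exact: blinP.
by move=> t; rewrite /= fE pmul; congr (w _); exact: blinP.
Qed.

(** The product is only separately continuous, so continuity of the inner integral in the remaining
    variable is an issue. For a coefficient the integral is [w] of [mop m] composed with [p t],
    which is continuous; density and a uniform bound give the general case. *)
Lemma lact_continuous m (f : A) : continuous (fun t => m (trl f t) : R[i]^o).
Proof.
apply: cb_uniform_limit => e e0; have [c c0 mc] := blin_gt0 m.
have [g [w gE] fg] := pdense f (divr_gt0 e0 c0).
exists (fun t => m (trl g t)) => [|t].
  have -> : (fun t => m (trl g t)) = fun t => w (blin_comp (mop m) (p t)).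
    by apply/funext => t; exact: trl_coef.
  have [L L0 mL] := blin_gt0 (mop m).
  apply: (@predual_continuous R H X _ L); first exact: ltW.
    by move=> s u; rewrite /= (le_trans (mL _))// ler_wpM2l ?(ltW L0)//; exact: p1.
  move=> h k; have -> : (fun s => dot (blin_comp (mop m) (p s) h) k) =
      fun s => dot (p s h) (adjoint (mop m) k) by apply/funext => s /=; rewrite adjointP.
  exact: pc.
have -> : m (trl f t) - m (trl g t) = m (trl (f - g) t) by rewrite trlB blinB.
rewrite (le_trans (mc _))// -ler_pdivlMl// mulrC.
by rewrite (le_trans (trl_norm _ _)).
Qed.

Lemma ract_continuous m (f : A) : continuous (fun s => m (trr f s) : R[i]^o).
Proof.
apply: cb_uniform_limit => e e0; have [c c0 mc] := blin_gt0 m.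
have [g [w gE] fg] := pdense f (divr_gt0 e0 c0).
exists (fun s => m (trr g s)) => [|s].
  have -> : (fun s => m (trr g s)) = fun s => w (blin_comp (p s) (mop m)).
    by apply/funext => s; exact: trr_coef.
  have [L L0 mL] := blin_gt0 (mop m).
  apply: (@predual_continuous R H X _ L); first exact: ltW.
    by move=> s u; rewrite /= (le_trans (p1 _ _)).
  by move=> h k; exact: pc.
have -> : m (trr f s) - m (trr g s) = m (trr (f - g) s) by rewrite trrB blinB.
rewrite (le_trans (mc _))// -ler_pdivlMl// mulrC.
by rewrite (le_trans (trr_norm _ _)).
Qed.

Definition lact m (f : A) : A := mkcb cX (@lact_continuous m f).
Definition ract m (f : A) : A := mkcb cX (@ract_continuous m f).

Lemma lactP m k f g : lact m (k *: f + g) = k *: lact m f + lact m g.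
Proof. by apply: cbfun_inj => t /=; rewrite trlP blinD blinZ. Qed.
Lemma ractP m k f g : ract m (k *: f + g) = k *: ract m f + ract m g.
Proof. by apply: cbfun_inj => s /=; rewrite trrP blinD blinZ. Qed.

Lemma lact_bound m (c : C) f : 0 <= c -> (forall g, `|m g| <= c * `|g|) ->
  `|lact m f| <= c * `|f|.
Proof.
move=> c0 mc; apply: cb_le_norm => [|t]; first by rewrite mulr_ge0.
by rewrite /= (le_trans (mc _))// ler_wpM2l// trl_norm.
Qed.

Lemma ract_bound m (c : C) f : 0 <= c -> (forall g, `|m g| <= c * `|g|) ->
  `|ract m f| <= c * `|f|.
Proof.
move=> c0 mc; apply: cb_le_norm => [|s]; first by rewrite mulr_ge0.
by rewrite /= (le_trans (mc _))// ler_wpM2l// trr_norm.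
Qed.

Lemma conv_exists m l : exists ml : dual A, forall f, ml f = l (lact m f).
Proof.
apply: (@blin_exists R A R[i]^o (fun f => l (lact m f))).
  by move=> k f g; rewrite lactP blinD blinZ.
have [c c0 mc] := blin_gt0 m; have [d d0 ld] := blin_gt0 l.
exists (d * c) => f; rewrite (le_trans (ld _))// -mulrA ler_wpM2l ?(ltW d0)//.
by rewrite lact_bound// ltW.
Qed.

Definition mconv m l : dual A := sval (cid (conv_exists m l)).
Lemma mconvE m l f : mconv m l f = l (lact m f).
Proof. exact: (svalP (cid (conv_exists m l))). Qed.

Lemma mconv_coef m l w (f : cbfun R X) : (forall s, f s = w (p s)) ->
  mconv m l f = w (blin_comp (mop m) (mop l)).
Proof.
move=> fE; rewrite mconvE (@mop_coef l w (mop m) (blin_id H)).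
  by congr (w _); exact: blinP.
by move=> t; rewrite /= (@trl_coef m w _ t fE); congr (w _); exact: blinP.
Qed.

(** Fubini: each order of integration is a bounded functional of [f], and on coefficients both give
    [w] of the product of [mop m] and [mop l]. *)
Lemma mconv_ract m l f : mconv m l f = m (ract l f).
Proof.
have [lm lmE] : exists lm : dual A, forall f, lm f = m (ract l f).
  apply: (@blin_exists R A R[i]^o (fun f => m (ract l f))).
    by move=> k g h; rewrite ractP blinD blinZ.
  have [c c0 mc] := blin_gt0 m; have [d d0 ld] := blin_gt0 l.
  exists (c * d) => g; rewrite (le_trans (mc _))// -mulrA ler_wpM2l ?(ltW c0)//.
  by rewrite ract_bound// ltW.
rewrite -lmE; apply: dual_eq => w g gE; rewrite lmE (mconv_coef _ _ gE).
rewrite (@mop_coef m w (blin_id H) (mop l)).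
  by congr (w _); exact: blinP.
by move=> s; rewrite /= (@trr_coef l w _ s gE); congr (w _); exact: blinP.
Qed.

Lemma mop_conv m l : mop (mconv m l) = blin_comp (mop m) (mop l).
Proof.
apply: blinP => h; apply: dot_ext => k.
have [w wE] := vec_predual (fun _ : 'I_1 => h) (fun=> k).
have wE1 x : w x = dot (x h) k by rewrite wE big_ord1.
rewrite -wE1 -(@mop_coef0 _ w (mkcb cX (@pc h k))); last by move=> s; rewrite wE1.
by rewrite (@mconv_coef m l w) ?wE1// => s; rewrite wE1.
Qed.

(** Associativity is that of operator composition, through [mop_conv] and the density of the
    coefficients. *)
Lemma mconvA m l k f : mconv (mconv m l) k f = mconv m (mconv l k) f.
Proof.
move: f; apply: dual_eq => w f fE; rewrite !(mconv_coef _ _ fE) !mop_conv.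
by congr (w _); exact: blinP.
Qed.

End SemigroupFunctions.

Section SliceCalculus.
Variables (R : realType) (A : cstar_algebra R) (U : univ_rep A) (H : hilbert R).
Variables (T : htensor U H) (V : bop T).
Local Notation C := R[i].

Lemma rslice_eq (w : predual H) (Y : bop U) :
  (forall u v, dot (Y u) v = w (vec_slice V u v)) -> rslice V w = Y.
Proof.
move=> YE; apply: blinP => u; apply: dot_ext => v; rewrite YE.
apply: (getPex (P := [set Y : bop U | forall u v, dot (Y u) v = w (vec_slice V u v)])).
by exists Y.
Qed.

End SliceCalculus.

(** * The Eberlein algebra of a semigroup with dense coefficients *)

Section SemigroupEberlein.
Variables (R : realType) (X : topologicalType) (H : hilbert R).
Local Notation C := R[i].
Local Notation A := (cb_algebra R X).
Hypothesis cX : compact [set: X].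
Variable p : X -> bop H.
Hypothesis pc : wot_continuous p.
Hypothesis p1 : forall s, contractive (p s).
Hypothesis pdense : forall f : A,
  @adherent R A [set g : A | exists w : predual H, forall s, (g : cbfun R X) s = w (p s)] f.
Variable mul : X -> X -> X.
Hypothesis mul_cl : forall t, continuous (fun s => mul s t).
Hypothesis mul_cr : forall s, continuous (mul s).
Hypothesis pmul : forall s t, p (mul s t) = blin_comp (p s) (p t).
Variable U : univ_rep A.

Let rh := rep_star_hom U.
Let pM s h : `|p s h| <= 1 * `|h|.
Proof. by rewrite mul1r; exact: p1. Qed.

Local Notation mop := (mop cX (@pc) p1).
Local Notation trr := (trr cX mul_cr).
Local Notation ract := (ract cX (@pc) p1 (@pdense) mul_cr pmul).
Local Notation lact := (lact cX (@pc) p1 (@pdense) mul_cl pmul).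
Local Notation mconv := (mconv cX (@pc) p1 (@pdense) mul_cl pmul).

Lemma vf_exists u v : exists m : dual A, forall a, m a = dot (rep U a u) v.
Proof. exact: vector_functional (@cb_one_unit R X cX) (cb_sq_complement cX). Qed.

Definition vf u v : dual A := sval (cid (vf_exists u v)).
Lemma vfE u v a : vf u v a = dot (rep U a u) v.
Proof. exact: (svalP (cid (vf_exists u v))). Qed.

(** Whatever vectors were picked for [m], they induce [m] again; slices of integrated operators
    therefore do not depend on the choice. *)
Lemma vectors_vf (m : dual A) : vf (vectors U m).1 (vectors U m).2 = m.
Proof. by apply: blinP => a; rewrite vfE -vectorsP. Qed.

Section ComultiplicationField.
Variables (T2 : htensor U U).

(** The values act on the second tensor leg. The integrated operator of this field represents
    [f (s t)] as a function of two variables. *)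
Definition trr_field (f : A) (s : X) : bop U := rep U (trr f s).

Lemma trr_field_wot f : wot_continuous (trr_field f).
Proof.
move=> u v; have -> : (fun s => dot (trr_field f s u) v) = ract (vf u v) f :> (X -> R[i]^o).
  by apply/funext => s; rewrite /= vfE.
exact: cb_continuous.
Qed.

Lemma trr_field_bound f s u : `|trr_field f s u| <= `|f| * `|u|.
Proof.
rewrite (le_trans (rep_bound cX _ _))// ler_wpM2r//; exact: trr_norm.
Qed.

Lemma trr_mul (f g : A) s : trr (cmul f g) s = cmul (trr f s) (trr g s).
Proof. exact: cbfun_inj. Qed.
Lemma trr_star (f : A) s : trr (cstar f) s = cstar (trr f s).
Proof. exact: cbfun_inj. Qed.

(** The square of the distance expands into weakly continuous terms, because the norm squares are
    entries of the field of [cmul (cstar f) f]. This is the strong continuity that [field_op_comp]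
    asks for. *)
Lemma trr_field_sot f s u :
  continuous (fun s' => complex.Re `|trr_field f s u - trr_field f s' u| : R^o).
Proof.
pose a := trr_field f s u.
pose sq s' : C := dot a a + dot (trr_field (cmul (cstar f) f) s' u) u -
  (dot (trr_field f s' u) a + (dot (trr_field f s' u) a)^*).
have sqE s' : sq s' = `|a - trr_field f s' u| ^+ 2.
  rewrite dot_norm dotBl !dotBr /sq /trr_field trr_mul trr_star.
  rewrite -(star_hom_norm rh) -[dot (rep U (trr f s') u) (rep U (trr f s') u)]dot_norm.
  by rewrite [dot a (rep U (trr f s') u)]dotC; ring.
have sqc : continuous (sq : X -> R[i]^o).
  have c1 : continuous (fun s' => dot (trr_field f s' u) a : R[i]^o).
    exact: trr_field_wot.
  have c2 : continuous (fun s' => (dot (trr_field f s' u) a)^* : R[i]^o).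
    apply/continuous_normP => x e e0; have := (continuous_normP _).1 c1 x e e0.
    by apply: filterS => y; rewrite -rmorphB norm_conjC.
  move=> x; apply: (@cvgB R[i] R[i]^o).
    by apply: (@cvgD R[i] R[i]^o); [exact: cvg_cst|exact: trr_field_wot].
  by apply: (@cvgD R[i] R[i]^o); [exact: c1|exact: c2].
have -> : (fun s' => complex.Re `|a - trr_field f s' u|) =
    fun s' => Num.sqrt (complex.Re (sq s')).
  apply/funext => s'; have [r r0 rE] := normCP (a - trr_field f s' u).
  rewrite sqE rE -(rmorphXn (real_complex R))/= sqrtr_sqr ger0_norm//.
move=> x; apply: (@continuous_comp _ _ _ (fun s' => complex.Re (sq s') : R^o) (@Num.sqrt R)).
  exact: continuous_Re.
exact: sqrt_continuous.
Qed.

Lemma comult_exists f : exists V : bop T2, [/\ is_field_op (trr_field f) V,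
  forall z, `|V z| <= `|f| * `|z| & vn_tensor (@bidual R A U) (@bidual R A U) V].
Proof.
have [V [VE VM VN]] := field_op_exists cX T2 (@trr_field_wot f) (normr_ge0 _) (@trr_field_bound f).
by exists V; split=> //; apply: VN => s; exact: rep_bidual.
Qed.

Definition comult f : bop T2 := sval (cid (comult_exists f)).

Lemma comult_field f : is_field_op (trr_field f) (comult f).
Proof. by have [] := svalP (cid (comult_exists f)). Qed.

Lemma comult_vn f : vn_tensor (@bidual R A U) (@bidual R A U) (comult f).
Proof. by have [] := svalP (cid (comult_exists f)). Qed.

Lemma comultE f u u' v v' :
  dot (comult f (tens T2 u u')) (tens T2 v v') = dot (rep U (ract (vf u' v') f) u) v.
Proof. by apply: comult_field => s /=; rewrite vfE. Qed.

Lemma comult_star_hom : star_hom comult.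
Proof.
split=> [k a b z|a b|a].
- have [W WE] := blin_lin_exists k (comult a) (comult b).
  suff -> : comult (k *: a + b) = W by rewrite WE.
  apply: tens_form_ext => u h v k'; rewrite WE dotDl dotZl !comultE ractP.
  by rewrite (star_homP rh) dotDl dotZl.
- have pV : is_field_op (trr_field (cmul a b)) (blin_comp (comult a) (comult b)).
    have := field_op_comp cX (@trr_field_wot a) (@comult_field a) (normr_ge0 _)
      (trr_field_bound a) (@trr_field_wot b) (@comult_field b) (@trr_field_sot b).
    congr is_field_op; apply/funext => s; apply: blinP => u.
    by rewrite /trr_field trr_mul (star_homM rh).
  exact: (field_op_uniq cX (@trr_field_wot (cmul a b)) (@comult_field (cmul a b)) pV).
- have -> : comult (cstar a) = adjoint (comult a); last exact: adjointP.
  have pV : is_field_op (trr_field (cstar a)) (adjoint (comult a)).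
    have := field_op_adjoint (@comult_field a).
    congr is_field_op; apply/funext => s; apply: adjoint_uniq => u v.
    by rewrite /trr_field trr_star (star_hom_dot rh).
  exact: (field_op_uniq cX (@trr_field_wot (cstar a)) (@comult_field (cstar a)) pV).
Qed.

Lemma comult_unit e : is_unit e -> comult e = blin_id T2.
Proof.
move=> eU; apply: tens_form_ext => u h v k; rewrite comultE /= tens_dot.
have te s : trr e s = e.
  by rewrite (cb_unit_eq cX eU); apply: cbfun_inj.
have -> : ract (vf h k) e = dot h k *: e :> A.
  rewrite {2}(cb_unit_eq cX eU).
  apply: cbfun_inj => s /=; rewrite te vfE (rep_unit eU).
  exact: esym (mulr1 _).
by rewrite (star_homZ rh) dotZl (rep_unit eU) mulrC.
Qed.

(** [comultE] integrates over the second variable first, [is_Phi] over the first variable first;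
    [mconv_ract] exchanges the two orders. *)
Lemma comult_pairing f (m l : dual A) : pairing2 (comult f) m l = mconv m l f.
Proof.
by rewrite /pairing2 comultE vectors_vf -vectorsP mconv_ract.
Qed.

Lemma comult_conv (m l : dual A) : Defs.conv comult m l = mconv m l.
Proof. by apply/funext => f; exact: comult_pairing. Qed.

Lemma comult_is_Phi : is_Phi mul idfun comult.
Proof.
move=> a; split=> [|m l]; first exact: comult_vn.
have -> : m \o idfun = m by [].
have -> : l \o idfun = l by [].
rewrite comult_pairing mconvE; symmetry; apply: sintE => t /=.
by rewrite (@sintE _ _ m _ (trl cX mul_cl a t)).
Qed.

End ComultiplicationField.

Variable T : htensor U H.

Lemma inclusion_op_exists : exists V : bop T, [/\ is_field_op p V, contractive V &
  vn_tensor (@bidual R A U) setT V].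
Proof.
have [V [VE VM VN]] := field_op_exists cX T pc ler01 pM.
by exists V; split=> // [z|]; [rewrite -[leRHS]mul1r|exact: VN].
Qed.

Lemma field_op_slice (V : bop T) u v : is_field_op p V ->
  vec_slice V u v = mop (vf u v).
Proof.
move=> pV; apply: vec_slice_eq => h k.
by rewrite (pV _ _ _ _ (mkcb cX (@pc h k)))// -vfE (@mopE _ _ _ _ _ _ _ _ _ _ (mkcb cX (@pc h k))).
Qed.

Lemma field_op_lslice (V : bop T) (m : dual A) : is_field_op p V -> lslice V m = mop m.
Proof. by move=> pV; rewrite /lslice field_op_slice// vectors_vf. Qed.

Lemma field_op_rslice (V : bop T) (w : predual H) (a : cbfun R X) : is_field_op p V ->
  (forall s, a s = w (p s)) -> rslice V w = rep U a.
Proof.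
move=> pV aE; apply: rslice_eq => u v.
by rewrite field_op_slice// -vfE; exact: mop_coef0.
Qed.

Lemma field_op_is_V (V : bop T) : is_field_op p V ->
  vn_tensor (@bidual R A U) setT V -> is_V idfun p V.
Proof.
move=> pV VN; split=> // m w; rewrite /pairing.
have -> : m \o idfun = m by [].
rewrite field_op_lslice// -(@mop_coef0 _ _ _ cX _ (@pc) p1 m w (coef cX (@pc) p1 w))//.
by symmetry; exact: sintE.
Qed.

Lemma field_op_eberlein (T2 : htensor U U) (V : bop T) : is_field_op p V -> contractive V ->
  vn_tensor (@bidual R A U) setT V -> is_eberlein (comult T2) V.
Proof.
move=> pV V1 VN; split=> //.
- exact: comult_vn.
- exact: comult_star_hom.
- split=> [e eU|ne]; first exact: comult_unit.
  by exfalso; apply: ne; exists (cb_one R cX); exact: cb_one_unit.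
- move=> w; exists (coef cX (@pc) p1 w).
  exact: field_op_rslice.
- apply/(@denseP R A) => f; apply: adherentS (pdense f) => g [w gE].
  by exists w; exact: field_op_rslice.
- move=> m l k; apply/funext => f.
  by rewrite !comult_conv; exact: mconvA.
- move=> m l; rewrite comult_conv !field_op_lslice//.
  exact: mop_conv.
Qed.

End SemigroupEberlein.

(** * Semigroups of contractions on the Fock space *)

Lemma lin_spanP (K : numFieldType) (E : lmodType K) (P : set E) k x y :
  lin_span P x -> lin_span P y -> lin_span P (k *: x + y).
Proof.
move=> [n [c [p [Pp ->]]]] [m [d [q [Pq ->]]]].
exists (n + m)%N, (fun i => match fintype.split i with inl i => k * c i | inr j => d j end),
  (fun i => match fintype.split i with inl i => p i | inr j => q j end); split.
  by move=> i; case: fintype.split.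
rewrite big_split_ord scaler_sumr; congr (_ + _); apply: eq_bigr => i _.
  by rewrite (unsplitK (inl i : 'I_n + 'I_m)) scalerA.
by rewrite (unsplitK (inr i : 'I_n + 'I_m)).
Qed.

Lemma lin_span_sub (K : numFieldType) (E : lmodType K) (P : set E) x : P x -> lin_span P x.
Proof. by move=> Px; exists 1%N, (fun=> 1), (fun=> x); rewrite big_ord1 scale1r. Qed.

Lemma lin_span0 (K : numFieldType) (E : lmodType K) (P : set E) : lin_span P 0.
Proof.
exists 0%N, (fun=> 0), (fun=> 0); rewrite big_ord0; split=> //.
by case.
Qed.

Lemma lin_span_ind (K : numFieldType) (E : lmodType K) (P Q : set E) : Q 0 ->
  (forall k x y, P x -> Q y -> Q (k *: x + y)) -> lin_span P `<=` Q.
Proof.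
move=> Q0 QD _ [n [c [p [Pp ->]]]]; elim/big_rec: _ => // i x _; exact: QD.
Qed.

Lemma continuous_blin (R : realType) (E F : normedModType R[i]) (x : blin E F) :
  continuous (x : E -> F).
Proof.
move=> u; apply/cvgrPdist_le => e e0; have [M M0 xM] := blin_gt0 x.
have d0 : 0 < e / M by rewrite divr_gt0.
near=> v; rewrite -blinB (le_trans (xM _))// -ler_pdivlMl// mulrC.
by near: v; have /cvgrPdist_le := @cvg_id _ (nbhs u); exact.
Unshelve. all: by end_near. Qed.

Section WeakContinuity.
Variables (R : realType) (X : topologicalType).
Local Notation C := R[i].

Lemma continuous_prod_ord N (f : 'I_N -> X -> R[i]^o) : (forall i, continuous (f i)) ->
  continuous (fun x => \prod_i f i x : R[i]^o).
Proof.
elim: N f => [|N IH] f fc.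
  have -> : (fun x => \prod_i f i x) = (fun=> 1) by apply/funext => x; rewrite big_ord0.
  exact: cst_continuous.
have -> : (fun x => \prod_i f i x) = (fun x => (\prod_i f (lift ord0 i) x) * f ord0 x).
  by apply/funext => x; rewrite big_ord_recl mulrC.
by move=> x; apply: cvgM; [exact: IH|exact: fc].
Qed.

Lemma continuous_mulC (f g : X -> R[i]^o) : continuous f -> continuous g ->
  continuous (fun x => f x * g x : R[i]^o).
Proof. by move=> fc gc x; apply: cvgM; [exact: fc|exact: gc]. Qed.

Lemma continuous_conjC (f : X -> R[i]^o) : continuous f ->
  continuous (fun x => (f x)^* : R[i]^o).
Proof.
move=> fc; apply/continuous_normP => x e e0; have := (continuous_normP _).1 fc x e e0.
by apply: filterS => y; rewrite -rmorphB norm_conjC.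
Qed.

(** Contractivity lets weak continuity pass from a total set to the whole space by uniform limits,
    one argument at a time. *)
Lemma wot_continuous_total (H : hilbert R) (G : set H) (p : X -> bop H) :
  (forall s, contractive (p s)) -> (forall z, adherent (lin_span G) z) ->
  (forall g g', G g -> G g' -> continuous (fun s => dot (p s g) g' : R[i]^o)) ->
  wot_continuous p.
Proof.
move=> p1 Gd Gc h k.
have step (x : H) (Q : set H) z : adherent Q z ->
    (forall y, Q y -> continuous (fun s => dot (p s x) y : R[i]^o)) ->
    continuous (fun s => dot (p s x) z : R[i]^o).
  move=> Qz Qc; apply: cb_uniform_limit => e e0.
  have x0 : 0 < `|x| + 1 by rewrite ltr_wpDl.
  have [|y Qy zy] := Qz (e / (`|x| + 1)); first by rewrite divr_gt0.
  exists (fun s => dot (p s x) y) => [|s]; first exact: Qc.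
  rewrite -dotBr (le_trans (cauchy_schwarz _ _))//.
  rewrite (le_trans (ler_pM _ _ (p1 s x) zy))//.
  rewrite mulrCA ler_piMr ?(ltW e0)// ler_pdivrMr// mul1r.
  by rewrite lerDl.
have step' (y : H) (Q : set H) z : adherent Q z ->
    (forall x, Q x -> continuous (fun s => dot (p s x) y : R[i]^o)) ->
    continuous (fun s => dot (p s z) y : R[i]^o).
  move=> Qz Qc; apply: cb_uniform_limit => e e0.
  have x0 : 0 < `|y| + 1 by rewrite ltr_wpDl.
  have [|x Qx zx] := Qz (e / (`|y| + 1)); first by rewrite divr_gt0.
  exists (fun s => dot (p s x) y) => [|s]; first exact: Qc.
  rewrite -dotBl -blinB (le_trans (cauchy_schwarz _ _))//.
  rewrite (le_trans (ler_wpM2r _ (le_trans (p1 s _) zx)))//.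
  rewrite -mulrA ler_piMr ?(ltW e0)// mulrC ler_pdivrMr// mul1r.
  by rewrite lerDl.
apply: step' (Gd h) _ => _ [n [c [g [Gg ->]]]]; apply: step (Gd k) _.
move=> _ [m [d [g' [Gg' ->]]]].
have -> : (fun s => dot (p s (\sum_i c i *: g i)) (\sum_j d j *: g' j)) =
    (fun s => \sum_i \sum_j c i * (d j)^* * dot (p s (g i)) (g' j)).
  apply/funext => s; rewrite blin_sum dot_suml; apply: eq_bigr => i _.
  rewrite dot_sumr; apply: eq_bigr => j _.
  by rewrite blinZ dotZl dotZr mulrA.
apply: continuous_sum => i; apply: continuous_sum => j.
move=> s; apply: (@cvgM R[i]); [exact: cvg_cst|exact: Gc].
Qed.

End WeakContinuity.

Lemma contractive_comp (R : realType) (H : hilbert R) (x y : bop H) :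
  contractive x -> contractive y -> contractive (blin_comp x y).
Proof. by move=> x1 y1 u; rewrite (le_trans (x1 _))//; exact: y1. Qed.

Lemma wot_weak_continuous (R : realType) (H : hilbert R) (Y : topologicalType)
    (f : Y -> bop H) : (forall s, contractive (f s)) -> wot_continuous f ->
  continuous (f : Y -> bop_top weak_star H).
Proof.
move=> f1 fc; apply: continuous_weak => w.
by apply: (@predual_continuous _ _ _ f 1) => // s u; rewrite mul1r; exact: f1.
Qed.

Section SubsemigroupTopology.
Variables (R : realType) (H : hilbert R) (S : set (bop H)).
Local Notation Xs := (sub_top strong_star S).

Lemma strong_sub_eval u : continuous (fun s : Xs => sub_val s u).
Proof.
move=> s; apply: (@continuous_comp _ _ _
  (@sub_val R strong_star H S : _ -> bop_top strong_star H) (fun x : bop H => x u)).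
  exact: sub_val_continuous.
exact: strong_eval.
Qed.

Lemma strong_sub_eval_adjoint u : continuous (fun s : Xs => adjoint (sub_val s) u).
Proof.
move=> s; apply: (@continuous_comp _ _ _
  (@sub_val R strong_star H S : _ -> bop_top strong_star H) (fun x : bop H => adjoint x u)).
  exact: sub_val_continuous.
exact: strong_eval_adjoint.
Qed.

End SubsemigroupTopology.

Section SubsemigroupProduct.
Variables (R : realType) (H : hilbert R) (tau : op_topology).
Variables (S : set (bop H)) (sgS : subsemigroup S).
Hypothesis S1 : forall x, S x -> contractive x.
Local Notation X := (sub_top tau S).

Lemma sub_mul_cl t : continuous (fun s : X => sub_mul sgS s t).
Proof.
apply: continuous_sub; case: tau t => t.
  apply: wot_weak_continuous => [s|h k].
    exact: (contractive_comp (S1 (sub_val_mem s)) (S1 (sub_val_mem t))).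
  exact: (@sub_val_wot _ _ _ S).
apply: continuous_strong => u; first exact: strong_sub_eval.
have -> : (fun s : sub_top strong_star S => adjoint (sub_val (sub_mul sgS s t)) u) =
    (fun s => adjoint (sub_val t) (adjoint (sub_val s) u)).
  by apply/funext => s; rewrite adjoint_comp.
move=> s; apply: (@continuous_comp _ _ _
  (fun s : sub_top strong_star S => adjoint (sub_val s) u) (adjoint (sub_val t))).
  exact: strong_sub_eval_adjoint.
exact: continuous_blin.
Qed.

Lemma sub_mul_cr s : continuous (sub_mul (tau := tau) sgS s).
Proof.
apply: continuous_sub; case: tau s => s.
  apply: wot_weak_continuous => [t|h k].
    exact: (contractive_comp (S1 (sub_val_mem s)) (S1 (sub_val_mem t))).
  have -> : (fun t : sub_top weak_star S => dot (sub_val (sub_mul sgS s t) h) k : R[i]^o) =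
    fun t => dot (sub_val t h) (adjoint (sub_val s) k).
    by apply/funext => t; rewrite /= -adjointP.
  exact: (@sub_val_wot _ _ _ S).
apply: continuous_strong => u.
  move=> t; apply: (@continuous_comp _ _ _
    (fun t : sub_top strong_star S => sub_val t u) (sub_val s)).
    exact: strong_sub_eval.
  exact: continuous_blin.
have -> : (fun t : sub_top strong_star S => adjoint (sub_val (sub_mul sgS s t)) u) =
    (fun t => adjoint (sub_val t) (adjoint (sub_val s) u)).
  by apply/funext => t; rewrite adjoint_comp.
exact: strong_sub_eval_adjoint.
Qed.

End SubsemigroupProduct.

(** * Coefficients of the Fock space representation *)

Section FockInclusion.
Variables (R : realType) (H : hilbert R) (F : fock H) (tau : op_topology).
Variables (S : set (bop H)) (sgS : subsemigroup S).
Hypothesis S1 : forall x, S x -> contractive x.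
Hypothesis cS : compact (S : set (bop_top tau H)).
Hypothesis S0 : ~ S (blin_zero H H).
Local Notation C := R[i].
Local Notation X := (sub_top tau S).
Local Notation A := (cb_algebra R X).

Let cX : compact [set: X] := compact_sub_top cS.
Let mul := sub_mul (tau := tau) sgS.
Let v1 (s : X) : contractive (sub_val s).
Proof. exact: (S1 (sub_val_mem s)). Qed.

Definition fock_incl (s : X) : bop F := fock_op F (sub_val s).

Lemma fock_incl1 s : contractive (fock_incl s).
Proof. by have [] := fock_opP F (@v1 s). Qed.

Lemma fock_incl_mul s t : fock_incl (mul s t) = blin_comp (fock_incl s) (fock_incl t).
Proof. exact: (fock_op_comp F (@v1 s) (@v1 t)). Qed.

(** Entries between generators are finite products of coefficients of [s] and of their conjugates;
    contractivity extends continuity to all entries. *)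
Lemma fock_incl_wot : wot_continuous fock_incl.
Proof.
apply: (wot_continuous_total fock_incl1 (@fock_adherent R H F)) => _ _ [p _ <-] [q _ <-].
pose N := maxn (fgm p) (fgn p).
have slotc (m m' : nat) (xi : 'I_m -> H) (xi' : 'I_m' -> H) k :
    continuous (fun s : X => slot (sub_val s \o xi) xi' k : R[i]^o).
  have -> : (fun s : X => slot (sub_val s \o xi) xi' k : R[i]^o) =
      fun s => dot (sub_val s (pad xi k)) (pad xi' k) + (m <= k)%N%:R * (m' <= k)%N%:R.
    by apply/funext => s; rewrite /slot pad_comp.
  have dc := @sub_val_wot R H tau S (pad xi k) (pad xi' k).
  apply/continuous_normP => s e e0; apply: filterS ((continuous_normP _).1 dc s e e0) => y.
  by rewrite opprD addrACA subrr addr0.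
have -> : (fun s => dot (fock_incl s (fock_vec F p)) (fock_vec F q) : R[i]^o) =
    fun s : X => (fgm p == fgm q)%:R * (fgn p == fgn q)%:R *
    (\prod_(k < N) slot (sub_val s \o @fgxi _ _ p) (@fgxi _ _ q) k *
     \prod_(k < N) (slot (sub_val s \o @fgeta _ _ p) (@fgeta _ _ q) k)^*).
  apply/funext => s; rewrite (fock_opP F (@v1 s)).1.
  by rewrite (@fock_vec_dot _ _ F N (fock_map (sub_val s) p)) ?leq_maxl ?leq_maxr.
apply: continuous_mulC; first exact: cst_continuous.
apply: continuous_mulC; apply: continuous_prod_ord => k; first exact: slotc.
exact/continuous_conjC/slotc.
Qed.

(** With [m] plain and [n] conjugate factors, [m + n >= 1], these are coefficients of [F] between
    elementary tensors. Their span is a self-adjoint algebra: products concatenate the lists and the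
    star exchanges them. *)
Definition monomial : set A := [set f : A | exists l1 l2 : seq (H * H),
  (0 < size l1 + size l2)%N /\ forall s, (f : cbfun R X) s =
    \prod_(p <- l1) dot (sub_val s p.1) p.2 * \prod_(p <- l2) (dot (sub_val s p.1) p.2)^*].

Definition coefficient (u v : H) : A := mkcb cX (@sub_val_wot R H tau S u v).

Lemma coefficient_span u v : lin_span monomial (coefficient u v).
Proof.
apply: lin_span_sub; exists [:: (u, v)], [::]; split=> // s.
by rewrite big_nil big_seq1 mulr1.
Qed.

Lemma monomial_dot (f : A) : monomial f -> exists h k : F,
  forall s, (f : cbfun R X) s = dot (fock_incl s h) k.
Proof.
move=> [l1 [l2 [l0 fE]]].
pose p := FockGen (fun i => (tnth (in_tuple l1) i).1) (fun i => (tnth (in_tuple l2) i).1) l0.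
exists (fock_vec F p), (fock_emb F (fun i => (tnth (in_tuple l1) i).2)
  (fun i => (tnth (in_tuple l2) i).2)).
move=> s; rewrite fE (fock_opP F (@v1 s)).1 /fock_vec/= fock_dot//=.
by rewrite (big_tnth _ _ l1) (big_tnth _ _ l2).
Qed.

Lemma fock_incl_dense (f : A) :
  adherent [set g : A | exists w : predual F, forall s, (g : cbfun R X) s = w (fock_incl s)] f.
Proof.
apply: adherentS (@stone_weierstrass R X cX (lin_span monomial) _ _ _ _ _ _ _ f).
(* A linear combination of coefficients is again given by a single normal functional, by
   [vec_predual]. *)
- move=> _ [n [c [q [Mq ->]]]].
  have hk i : {hk : F * F | forall s, (q i : cbfun R X) s = dot (fock_incl s hk.1) hk.2}.
    by apply: cid; have [h [k E]] := monomial_dot (Mq i); exists (h, k).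
  have [w wE] := vec_predual (fun i => c i *: (sval (hk i)).1) (fun i => (sval (hk i)).2).
  exists w => s; rewrite wE cb_sumE; apply: eq_bigr => i _.
  by rewrite blinZ dotZl -(svalP (hk i)).
- exact: lin_span0.
- by move=> g h Dg Dh; rewrite -[g]scale1r; exact: lin_spanP.
- by move=> k g Dg; rewrite -[k *: g]addr0; apply: lin_spanP => //; exact: lin_span0.
- move=> g h Dg; move: g Dg h; apply: (@lin_span_ind _ _ _
      [set g | forall h, lin_span monomial h -> lin_span monomial (cmul g h)]) =>
      [h _|k g g' Mg IH h Dh].
    apply: (eq_ind _ (lin_span monomial) (@lin_span0 _ A _)).
    by symmetry; apply: cbfun_inj => s /=; exact: mul0r.
  apply: (eq_ind_r (lin_span monomial) _ (cmul_linl k g g' h)); apply: lin_spanP (IH h Dh).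
  move: h Dh; apply: (@lin_span_ind _ _ _ [set h | lin_span monomial (cmul g h)]) =>
    [|k' h' h'' Mh Dh].
    apply: (eq_ind _ (lin_span monomial) (@lin_span0 _ A _)).
    by symmetry; apply: cbfun_inj => s /=; exact: mulr0.
  apply: (eq_ind_r (lin_span monomial) _ (cmul_linr k' h' h'' g)).
  apply: lin_spanP => //; apply: lin_span_sub.
  have [[l1 [l2 [l0 gE]]] [l1' [l2' [l0' hE]]]] := (Mg, Mh).
  exists (l1 ++ l1'), (l2 ++ l2'); split=> [|s]; first by rewrite !size_cat addnACA ltn_addr.
  by rewrite /= gE hE !big_cat/=; exact: mulrACA.
- apply: (@lin_span_ind _ _ _ [set g | lin_span monomial (cstar g)]) => [|k g g' Mg IH].
    apply: (eq_ind _ (lin_span monomial) (@lin_span0 _ A _)).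
    by symmetry; apply: cbfun_inj => s /=; exact: rmorph0.
  apply: (eq_ind_r (lin_span monomial) _ (cstar_antilin k g g')).
  apply: lin_spanP IH; apply: lin_span_sub.
  have [l1 [l2 [l0 gE]]] := Mg; exists l2, l1; split=> [|s]; first by rewrite addnC.
  rewrite /= gE rmorphM mulrC !rmorph_prod; congr (_ * _).
  by apply: eq_bigr => i _; exact: conjCK.
- move=> s t st; apply: contrapT => nD; apply: st; apply: sub_val_inj.
  apply: blinP => u; apply: dot_ext => v; apply: contrapT => ne; apply: nD.
  exists (@coefficient u v); last by [].
  exact: coefficient_span.
- move=> s; apply: contrapT => nD; apply: S0.
  suff <- : sub_val s = blin_zero H H by exact: sub_val_mem.
  apply: blinP => u; apply: dot_ext => v; rewrite dot0l; apply: contrapT => ne; apply: nD.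
  exists (@coefficient u v); last by [].
  exact: coefficient_span.
Qed.

Theorem subsemigroup_eberlein (U : univ_rep A) (T2 : htensor U U) (T : htensor U F) :
  exists (Phi : A -> bop T2) (V : bop T),
    [/\ is_Phi mul idfun Phi, is_V idfun fock_incl V & is_eberlein Phi V].
Proof.
have [V [VE V1 VN]] := inclusion_op_exists cX fock_incl_wot fock_incl1 T.
exists (comult cX (@fock_incl_wot) fock_incl1 fock_incl_dense
  (@sub_mul_cr _ _ tau S sgS S1) fock_incl_mul T2), V; split.
- apply: comult_is_Phi; exact: (@sub_mul_cl _ _ tau S sgS S1).
- exact: (field_op_is_V cX (@fock_incl_wot) fock_incl1 VE VN).
- apply: field_op_eberlein => //; exact: (@sub_mul_cl _ _ tau S sgS S1).
Qed.

End FockInclusion.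

(** * Characters and multipliers *)

Section CharacterEigenvector.
Variables (R : realType) (A : cstar_algebra R) (U : univ_rep A) (e : A).
Hypothesis eU : is_unit e.
Variable chi : dual A.
Hypothesis chiM : forall a b, chi (cmul a b) = chi a * chi b.
Hypothesis chi1 : chi e = 1.
Local Notation C := R[i].

Let rh := rep_star_hom U.

(** From [0 <= x^* x <= M^2] the operator [1 - M^-2 x^* x] lies between [0] and [1]. It turns an
    element of the kernel of a character into a contraction on which the character is [1]. *)
Lemma sub_sq_contractive (x : bop U) (M : C) u : 0 < M -> (forall u, `|x u| <= M * `|u|) ->
  `|u - M ^- 2 *: adjoint x (x u)| <= `|u|.
Proof.
move=> M0 xM; rewrite -(@ler_pXn2r _ 2) ?nnegrE// !dot_norm dotBl !dotBr !dotZl !dotZr.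
have Mr : (M ^- 2)^* = M ^- 2 by rewrite geC0_conj// invr_ge0 exprn_ge0// ltW.
rewrite Mr.
have axM : `|adjoint x (x u)| ^+ 2 <= M ^+ 2 * `|x u| ^+ 2.
  rewrite -exprMn ler_pXn2r ?nnegrE ?mulr_ge0// ?(ltW M0)//.
  exact: adjoint_bound (ltW M0) xM _.
have e1 : dot (adjoint x (x u)) u = `|x u| ^+ 2 by rewrite dot_adjoint dot_norm.
have e2 : dot u (adjoint x (x u)) = `|x u| ^+ 2 by rewrite -adjointP dot_norm.
rewrite e1 e2 -[dot (adjoint x (x u)) _]dot_norm -subr_ge0.
move: (`|x u| ^+ 2) (`|adjoint x (x u)| ^+ 2) (dot u u) axM
  (exprn_ge0 2 (normr_ge0 (x u))) => a b c ab a0.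
rewrite [X in 0 <= X](_ : _ = M ^- 2 * a + (M ^- 2 * M ^- 2) * (M ^+ 2 * a - b)); last first.
  by field; rewrite gt_eqF.
have M2 : 0 <= M ^- 2 by rewrite invr_ge0 exprn_ge0// ltW.
by rewrite addr_ge0// !mulr_ge0// subr_ge0.
Qed.

(** Contractions [rep b] with [chi b = 1] map [K] to itself, so they fix its vector [w] of minimal
    norm. For [h] in the kernel of [chi], [b = e - M^-2 h^* h] is such an element, whence [h w = 0].
    The clause [dot w v = 1] keeps [w] nonzero. *)
Lemma character_vector u v : (forall a, chi a = dot (rep U a u) v) ->
  exists w : U, [/\ dot w v = 1, forall a, rep U a w = chi a *: w &
    adherent [set z | exists2 a, chi a = 1 & z = rep U a u] w].
Proof.
move=> chiE.
pose K := adherent [set z | exists a, [/\ chi a = 1, contractive (rep U a) & z = rep U a u]].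
have Kv z : K z -> dot z v = 1.
  move=> Kz; apply: approx_eq => d d0; have d1 : 0 < d / (`|v| + 1).
    by rewrite divr_gt0// ltr_wpDl.
  have [_ [a [a1 _ ->]] za] := Kz _ d1.
  rewrite -a1 chiE -dotBl (le_trans (cauchy_schwarz _ _))//.
  rewrite (le_trans (ler_wpM2r _ za))// -mulrA ler_piMr ?(ltW d0)//.
  by rewrite mulrC ler_pdivrMr ?ltr_wpDl// mul1r lerDl.
have Kmap b z : chi b = 1 -> contractive (rep U b) -> K z -> K (rep U b z).
  move=> b1 bc Kz d d0; have [_ [a [a1 ac ->]] za] := Kz d d0.
  exists (rep U (cmul b a) u); last first.
    by rewrite (star_homM rh) -blinB (le_trans (bc _)).
  exists (cmul b a); split=> //; first by rewrite chiM b1 a1 mulr1.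
  by move=> y; rewrite (star_homM rh) (le_trans (bc _)).
have [||x y Kx Ky|w [Kw _ wmin]] := @min_norm R U K.
- exists u; apply: sub_adherent; exists e; split=> //.
    by move=> z; rewrite (rep_unit eU).
  by rewrite (rep_unit eU).
- exact: adherentK.
- move=> d d0; have [_ [a [a1 ac ->]] xa] := Kx d d0.
  have [_ [b [b1 bc ->]] yb] := Ky d d0.
  have h0 : 0 <= 2^-1 :> C by rewrite invr_ge0.
  exists (rep U (2^-1 *: (a + b)) u); last first.
    rewrite (star_homZ rh) (star_homD rh) -scalerBr opprD addrACA normrZ ger0_norm//.
    rewrite mulrC ler_pdivrMr// mulr_natr mulr2n (le_trans (ler_normD _ _))//.
    exact: lerD.
  exists (2^-1 *: (a + b)); split=> //.
    by rewrite blinZ blinD a1 b1 -mulr2n; apply: mulVf; rewrite pnatr_eq0.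
  move=> z; rewrite (star_homZ rh) (star_homD rh) normrZ ger0_norm//.
  rewrite mulrC ler_pdivrMr// mulr_natr mulr2n (le_trans (ler_normD _ _))//.
  by rewrite lerD.
have fixw b : chi b = 1 -> contractive (rep U b) -> rep U b w = w.
  by move=> b1 bc; apply: wmin => //; exact: Kmap.
have kerw h : chi h = 0 -> rep U h w = 0.
  move=> h0; have [M M0 hM] := blin_gt0 (rep U h).
  pose b := e - M ^- 2 *: cmul (cstar h) h.
  have bE z : rep U b z = z - M ^- 2 *: adjoint (rep U h) (rep U h z).
    rewrite (star_homB rh) (star_homZ rh) (star_homM rh) (rep_unit eU).
    by rewrite (adjoint_uniq (fun y z' => star_hom_dot rh h y z')).
  have /eqP : rep U b w = w.
    apply: fixw; last by move=> z; rewrite bE; exact: sub_sq_contractive.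
    rewrite linearB/= linearZ/= chi1 chiM h0 mulr0.
    by rewrite [X in _ - X](mulr0 _) subr0.
  rewrite bE -subr_eq0 addrAC subrr add0r oppr_eq0 scaler_eq0 invr_eq0 expf_eq0/= gt_eqF//=.
  move=> /eqP hw; apply/eqP; rewrite -normr_eq0 -sqrf_eq0 dot_norm.
  by rewrite adjointP hw dot0r.
have eig a : rep U a w = chi a *: w.
  have : rep U (a - chi a *: e) w = 0.
    by apply: kerw; rewrite linearB/= linearZ/= chi1 [X in _ - X](mulr1 _) subrr.
  by rewrite (star_homB rh) (star_homZ rh) (rep_unit eU) => /eqP; rewrite subr_eq0 => /eqP.
exists w; split=> //; first exact: Kv.
by apply: adherentS Kw => _ [a [a1 _ ->]]; exists a.
Qed.

Lemma character_eigenvector : exists w : U, `|w| = 1 /\ forall a, rep U a w = chi a *: w.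
Proof.
have [u [v chiE]] := @rep_vector _ _ U chi.
have [w [wv eig _]] := character_vector chiE.
have w0 : `|w| != 0.
  by rewrite normr_eq0; apply/eqP => w0; move/eqP: wv; rewrite w0 dot0l eq_sym oner_eq0.
exists (`|w|^-1 *: w); split=> [|a].
  by rewrite normrZ normfV normr_id mulVf.
by rewrite blinZ eig !scalerA mulrC.
Qed.

End CharacterEigenvector.

(** * The minimal tensor product with the compact operators *)

Section MinTensor.
Variables (R : realType) (A : cstar_algebra R) (U : univ_rep A) (H : hilbert R).
Variable T : htensor U H.
Local Notation C := R[i].

Definition elem_tensor : set (bop T) :=
  [set t | exists a k, compact_op k /\ is_tens_op (rep U a) k t].

Definition fin_tensor : set (T -> T) := [set f | exists n (t : 'I_n -> bop T),
  (forall i, elem_tensor (t i)) /\ forall z, f z = \sum_i t i z].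

Lemma fin_tensor_elem t : elem_tensor t -> fin_tensor t.
Proof. by move=> tE; exists 1%N, (fun=> t); split=> // z; rewrite big_ord1. Qed.

Lemma fin_tensor_add f g : fin_tensor f -> fin_tensor g -> fin_tensor (fun z => f z + g z).
Proof.
move=> [n [t [tE fE]]] [m [t' [tE' gE]]].
exists (n + m)%N, (fun i => match fintype.split i with inl i => t i | inr j => t' j end).
split=> [i|z]; first by case: fintype.split.
rewrite fE gE big_split_ord; congr (_ + _); apply: eq_bigr => i _.
  by rewrite (unsplitK (inl i : 'I_n + 'I_m)).
by rewrite (unsplitK (inr i : 'I_n + 'I_m)).
Qed.

Lemma fin_tensor_sum n (f : 'I_n -> T -> T) : (forall i, fin_tensor (f i)) ->
  fin_tensor (fun z => \sum_i f i z).
Proof.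
elim: n f => [|n IH] f fF.
  exists 0%N, (fun=> blin_zero T T); split=> [[]//|z].
  by rewrite !big_ord0.
have -> : (fun z => \sum_i f i z) = fun z => f ord0 z + \sum_(i < n) f (lift ord0 i) z.
  by apply/funext => z; rewrite big_ord_recl.
by apply: fin_tensor_add => //; exact: IH.
Qed.

Lemma min_tensorP (b : bop T) : min_tensor_compact b <->
  forall d : C, 0 < d -> exists f, fin_tensor f /\ forall z, `|b z - f z| <= d * `|z|.
Proof.
split=> bT d d0; have := bT d d0.
  by move=> [n [t [tE bE]]]; exists (fun z => \sum_i t i z); split=> //; exists n, t.
by move=> [f [[n [t [tE fE]]] bE]]; exists n, t; split=> // z; rewrite -fE.
Qed.

Lemma min_tensor_stable (F : bop T -> bop T) (M : C) :
  0 < M ->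
  (forall (b : bop T) n (t : 'I_n -> bop T) (d : C), 0 < d ->
    (forall z, `|b z - \sum_i t i z| <= d * `|z|) ->
    forall z, `|F b z - \sum_i F (t i) z| <= M * d * `|z|) ->
  (forall t, elem_tensor t -> min_tensor_compact (F t)) ->
  forall b, min_tensor_compact b -> min_tensor_compact (F b).
Proof.
move=> M0 FM Ft b bT; apply/min_tensorP => d d0.
(* Half of [d] pays for replacing [b] by a finite sum; the other half is shared among the [n] terms,
   with [n + 1] to avoid division by zero. *)
have [|n [t [tE tb]]] := bT (d / 2 / M); first by rewrite !divr_gt0.
have n0 : 0 < n%:R + 1 :> C by rewrite ltr_wpDl.
have tf i : {f | fin_tensor f /\ forall z, `|F (t i) z - f z| <= d / 2 / (n%:R + 1) * `|z|}.
  apply: cid; have /min_tensorP := Ft _ (tE i); apply.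
  by rewrite !divr_gt0.
exists (fun z => \sum_i sval (tf i) z); split.
  by apply: fin_tensor_sum => i; have [] := svalP (tf i).
move=> z; rewrite -(subrKA (\sum_i F (t i) z)) (le_trans (ler_normD _ _))//.
rewrite [X in _ <= X * _]splitr mulrDl lerD//.
  have := FM _ _ _ _ _ tb z; rewrite mulrCA mulfV ?gt_eqF// mulr1; apply.
  by rewrite !divr_gt0.
rewrite -sumrB (le_trans (ler_norm_sum _ _ _))//.
rewrite (le_trans (ler_sum _ (fun i _ => (svalP (tf i)).2 z)))//.
rewrite sumr_const card_ord -[_ *+ n]mulr_natl mulrA ler_wpM2r//.
rewrite mulrCA ler_piMr ?divr_ge0 ?(ltW d0)// ler_pdivrMr// mul1r.
by rewrite lerDl.
Qed.

Lemma min_tensor_comp_l (V b : bop T) :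
  (forall t, elem_tensor t -> min_tensor_compact (blin_comp V t)) ->
  min_tensor_compact b -> min_tensor_compact (blin_comp V b).
Proof.
move=> Vt; have [M M0 VM] := blin_gt0 V.
apply: (@min_tensor_stable (fun b => blin_comp V b) M) => // {}b n t d d0 bt z /=.
by rewrite -blin_sum -blinB (le_trans (VM _))// -mulrA ler_pM2l.
Qed.

Lemma min_tensor_comp_r (V b : bop T) :
  (forall t, elem_tensor t -> min_tensor_compact (blin_comp t V)) ->
  min_tensor_compact b -> min_tensor_compact (blin_comp b V).
Proof.
move=> Vt; have [M M0 VM] := blin_gt0 V.
apply: (@min_tensor_stable (fun b => blin_comp b V) M) => // {}b n t d d0 bt z /=.
by rewrite (le_trans (bt _))// [M * d]mulrC -mulrA ler_pM2l.
Qed.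

End MinTensor.

(** * Compact operators and finite nets *)

Section CompactOperators.
Variables (R : realType) (H : hilbert R).
Local Notation C := R[i].

Lemma compact_op_sub (k : bop H) (K : set H) : compact K ->
  (forall u, `|u| <= 1 -> K (k u)) -> compact_op k.
Proof.
move=> cK kK; apply: (subclosed_compact _ cK); first exact: closed_closure.
have : closed K by apply: compact_closed => //; exact: norm_hausdorff.
by move/closure_id ->; apply: closure_subset => _ [u u1 <-]; exact: kK.
Qed.

Lemma compact_op_comp_l (s k : bop H) : compact_op k -> compact_op (blin_comp s k).
Proof.
move=> ck; apply: (@compact_op_sub _ (s @` closure (k @` [set u : H | `|u| <= 1]))).
  apply: continuous_compact => //; apply: continuous_subspaceT; exact: continuous_blin.
by move=> u u1; exists (k u) => //; apply: subset_closure; exists u.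
Qed.

Lemma compact_op_comp_r (s k : bop H) : contractive s -> compact_op k -> compact_op (blin_comp k s).
Proof.
move=> s1 ck; apply: (compact_op_sub ck) => u u1.
by apply: subset_closure; exists (s u) => //=; rewrite (le_trans (s1 _)).
Qed.

Lemma compact_rank1 (x y : H) : compact_op (rank1 x y).
Proof.
have [r r0 rE] := normCP y.
pose f (c : R * R) : H := (c.1%:C + 'i * c.2%:C)%C *: x.
have I0 : compact (`[- r, r] : set R) by exact: segment_compact.
apply: (@compact_op_sub _ (f @` (`[- r, r] `*` `[- r, r]))).
  apply: continuous_compact; last exact: compact_setX.
  apply: continuous_subspaceT => c; apply: cvgZr_tmp.
  have c1 : continuous (fun c : R * R => c.1%:C%C : R[i]^o).
    by apply: continuous_real => z; exact: cvg_fst.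
  have c2 : continuous (fun c : R * R => c.2%:C%C : R[i]^o).
    by apply: continuous_real => z; exact: cvg_snd.
  apply: (@cvgD R[i] R[i]^o); first exact: c1.
  exact: (continuous_mulC (@cst_continuous _ R[i]^o 'i%C) c2).
move=> u u1; rewrite rank1E; have := cauchy_schwarz u y.
have uy : `|dot u y| <= r%:C%C.
  rewrite -rE (le_trans (cauchy_schwarz _ _))// ler_piMl//.
move=> _; exists (complex.Re (dot u y), complex.Im (dot u y)); last by rewrite /f/= -complexE.
have ab (a : R) : `|a|%:C%C <= `|dot u y| -> - r <= a <= r.
  by move=> ad; rewrite -ler_norml -lecR (le_trans ad).
split=> /=; rewrite in_itv/= ab ?normc_ge_Re//.
by rewrite -normrN -ReiNIm (le_trans (normc_ge_Re _))// normrM normci mulr1.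
Qed.

Lemma compact_op_net (k : bop H) (d : C) : compact_op k -> 0 < d ->
  exists n (x : 'I_n -> H), forall u, `|u| <= 1 -> exists i, `|k u - x i| <= d.
Proof.
move=> ck d0.
pose F := filter_from [set: seq H] (fun s => [set t : seq H | {subset s <= t}]).
have FF : ProperFilter F.
  apply: filter_from_proper; last by move=> s _; exists s => x.
  apply: filter_from_filter; first by exists [::].
  move=> s t _ _; exists (s ++ t) => // w /= stw.
  by split=> x xs; apply: stw; rewrite mem_cat xs ?orbT.
have := (compact_near_coveringP _).1 ck (seq H) F
  (fun s y => exists2 x, x \in s & `|y - x| <= d) _.
case=> [x _|s _ sO].
  exists ([set y | `|y - x| <= d], [set t : seq H | x \in t]) => /=.
    split; last by exists [:: x] => // t /= xt; apply: xt; rewrite mem_head.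
    have /cvgrPdist_le/(_ _ d0) := @cvg_id _ (nbhs x); apply: filterS => y.
    by rewrite distrC.
  by move=> [y t] [/= Oy xt]; exists x.
exists (size s), (fun i => s`_i) => u u1.
have ku : closure (k @` [set u | `|u| <= 1]) (k u) by apply: subset_closure; exists u.
have [x xs kx] := sO s (fun x xs => xs) (k u) ku.
by exists (Ordinal (etrans (index_mem x s) xs)); rewrite nth_index.
Qed.

End CompactOperators.

Lemma unit_ball_bound (R : realType) (E F : normedModType R[i]) (x : blin E F) (M : R[i]) :
  (forall u, `|u| <= 1 -> `|x u| <= M) -> forall u, `|x u| <= M * `|u|.
Proof.
move=> xM u; have [->|u0] := eqVneq u 0; first by rewrite blin0 !normr0 mulr0.
have n0 : 0 < `|u| by rewrite normr_gt0.
have := xM (`|u|^-1 *: u); rewrite blinZ !normrZ normfV normr_id mulVf ?gt_eqF//.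
by rewrite mulrC ler_pdivrMr//; exact.
Qed.

Lemma field_op_id_tens (R : realType) (X : topologicalType) (U : univ_rep (cb_algebra R X))
    (H : hilbert R) (T : htensor U H) (p : X -> bop H) (V : bop T) (k : bop H) :
  is_field_op p V ->
  is_field_op (fun s => blin_comp k (p s)) (blin_comp (tens_op T (blin_id U) k) V).
Proof.
move=> pV u h v k' g gE; rewrite /= adjointP tens_op_adjoint tens_opE.
have -> : adjoint (blin_id U) v = v.
  by rewrite (@adjoint_uniq _ _ (blin_id U) (blin_id U)).
by apply: pV => s; rewrite gE /= adjointP.
Qed.

(** * Strong-star continuous fields are multipliers *)

Section NormContinuousFields.
Variables (R : realType) (X : topologicalType).
Local Notation C := R[i].
Local Notation A := (cb_algebra R X).
Hypothesis cX : compact [set: X].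
Variables (U : univ_rep A) (H : hilbert R) (T : htensor U H).

Let rh := rep_star_hom U.

(** Operator-norm continuity, expressed through a gauge of the kind that [partition_unity]
    accepts. *)
Definition op_norm_continuous (q : X -> bop H) := forall e : C, 0 < e ->
  exists (d : X -> X -> R) (r : R), [/\ 0 < r, forall s, continuous (d s : X -> R^o),
    forall s, d s s = 0 &
    forall s s', d s s' < r -> forall u, `|q s u - q s' u| <= e * `|u|].

(** The error is the integrated operator of the field [q - sum_j phi_j q (s_j)]. Its values have
    norm at most [e], and [field_op_bound] transfers this to the operator. *)
Lemma field_op_fin_approx (q : X -> bop H) (W : bop T) (e : C) :
  wot_continuous q -> is_field_op q W -> op_norm_continuous q -> 0 < e ->
  exists n (phi : 'I_n -> A) (s : 'I_n -> X),
    forall z, `|W z - \sum_j tens_op T (rep U (phi j)) (q (s j)) z| <= e * `|z|.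
Proof.
move=> qc qW qn e0; have [d [r [r0 dc dss dq]]] := qn _ e0.
have [n [phi [s [phi0 phi1 phid]]]] := partition_unity cX r0 dc dss.
exists n, phi, s.
have [W' W'E] := blin_sum_exists (fun j => tens_op T (rep U (phi j)) (q (s j))).
have yE x : {y : bop H | forall h, y h = \sum_j (phi j) x *: q (s j) h}.
  apply: cid; elim: n phi s {phi0 phi1 phid W' W'E} => [|n IH] phi s.
    by exists (blin_zero H H) => h; rewrite big_ord0.
  have [y yE] := IH (fun j => phi (lift ord0 j)) (fun j => s (lift ord0 j)).
  have [z zE] := blin_lin_exists (phi ord0 x) (q (s ord0)) y.
  by exists z => h; rewrite zE yE big_ord_recl.
pose q' x := sval (yE x); have q'E x h : q' x h = \sum_j (phi j) x *: q (s j) h.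
  exact: (svalP (yE x)).
have q'dot x h k : dot (q' x h) k = \sum_j (phi j) x * dot (q (s j) h) k.
  by rewrite q'E dot_suml; apply: eq_bigr => j _; rewrite dotZl.
have q'c : wot_continuous q'.
  move=> h k; have -> : (fun x => dot (q' x h) k) = (fun x => \sum_j (phi j) x * dot (q (s j) h) k).
    by apply/funext.
  apply: continuous_sum => j; apply: continuous_mulC; first exact: cb_continuous.
  exact: cst_continuous.
have q'W : is_field_op q' W'.
  move=> u h v k g gE; rewrite W'E dot_suml.
  have -> : g = \sum_j dot (q (s j) h) k *: phi j :> A.
    by apply: cbfun_inj => x; rewrite gE q'dot cb_sumE; apply: eq_bigr => j _; rewrite mulrC.
  rewrite (star_hom_sum rh) dot_suml; apply: eq_bigr => j _.
  by rewrite (star_homZ rh) dotZl tens_opE tens_dot mulrC.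
have [D DE] := blin_sub_exists W W'.
have [pd pdE] : exists pd : X -> bop H, forall x h, pd x h = q x h - q' x h.
  exists (fun x => sval (cid (blin_sub_exists (q x) (q' x)))) => x h.
  exact: (svalP (cid (blin_sub_exists (q x) (q' x)))).
have pdc : wot_continuous pd.
  move=> h k; apply/continuous_normP => x a a0.
  have a2 : 0 < a / 2 by rewrite divr_gt0.
  near=> y; rewrite !pdE !dotBl.
  have -> : dot (q x h) k - dot (q' x h) k - (dot (q y h) k - dot (q' y h) k) =
    (dot (q x h) k - dot (q y h) k) - (dot (q' x h) k - dot (q' y h) k) by ring.
  rewrite (le_trans (ler_normB _ _))// [a]splitr lerD//.
    by near: y; exact: (continuous_normP _).1 (qc h k) x _ a2.
  by near: y; exact: (continuous_normP _).1 (q'c h k) x _ a2.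
have Dp : is_field_op pd D := field_op_sub cX qc q'c qW q'W pdE DE.
move=> z; rewrite -W'E -DE; apply: (field_op_bound cX pdc Dp (ltW e0)) => x h.
rewrite pdE q'E -[q x h]scale1r -(phi1 x) scaler_suml -sumrB.
rewrite (le_trans (ler_norm_sum _ _ _))//.
rewrite -[leRHS]mul1r -(phi1 x) mulr_suml ler_sum// => j _.
rewrite -scalerBr normrZ ger0_norm//.
have [->|pn] := eqVneq (phi j x) 0; first by rewrite !mul0r.
by rewrite ler_wpM2l// distrC; apply: dq; exact: phid.
Unshelve. all: by end_near. Qed.

Variable p : X -> bop H.
Hypothesis pc : wot_continuous p.
Hypothesis p1 : forall s, contractive (p s).
Hypothesis ps : forall u, continuous (fun s => p s u).
Hypothesis psa : forall u, continuous (fun s => adjoint (p s) u).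
Variable V : bop T.
Hypothesis pV : is_field_op p V.

Let pd n (f : X -> bop H) (x : 'I_n -> H) s s' : R := \sum_i complex.Re `|f s (x i) - f s' (x i)|.

Let pd_continuous n (f : X -> bop H) (x : 'I_n -> H) s :
  (forall u, continuous (fun s => f s u)) -> continuous (pd f x s : X -> R^o).
Proof.
move=> fc; apply: continuous_sum => i; apply: continuous_Re => s'.
apply: (@continuous_comp _ _ _ (fun s' => f s (x i) - f s' (x i)) (fun z : H => `|z| : R[i]^o)).
  by apply: cvgB; [exact: cvg_cst|exact: fc].
exact: norm_continuous.
Qed.

Let pd0 n (f : X -> bop H) (x : 'I_n -> H) s : pd f x s s = 0.
Proof. by apply: big1 => i _; rewrite subrr normr0. Qed.

Let pd_lt n (f : X -> bop H) (x : 'I_n -> H) s s' (r : R) i : pd f x s s' < r ->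
  `|f s (x i) - f s' (x i)| <= r%:C%C.
Proof.
move=> /ltW pr; rewrite -[leLHS]RRe_real ?normr_real// lecR (le_trans _ pr)//.
rewrite /pd (bigD1 i)//= lerDl sumr_ge0// => j _.
by have := normr_ge0 (f s (x j) - f s' (x j)); rewrite lecE => /andP[].
Qed.

Lemma comp_compact_norm_continuous k : compact_op k ->
  op_norm_continuous (fun s => blin_comp (p s) k).
Proof.
move=> ck e e0; have e3 : 0 < e / 3 by rewrite divr_gt0.
have [n [x kx]] := compact_op_net ck e3; have [r r0 rE] := gt0CP e3.
exists (pd p x), r; split=> // [s|s s' dr]; first exact: pd_continuous.
have [y yE] := blin_sub_exists (blin_comp (p s) k) (blin_comp (p s') k).
suff : forall u, `|y u| <= e * `|u| by move=> ye u; rewrite -yE.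
apply: unit_ball_bound => u u1; rewrite yE/=; have [i kxi] := kx u u1.
have -> : p s (k u) - p s' (k u) =
    p s (k u - x i) - p s' (k u - x i) + (p s (x i) - p s' (x i)).
  by rewrite -{1 2}(subrK (x i) (k u)) !blinD opprD addrACA.
have -> : e = e / 3 + e / 3 + e / 3 by field.
rewrite (le_trans (ler_normD _ _))// lerD//.
  by rewrite (le_trans (ler_normB _ _))// lerD// (le_trans (p1 _ _)).
by rewrite rE; exact: pd_lt.
Qed.

(** The square of the norm of [K = k w] is estimated, [w] being half the difference:
    [<K, K> = <K - x_i, K> + <x_i, K>], where the second term only involves the adjoints of the
    [p s] at [adjoint k (x_i)]. Hence the squares of [e] in the constants, for which
    [4 a M + 2 b = e^2]. *)
Lemma compact_comp_norm_continuous k : compact_op k ->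
  op_norm_continuous (fun s => blin_comp k (p s)).
Proof.
move=> ck e e0; have [M M0 kM] := blin_gt0 k.
pose a := e ^+ 2 / (8%:R * M); pose b := e ^+ 2 / 4%:R.
have a0 : 0 < a by rewrite divr_gt0 ?exprn_gt0 ?mulr_gt0.
have b0 : 0 < b by rewrite divr_gt0 ?exprn_gt0.
have [n [x kx]] := compact_op_net ck a0; have [r r0 rE] := gt0CP b0.
pose f s := adjoint (p s).
exists (pd f (fun i => adjoint k (x i))), r; split=> // [s|s s' dr]; first exact: pd_continuous.
have [y yE] := blin_sub_exists (blin_comp k (p s)) (blin_comp k (p s')).
suff : forall u, `|y u| <= e * `|u| by move=> ye u; rewrite -yE.
apply: unit_ball_bound => u u1; rewrite yE/=.
pose w := 2^-1 *: (p s u - p s' u).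
have w1 : `|w| <= 1.
  rewrite normrZ ger0_norm ?invr_ge0// mulrC ler_pdivrMr// mul1r.
  by rewrite (le_trans (ler_normB _ _))// mulr2n lerD// (le_trans (p1 _ _)).
have ps2 : p s u - p s' u = 2 *: w by rewrite scalerA divff ?scale1r.
have [i kxi] := kx w w1.
rewrite -blinB ps2 blinZ.
set K := k w in kxi *.
have K1 : `|K| <= M by rewrite (le_trans (kM _))// ler_piMr// ltW.
rewrite -(@ler_pXn2r _ 2) ?nnegrE ?(ltW e0)// normrZ exprMn.
have d1 : `|dot (K - x i) K| <= a * M.
  by rewrite (le_trans (cauchy_schwarz _ _))// ler_pM.
have d2 : `|2 * dot (x i) K| <= b.
  have -> : 2 * dot (x i) K = dot (f s (adjoint k (x i)) - f s' (adjoint k (x i))) u.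
    rewrite dotBl !dot_adjoint -dotBr -blinB ps2 blinZ dotZr.
    by rewrite geC0_conj.
  rewrite (le_trans (cauchy_schwarz _ _))//.
  by rewrite (le_trans (ler_pM _ _ (pd_lt i dr) u1))// mulr1 rE.
have -> : `|2| ^+ 2 * `|K| ^+ 2 = `|4%:R * dot (K - x i) K + 2 * (2 * dot (x i) K)|.
  have -> : 4%:R * dot (K - x i) K + 2 * (2 * dot (x i) K) = 2 ^+ 2 * dot K K.
    by rewrite dotBl; ring.
  by rewrite -dot_norm normrM !normrX normr_id.
have -> : e ^+ 2 = 4%:R * (a * M) + 2 * b by rewrite /a /b; field; rewrite gt_eqF.
rewrite (le_trans (ler_normD _ _))// lerD// normrM ger0_norm// ler_wpM2l//.
Qed.

(** The two legs factor in either order, so that [1 (x) k] can be put next to [V] while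
    [rep a (x) 1] stays outside. *)
Lemma tens_op_split t a k : is_tens_op (rep U a) k t ->
  t = blin_comp (tens_op T (blin_id U) k) (tens_op T (rep U a) (blin_id H)) /\
  t = blin_comp (tens_op T (rep U a) (blin_id H)) (tens_op T (blin_id U) k).
Proof. by split; apply: tens_op_ext => u h; rewrite /= !tens_opE. Qed.

Lemma field_op_elem_l t : elem_tensor t -> min_tensor_compact (blin_comp V t).
Proof.
move=> [a [k [ck tE]]]; have [-> _] := tens_op_split tE; apply/min_tensorP => d d0.
have [M M0 aM] := blin_gt0 (tens_op T (rep U a) (blin_id H)).
have qW : is_field_op (fun s => blin_comp (p s) k) (blin_comp V (tens_op T (blin_id U) k)).
  by move=> u h v k' g gE; rewrite /= tens_opE; exact: pV.
have qc : wot_continuous (fun s => blin_comp (p s) k) by move=> h k'; exact: pc.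
have d1 : 0 < d / M by rewrite divr_gt0.
have [n [phi [s sE]]] := field_op_fin_approx qc qW (comp_compact_norm_continuous ck) d1.
exists (fun z => \sum_j blin_comp (tens_op T (rep U (phi j)) (blin_comp (p (s j)) k))
  (tens_op T (rep U a) (blin_id H)) z); split.
  apply: fin_tensor_sum => j; apply: fin_tensor_elem.
  exists (cmul (phi j : A) a), (blin_comp (p (s j)) k); split; first exact: compact_op_comp_l.
  by move=> u h; rewrite /= !tens_opE (star_homM rh).
move=> z /=; rewrite (le_trans (sE _))// (le_trans (ler_wpM2l (ltW d1) (aM z)))//.
by rewrite mulrA divfK ?gt_eqF.
Qed.

Lemma field_op_elem_r t : elem_tensor t -> min_tensor_compact (blin_comp t V).
Proof.
move=> [a [k [ck tE]]]; have [_ ->] := tens_op_split tE; apply/min_tensorP => d d0.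
have [M M0 aM] := blin_gt0 (tens_op T (rep U a) (blin_id H)).
have qW : is_field_op (fun s => blin_comp k (p s)) (blin_comp (tens_op T (blin_id U) k) V).
  exact: field_op_id_tens.
have qc : wot_continuous (fun s => blin_comp k (p s)).
  move=> h k'; have -> : (fun s => dot (blin_comp k (p s) h) k') =
      (fun s => dot (p s h) (adjoint k k')).
    by apply/funext => s; rewrite /= adjointP.
  exact: pc.
have d1 : 0 < d / M by rewrite divr_gt0.
have [n [phi [s sE]]] := field_op_fin_approx qc qW (compact_comp_norm_continuous ck) d1.
exists (fun z => \sum_j blin_comp (tens_op T (rep U a) (blin_id H))
  (tens_op T (rep U (phi j)) (blin_comp k (p (s j)))) z); split.
  apply: fin_tensor_sum => j; apply: fin_tensor_elem.
  exists (cmul a (phi j : A)), (blin_comp k (p (s j))); split; first exact: compact_op_comp_r.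
  by move=> u h; rewrite /= !tens_opE (star_homM rh).
move=> z /=; rewrite -blin_sum -blinB (le_trans (aM _))//.
rewrite (le_trans (ler_wpM2l (ltW M0) (sE z)))//.
by rewrite mulrA [M * _]mulrC divfK ?gt_eqF.
Qed.

Lemma field_op_multiplier : vn_tensor (@bidual R A U) setT V -> multiplier_compact V.
Proof.
move=> VN; split=> // b bT; split.
  exact: min_tensor_comp_l field_op_elem_l bT.
exact: min_tensor_comp_r field_op_elem_r bT.
Qed.

End NormContinuousFields.

(** * Continuity forced by the multiplier property *)

Section MultiplierContinuity.
Variables (R : realType) (X : topologicalType).
Local Notation C := R[i].
Local Notation A := (cb_algebra R X).
Hypothesis cX : compact [set: X].
Variables (U : univ_rep A) (H : hilbert R) (T : htensor U H).
Variable p : X -> bop H.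
Hypothesis pc : wot_continuous p.
Variable V : bop T.
Hypothesis pV : is_field_op p V.
Hypothesis VM : multiplier_compact V.

Let rh := rep_star_hom U.

Lemma point_eigenvector s : exists w : U, `|w| = 1 /\ forall a : cbfun R X, rep U a w = a s *: w.
Proof.
have [m mE] : exists m : dual A, forall a : cbfun R X, m a = a s.
  apply: (@blin_exists R A R[i]^o (fun a => (a : cbfun R X) s)) => [//|].
  by exists 1 => a; rewrite mul1r; exact: cb_norm_ge.
have [||w [w1 wE]] := @character_eigenvector R A U _ (@cb_one_unit R X cX) m.
- by move=> a b; rewrite !mE.
- by rewrite mE.
by exists w; split=> // a; rewrite wE mE.
Qed.

(** Slicing a finite approximation of [b] at a unit eigenvector of the evaluation at [s] replaces
    each [rep (a_i)] by the number [a_i(s)]. The error bound does not depend on [s], so continuity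
    survives the limit. *)
Lemma multiplier_slice (b : bop T) (q : X -> bop H) (e : C) :
  is_field_op q b -> wot_continuous q -> min_tensor_compact b -> 0 < e ->
  exists n (a : 'I_n -> cbfun R X) (k : 'I_n -> bop H),
    forall s h k', `|dot (q s h - \sum_i (a i s) *: k i h) k'| <= e * `|h| * `|k'|.
Proof.
move=> qb qc bT e0; have [n [t [tE bt]]] := bT e e0.
have ak i : {ak : A * bop H | is_tens_op (rep U ak.1) ak.2 (t i)}.
  by apply: cid; have [a [k [_ tak]]] := tE i; exists (a, k).
exists n, (fun i => (sval (ak i)).1), (fun i => (sval (ak i)).2) => s h k'.
have [w [w1 wE]] := point_eigenvector s.
have := cauchy_schwarz (b (tens T w h) - \sum_i t i (tens T w h)) (tens T w k').
rewrite dotBl (qb _ _ _ _ (mkcb cX (qc h k')))// wE dotZl dot_suml.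
rewrite -[dot w w]dot_norm w1 expr1n mulr1.
under eq_bigr => i _ do rewrite (svalP (ak i)) tens_dot wE dotZl -[dot w w]dot_norm w1 expr1n mulr1.
rewrite dotBl dot_suml; under [in X in _ -> X]eq_bigr => i _ do rewrite dotZl.
move=> h1; apply: (le_trans h1).
rewrite (le_trans (ler_wpM2r _ (bt _)))// !norm_tens w1 !mul1r//.
Qed.

Let theta_min x : min_tensor_compact (tens_op T (blin_id U) (rank1 x x)).
Proof.
apply/min_tensorP => d d0; exists (tens_op T (blin_id U) (rank1 x x)); split.
  apply: fin_tensor_elem; exists (cb_one R cX : A), (rank1 x x); split; first exact: compact_rank1.
  move=> u h; rewrite tens_opE; congr tens; exact: esym (rep_unit (@cb_one_unit R X cX) _).
by move=> z; rewrite subrr normr0 mulr_ge0// ltW.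
Qed.

Lemma uniform_limit_continuous (f : X -> H) :
  (forall e : C, 0 < e -> exists2 g : X -> H, continuous g & forall x, `|f x - g x| <= e) ->
  continuous f.
Proof.
move=> fg x; apply/cvgrPdist_le => e e0; have e3 : 0 < e / 3 by rewrite divr_gt0.
have [g gc fgE] := fg _ e3; near=> y.
have -> : f x - f y = (f x - g x) + (g x - g y) - (f y - g y).
  by rewrite opprB !subrKA.
have -> : e = e / 3 + e / 3 + e / 3 by field.
rewrite (le_trans (ler_normB _ _))// lerD// (le_trans (ler_normD _ _))// lerD//.
by near: y; have /cvgrPdist_le := gc x; exact.
Unshelve. all: by end_near. Qed.

Lemma continuous_cb_sum n (a : 'I_n -> cbfun R X) (x : 'I_n -> H) :
  continuous (fun s => \sum_i (a i s) *: x i).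
Proof.
apply: continuous_sum => i s; apply: cvgZr_tmp; exact: cb_continuous.
Qed.

Lemma multiplier_continuous x : continuous (fun s => p s x).
Proof.
have [->|x0] := eqVneq x 0.
  have -> : (fun s => p s 0) = fun=> 0 by apply/funext => s; rewrite blin0.
  exact: cst_continuous.
have n0 : 0 < `|x| by rewrite normr_gt0.
have qb : is_field_op (fun s => blin_comp (p s) (rank1 x x))
    (blin_comp V (tens_op T (blin_id U) (rank1 x x))).
  by move=> u h v k' g gE; rewrite /= tens_opE; exact: pV.
have qc : wot_continuous (fun s => blin_comp (p s) (rank1 x x)) by move=> h k'; exact: pc.
apply: uniform_limit_continuous => e e0.
have e1 : 0 < e * `|x| by rewrite mulr_gt0.
have [n [a [k akE]]] := multiplier_slice qb qc (VM.2 _ (theta_min x)).1 e1.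
(* [rank1 x x] maps [x] to [|x|^2 x], so its composite with [p s] recovers [p s x] after division by
   [|x|^2]. *)
exists (fun s => `|x| ^- 2 *: \sum_i (a i s) *: k i x).
  by move=> s; apply: cvgZl_tmp; exact: continuous_cb_sum.
move=> s; have -> : p s x = `|x| ^- 2 *: p s (rank1 x x x).
  by rewrite rank1E -[dot x x]dot_norm blinZ scalerA mulVf ?scale1r// expf_eq0 gt_eqF.
rewrite -scalerBr normrZ ger0_norm ?invr_ge0 ?exprn_ge0//.
rewrite ler_pdivrMl ?exprn_gt0//; apply: normr_le_dot => [|v].
  by rewrite mulr_ge0 ?exprn_ge0// ltW.
rewrite (le_trans (akE _ _ _))// ler_wpM2r//.
by rewrite -mulrA -expr2 mulrC.
Qed.

Lemma multiplier_continuous_adjoint x : continuous (fun s => adjoint (p s) x).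
Proof.
have [->|x0] := eqVneq x 0.
  have -> : (fun s => adjoint (p s) 0) = fun=> 0 by apply/funext => s; rewrite blin0.
  exact: cst_continuous.
have n0 : 0 < `|x| by rewrite normr_gt0.
have qb : is_field_op (fun s => blin_comp (rank1 x x) (p s))
    (blin_comp (tens_op T (blin_id U) (rank1 x x)) V).
  exact: field_op_id_tens.
have qc : wot_continuous (fun s => blin_comp (rank1 x x) (p s)).
  move=> h k'; have -> : (fun s => dot (blin_comp (rank1 x x) (p s) h) k') =
      (fun s => dot (p s h) (adjoint (rank1 x x) k')).
    by apply/funext => s; rewrite /= adjointP.
  exact: pc.
apply: uniform_limit_continuous => e e0.
have e1 : 0 < e * `|x| by rewrite mulr_gt0.
have [n [a [k akE]]] := multiplier_slice qb qc (VM.2 _ (theta_min x)).2 e1.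
(* Passing from [rank1 x x] composed with [p s] to its adjoint conjugates the functions [a i] and
   replaces [k i] by its adjoint. *)
exists (fun s => `|x| ^- 2 *: \sum_i ((cstar (a i : A) : cbfun R X) s) *: adjoint (k i) x).
  by move=> s; apply: cvgZl_tmp; exact: continuous_cb_sum.
move=> s; have -> : adjoint (p s) x = `|x| ^- 2 *: adjoint (p s) (rank1 x x x).
  by rewrite rank1E -[dot x x]dot_norm blinZ scalerA mulVf ?scale1r// expf_eq0 gt_eqF.
rewrite -scalerBr normrZ ger0_norm ?invr_ge0 ?exprn_ge0//.
rewrite ler_pdivrMl ?exprn_gt0//; apply: normr_le_dot => [|v].
  by rewrite mulr_ge0 ?exprn_ge0// ltW.
have := akE s v x; rewrite -norm_conjC -dotC.
have -> : dot x (blin_comp (rank1 x x) (p s) v - \sum_i a i s *: k i v) =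
    dot (adjoint (p s) (rank1 x x x) - \sum_i (cstar (a i : A) : cbfun R X) s *: adjoint (k i) x) v.
  rewrite dotBl dotBr dot_adjoint dot_sumr dot_suml; congr (_ - _).
    by rewrite /= !rank1E dotZl dotZr -dotC mulrC.
  by apply: eq_bigr => i _; rewrite dotZl dotZr dot_adjoint.
move=> h1; rewrite (le_trans h1)//.
by rewrite [leRHS](_ : _ = e * `|x| * `|v| * `|x|)//; ring.
Qed.

End MultiplierContinuity.

Section MultiplierSubsemigroup.
Variables (R : realType) (H : hilbert R) (S : set (bop H)).
Hypothesis S1 : forall x, S x -> contractive x.
Hypothesis cS : compact (S : set (bop_top weak_star H)).
Local Notation X := (sub_top weak_star S).
Local Notation Xs := (sub_top strong_star S).

Let cX : compact [set: X] := compact_sub_top cS.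
Let v1 (s : X) : contractive (sub_val s).
Proof. exact: (S1 (sub_val_mem s)). Qed.

(** The strong-star topology on [S] is always the finer one, so the equivalence only concerns
    continuity in the reverse direction. *)
Lemma strong_weak_continuous : continuous (id : Xs -> X).
Proof.
apply: continuous_sub; apply: wot_weak_continuous; last exact: (@sub_val_wot R H strong_star S).
by move=> s; exact: (S1 (sub_val_mem s)).
Qed.

Theorem subsemigroup_multiplier (U : univ_rep (cb_algebra R X)) (T : htensor U H) :
  exists V : bop T, is_V idfun (@sub_val R weak_star H S) V /\
    (multiplier_compact V <-> forall O : set (set_type S), @open X O <-> @open Xs O).
Proof.
have wc := @sub_val_wot R H weak_star S.
have [V [VE V1 VN]] := inclusion_op_exists cX wc v1 T.
exists V; split; first exact: (field_op_is_V cX wc v1 VE VN).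
have weak_open O : @open X O -> @open Xs O.
  by move=> oO; exact: (@open_comp Xs X id O (fun s _ => @strong_weak_continuous s) oO).
split=> [VM O|topE].
  split; first exact: weak_open.
  move=> oO; have ws : continuous (id : X -> Xs).
    apply: continuous_sub; apply: continuous_strong => u.
      exact: (multiplier_continuous cX wc VE VM).
    exact: (multiplier_continuous_adjoint cX wc VE VM).
  exact: (@open_comp X Xs id O (fun s _ => ws s) oO).
have ws : continuous (id : X -> Xs).
  by apply/topology_structure.continuousP => O oO; exact: (topE O).2.
have cont (f : Xs -> H) : continuous f -> continuous (f : X -> H).
  by move=> fc s; apply: (@continuous_comp _ _ _ (id : X -> Xs) f); [exact: ws|exact: fc].
apply: (field_op_multiplier cX wc v1 _ _ VE VN) => u; apply: cont.
  exact: strong_sub_eval.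
exact: strong_sub_eval_adjoint.
Qed.

End MultiplierSubsemigroup.

(** * Commutative C*-algebras *)

Section CommutativeCstar.
Variables (R : realType) (B : comPzRingType) (N : B -> R) (st : B -> B).
Variables (rs : {rmorphism R -> B}) (J : B).
Hypothesis ND : forall a b, N (a + b) <= N a + N b.
Hypothesis NM : forall a b, N (a * b) <= N a * N b.
Hypothesis Nrs : forall r a, N (rs r * a) = `|r| * N a.
Hypothesis N_eq0 : forall a, N a = 0 -> a = 0.
Hypothesis N_ge0 : forall a, 0 <= N a.
Hypothesis stD : forall a b, st (a + b) = st a + st b.
Hypothesis stM : forall a b, st (a * b) = st a * st b.
Hypothesis stK : forall a, st (st a) = a.
Hypothesis strs : forall r, st (rs r) = rs r.
Hypothesis stJ : st J = - J.
Hypothesis JJ : J * J = - 1.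
Hypothesis Nst : forall a, N (st a * a) = N a ^+ 2.
Hypothesis complete : forall (u : nat -> B) (c q : R), 0 <= q -> q < 1 ->
  (forall n, N (u n.+1 - u n) <= c * q ^+ n) ->
  exists l, forall e : R, 0 < e -> exists n0, forall n, (n0 <= n)%N -> N (u n - l) <= e.

Lemma N0 : N 0 = 0.
Proof. by rewrite -(mul0r 0) -(rmorph0 rs) Nrs normr0 mul0r. Qed.

Lemma Nopp a : N (- a) = N a.
Proof.
have -> : - a = rs (- 1) * a by rewrite rmorphN rmorph1 mulN1r.
by rewrite Nrs normrN normr1 mul1r.
Qed.

Lemma NB a b : N (a - b) <= N a + N b.
Proof. by rewrite -(Nopp b). Qed.

Lemma NC a b : N (a - b) = N (b - a).
Proof. by rewrite -Nopp opprB. Qed.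

Lemma st1 : st 1 = 1.
Proof. by rewrite -(rmorph1 rs). Qed.

Lemma stN a : st (- a) = - st a.
Proof. by rewrite -mulN1r -(rmorph1 rs) -(rmorphN rs) stM strs rmorphN rmorph1 mulN1r. Qed.

Lemma st0 : st 0 = 0.
Proof. by rewrite -(rmorph0 rs). Qed.

Lemma N1 : N 1 <= 1.
Proof.
have := Nst 1; rewrite st1 mulr1 expr2.
have [->//|n0] := eqVneq (N 1) 0; move=> h.
have p0 : 0 < N 1 by rewrite lt_def n0 N_ge0.
by rewrite -(ler_pM2l p0) mulr1 -h.
Qed.

Lemma Nrs1 r : N (rs r) <= `|r|.
Proof. by rewrite -(mulr1 (rs r)) Nrs ler_piMr// N1. Qed.

Lemma NstE a : N (st a) = N a.
Proof.
suff le b : N b <= N (st b) by apply/eqP; rewrite eq_le le -{2}(stK a) le.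
have := NM (st b) b; rewrite Nst expr2.
have [->|n0] := eqVneq (N b) 0; first by rewrite N_ge0.
by rewrite ler_pM2r// lt_def n0 N_ge0.
Qed.

Lemma N_small a : (forall e : R, 0 < e -> N a <= e) -> a = 0.
Proof.
move=> ae; apply: N_eq0; apply/eqP; rewrite eq_le N_ge0 andbT.
by apply/ler_addgt0Pr => e e0; rewrite add0r ae.
Qed.

Lemma half_dbl a : rs 2^-1 * (a + a) = a.
Proof.
rewrite mulrDr -mulrDl -rmorphD/= -{1}[2^-1]mul1r -[X in _ + X]mul1r -splitr.
by rewrite rmorph1 mul1r.
Qed.

(** [y = 1 - z] for the fixed point of [z |-> (x + z^2) / 2], a contraction of ratio [N x] on the
    ball of radius [N x] about [0]. *)
Lemma sqrt_exists x : st x = x -> N x < 1 -> exists y, st y = y /\ y * y = 1 - x.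
Proof.
move=> sx x1; pose g z := rs 2^-1 * (x + z * z).
pose z n := iter n g 0.
have zS n : z n.+1 = g (z n) by [].
have zs n : st (z n) = z n.
  by elim: n => [|n IH]; [exact: st0|rewrite zS /g stM strs stD stM sx IH].
have half : `|2^-1 : R| = 2^-1 by rewrite ger0_norm// invr_ge0.
have zN n : N (z n) <= N x.
  elim: n => [|n IH]; first by rewrite N0.
  rewrite zS /g Nrs half.
  have := ND x (z n * z n); have := NM (z n) (z n).
  have : N (z n) * N (z n) <= N x * 1.
    by rewrite ler_pM ?(le_trans IH)// ltW.
  lra.
have gB a b : N (g a - g b) <= 2^-1 * (N (a - b) * (N a + N b)).
  have -> : g a - g b = rs 2^-1 * ((a - b) * (a + b)) by rewrite /g; ring.
  rewrite Nrs half ler_pM2l ?invr_gt0// (le_trans (NM _ _))// ler_wpM2l//.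
have zc n : N (z n.+1 - z n) <= N x * N x ^+ n.
  elim: n => [|n IH]; first by rewrite subr0 expr0 mulr1; exact: (zN 1%N).
  rewrite [z n.+2]zS [X in g _ - X]zS (le_trans (gB _ _))// exprS.
  have IH' := ler_wpM2r (N_ge0 x) IH.
  have := ler_wpM2l (N_ge0 (z n.+1 - z n)) (lerD (zN n.+1) (zN n)).
  move: IH'; set a := N (_ - _); set b := N x ^+ n; lra.
have [l lE] := complete (N_ge0 x) x1 zc.
have ls : st l = l.
  apply/eqP; rewrite -subr_eq0; apply/eqP; apply: N_small => e e0.
  have [|n0 nE] := lE (e / 2); first by rewrite divr_gt0.
  have := nE n0 (leqnn _) => zl.
  have -> : st l - l = - st (z n0 - l) + (z n0 - l).
    by rewrite stD stN zs; ring.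
  by rewrite (le_trans (ND _ _))// Nopp NstE; lra.
have lg : l = g l.
  apply/eqP; rewrite -subr_eq0; apply/eqP; apply: N_small => e e0.
  (* The [1] accounts for replacing the next iterate by [l]; the rest is the Lipschitz constant of
     [g] between [z n0] and [l]. *)
  pose c := 1 + 2^-1 * (N x + N l).
  have c0 : 0 < c by rewrite /c; have := N_ge0 x; have := N_ge0 l; lra.
  have [|n0 nE] := lE (e / c); first by rewrite divr_gt0.
  have h1 := nE n0 (leqnn _); have h2 := nE n0.+1 (leqnSn _).
  have -> : l - g l = (g (z n0) - g l) - (z n0.+1 - l) by rewrite zS; ring.
  rewrite (le_trans (NB _ _))//.
  have -> : e = e / c * c by rewrite divfK// gt_eqF.
  rewrite /c mulrDr mulr1 addrC lerD// (le_trans (gB _ _))//.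
  rewrite mulrCA ler_pM ?mulr_ge0 ?invr_ge0 ?addr_ge0//.
  by rewrite ler_pM2l ?invr_gt0// lerD2r.
exists (1 - l); split; first by rewrite stD stN st1 ls.
have l2 : l + l = x + l * l.
  by rewrite {1 2}lg /g -mulrDr half_dbl.
have -> : (1 - l) * (1 - l) = 1 - (l + l) + l * l by ring.
by rewrite l2; ring.
Qed.

(** [u = w + J y] satisfies [st u * u = rs k], so the C*-identity bounds [u], and [w] is its
    self-adjoint part. [sq_bound] and [pos_norm] rest on this. *)
Lemma sum_sq_bound w y (k : R) : st w = w -> st y = y -> 0 <= k -> w * w + y * y = rs k ->
  N w ^+ 2 <= k.
Proof.
move=> sw sy k0 wy; pose u := w + J * y.
have su : st u = w - J * y by rewrite stD stM sw sy stJ mulNr.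
have u2 : st u * u = rs k.
  have -> : st u * u = w * w - (J * J) * (y * y) by rewrite su /u; ring.
  by rewrite JJ mulN1r opprK.
have Nu : N u ^+ 2 <= k by rewrite -Nst u2 (le_trans (Nrs1 _))// ger0_norm.
have wE : w = rs 2^-1 * (u + st u).
  have -> : u + st u = w + w by rewrite su /u; ring.
  by rewrite half_dbl.
rewrite (le_trans _ Nu)// ler_pXn2r ?nnegrE//.
rewrite wE Nrs ger0_norm ?invr_ge0//; have := ND u (st u); rewrite NstE; lra.
Qed.

(** Positivity without spectra: for a function, [|t - a| <= t] says that its values lie in
    [[0, 2 t]]. Sums are then immediate, whereas products have to be earned through square roots. *)
Definition pos a := st a = a /\ exists t : R, 0 <= t /\ N (rs t - a) <= t.

(** [(t - a) / t] may have norm exactly [1], on the border of [sqrt_exists]. Adding [d] brings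
    [1 - (a + d) / (t + d)] strictly inside the unit ball. *)
Lemma pos_sqrt a (d : R) : pos a -> 0 < d -> exists y, st y = y /\ y * y = a + rs d.
Proof.
move=> [sa [t [t0 ta]]] d0; have k0 : 0 < t + d by rewrite ltr_wpDl.
pose x := rs (t + d)^-1 * (rs t - a).
have [|| y [sy yE]] := @sqrt_exists x.
- by rewrite stM !strs stD stN strs sa.
- by rewrite Nrs ger0_norm ?invr_ge0 ?(ltW k0)// mulrC ltr_pdivrMr// mul1r (le_lt_trans ta)// ltrDl.
exists (rs (Num.sqrt (t + d)) * y); split; first by rewrite stM strs sy.
rewrite mulrACA yE -rmorphM/= -expr2 sqr_sqrtr ?(ltW k0)//.
rewrite /x mulrBr mulr1 mulrA -rmorphM/= divff ?gt_eqF// rmorph1 mul1r rmorphD/=; ring.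
Qed.

Lemma sq_bound y (k : R) : st y = y -> N y ^+ 2 < k -> N (rs k - y * y) <= k.
Proof.
move=> sy yk; have k0 : 0 < k by rewrite (le_lt_trans _ yk)// exprn_ge0.
pose x := rs k^-1 * (y * y).
have [|| w [sw wE]] := @sqrt_exists x.
- by rewrite stM strs stM sy.
- rewrite Nrs ger0_norm ?invr_ge0 ?(ltW k0)// mulrC ltr_pdivrMr// mul1r.
  by rewrite (le_lt_trans (NM _ _))// -expr2.
pose v := rs (Num.sqrt k) * w.
have vE : v * v = rs k - y * y.
  rewrite mulrACA wE -rmorphM/= -expr2 sqr_sqrtr ?(ltW k0)//.
  have -> : rs k * (1 - x) = rs k - (rs k * rs k^-1) * (y * y) by rewrite /x; ring.
  by rewrite -rmorphM/= divff ?gt_eqF// rmorph1 mul1r.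
have sv : st v = v by rewrite stM strs sw.
rewrite -vE (le_trans (NM _ _))// -expr2.
by apply: (@sum_sq_bound v y) => //; [exact: ltW|rewrite vE subrK].
Qed.

Lemma pos_sq y : st y = y -> pos (y * y).
Proof.
move=> sy; split; first by rewrite stM sy.
exists (N y ^+ 2 + 1); split; first by rewrite addr_ge0// exprn_ge0.
by apply: sq_bound => //; rewrite ltrDl.
Qed.

Lemma pos_rs (t : R) : 0 <= t -> pos (rs t).
Proof. by move=> t0; split=> //; exists t; split=> //; rewrite subrr N0. Qed.

Lemma pos_add a b : pos a -> pos b -> pos (a + b).
Proof.
move=> [sa [t [t0 ta]]] [sb [t' [t'0 tb]]]; split; first by rewrite stD sa sb.
exists (t + t'); split; first exact: addr_ge0.
have -> : rs (t + t') - (a + b) = (rs t - a) + (rs t' - b) by rewrite rmorphD/=; ring.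
by rewrite (le_trans (ND _ _))// lerD.
Qed.

Lemma pos_bounded c (t : R) : st c = c -> N c <= t -> pos (rs t - c).
Proof.
move=> sc ct; split; first by rewrite stD stN strs sc.
by exists t; split; [exact: le_trans (N_ge0 _) ct|rewrite opprB addrC subrK].
Qed.

Lemma pos_archi a : st a = a -> (forall d : R, 0 < d -> pos (a + rs d)) -> pos a.
Proof.
move=> sa ad; split=> //; exists (N a); split=> //.
(* [y^2 = a + 2 d] has [N y ^ 2 <= N a + 2 d < N a + 3 d], so [sq_bound] applies at [N a + 3 d]; the
   leftover shift by [d] makes [N a + 4 d]. *)
apply/ler_addgt0Pr => e e0; pose d := e / 4.
have d0 : 0 < d by rewrite divr_gt0.
have [y [sy yE]] := pos_sqrt (ad d d0) d0.
have Ny : N y ^+ 2 <= N a + 2 * d.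
  rewrite -Nst sy yE -addrA -rmorphD/= (le_trans (ND _ _))// lerD2l (le_trans (Nrs1 _))//.
  by rewrite ger0_norm; lra.
have := @sq_bound y (N a + 3 * d) sy; rewrite yE => h.
have {}h : N (rs (N a + 3 * d) - (a + rs d + rs d)) <= N a + 3 * d by apply: h; lra.
have -> : rs (N a) - a = (rs (N a + 3 * d) - (a + rs d + rs d)) - rs d.
  by rewrite !rmorphD/= rmorphM/=; ring.
rewrite (le_trans (NB _ _))//; have := Nrs1 d; rewrite ger0_norm ?(ltW d0)//.
by move: h; rewrite /d; lra.
Qed.

Lemma pos_closed a : st a = a -> (forall d : R, 0 < d -> exists2 b, pos b & N (a - b) <= d) ->
  pos a.
Proof.
move=> sa ab; apply: pos_archi => // d d0; have [b bP bd] := ab d d0.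
have -> : a + rs d = b + (rs d - (b - a)) by ring.
by apply: pos_add => //; apply: pos_bounded; [rewrite stD stN sa bP.1|rewrite NC].
Qed.

(** If [x^2 = a + e] and [y^2 = b + e], the square of [x y] differs from [a b] by [e (a + b + e)];
    squares are positive and positivity is a closed condition. *)
Lemma pos_mul a b : pos a -> pos b -> pos (a * b).
Proof.
move=> aP bP; apply: pos_closed => [|d d0]; first by rewrite stM aP.1 bP.1.
have c0 : 0 < N (a + b) + 1 by rewrite ltr_wpDl.
pose e := Num.min 1 (d / (N (a + b) + 1)).
have e0 : 0 < e by rewrite lt_min ltr01 divr_gt0.
have [x [sx xE]] := pos_sqrt aP e0; have [y [sy yE]] := pos_sqrt bP e0.
exists ((x * y) * (x * y)); first by apply: pos_sq; rewrite stM sx sy.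
have -> : a * b - x * y * (x * y) = - (rs e * ((a + b) + rs e)).
  have -> : x * y * (x * y) = (x * x) * (y * y) by ring.
  by rewrite xE yE; ring.
rewrite Nopp Nrs ger0_norm ?(ltW e0)//.
have e1 : e <= 1 by rewrite ge_min lexx.
have ed : e <= d / (N (a + b) + 1) by rewrite ge_min lexx orbT.
rewrite -[leRHS](divfK (lt0r_neq0 c0)) ler_pM ?(ltW e0)//.
rewrite (le_trans (ND _ _))// lerD2l (le_trans (Nrs1 _))// ger0_norm ?(ltW e0)//.
Qed.

(** [(t - a) (t + a) = t^2 - a^2] is positive, hence a square up to [d], and [sum_sq_bound]
    applies. *)
Lemma pos_norm a (t : R) : 0 <= t -> pos (rs t - a) -> pos (rs t + a) -> N a <= t.
Proof.
move=> t0 tm tp; have sa : st a = a.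
  by have := tp.1; rewrite stD strs => /addrI.
have sq : N a ^+ 2 <= t ^+ 2.
  apply/ler_addgt0Pr => d d0.
  have [y [sy yE]] := pos_sqrt (pos_mul tm tp) d0.
  apply: (sum_sq_bound sa sy); first by rewrite addr_ge0 ?exprn_ge0 ?(ltW d0).
  by rewrite yE rmorphD/= rmorphXn/= ; ring.
by move: sq; rewrite ler_pXn2r ?nnegrE.
Qed.

Definition cone_module (Q : set B) :=
  [/\ forall x, Q x -> st x = x, forall x y, Q x -> Q y -> Q (x + y),
      forall p x, pos p -> Q x -> Q (p * x) & ~ Q (- 1)].

(** * A maximal cone in which [h] attains its norm *)

Section MaximalCone.
Variable h : B.
Hypothesis sh : st h = h.
Hypothesis hm : forall d : R, 0 < d -> ~ pos (rs (N h - d) - h).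

(** The cone generated by the positive elements and the requirement [h >= N h]. It is proper because
    [hm] excludes [h <= N h - d]. *)
Let Q0 := [set x | exists p q, [/\ pos p, pos q & x = p + q * (h - rs (N h))]].

Let hpos : pos (rs (N h) - h).
Proof. exact: pos_bounded. Qed.

Let pos0 : pos 0.
Proof. by rewrite -(rmorph0 rs); exact: pos_rs. Qed.

Let pos1 : pos 1.
Proof. by rewrite -(rmorph1 rs); exact: pos_rs. Qed.

Let cone_Q0 : cone_module Q0.
Proof.
split.
- move=> _ [p [q [pp pq ->]]]; rewrite stD stM stD stN strs sh.
  by rewrite pp.1 pq.1.
- move=> _ _ [p [q [pp pq ->]]] [p' [q' [pp' pq' ->]]].
  by exists (p + p'), (q + q'); split; [exact: pos_add|exact: pos_add|ring].
- move=> r _ rP [p [q [pp pq ->]]].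
  by exists (r * p), (r * q); split; [exact: pos_mul|exact: pos_mul|ring].
(* If [-1 = p + q (h - N h)], bounding [q] by [c] yields [h <= N h - 1 / c], against [hm]. *)
move=> [p [q [pp pq E]]]; pose c := N q + 1.
have c0 : 0 < c by rewrite ltr_wpDl.
have cq : pos (rs c - q) by apply: pos_bounded; [exact: pq.1|rewrite /c lerDl].
have ci : 0 < c^-1 by rewrite invr_gt0.
apply: (hm ci).
have -> : rs (N h - c^-1) - h = rs c^-1 * ((rs c - q) * (rs (N h) - h) + p).
  have -> : (rs c - q) * (rs (N h) - h) + p =
      rs c * (rs (N h) - h) + (p + q * (h - rs (N h))) by ring.
  rewrite -E; have -> : rs c^-1 * (rs c * (rs (N h) - h) + -1) =
    (rs c^-1 * rs c) * (rs (N h) - h) - rs c^-1 by ring.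
  by rewrite -rmorphM/= mulVf ?gt_eqF// rmorph1 mul1r rmorphB/=; ring.
apply: pos_mul; first exact: pos_rs (ltW ci).
by apply: pos_add => //; exact: pos_mul.
Qed.

Lemma maximal_cone : exists Q : set B, [/\ cone_module Q, pos `<=` Q, Q (h - rs (N h)) &
  forall x, st x = x -> Q x \/ Q (- x)].
Proof.
have [|Q [[Qc QQ0] Qmax]] := @Zorn_bigcup B
    [set Q | cone_module Q /\ (Q `<=` set0 \/ Q0 `<=` Q)].
  move=> F FP Ft; split; last first.
    have [[Q FQ QQ]|nQ] := pselect (exists2 Q, F Q & Q0 `<=` Q).
      by right=> x /QQ Qx; exists Q.
    left=> x [Q FQ Qx]; have [_ [QQ|QQ]] := FP Q FQ; first exact: QQ Qx.
    by apply: nQ; exists Q.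
  split.
  - by move=> x [Q /FP[[+ _ _ _] _] Qx]; exact.
  - move=> x y [Q FQ Qx] [Q' FQ' Qy].
    have [QQ|QQ] := Ft Q Q' FQ FQ'.
      by exists Q' => //; have [[_ + _ _] _] := FP Q' FQ'; apply => //; exact: QQ.
    by exists Q => //; have [[_ + _ _] _] := FP Q FQ; apply => //; exact: QQ.
  - move=> p x pp [Q FQ Qx]; exists Q => //.
    by have [[_ _ + _] _] := FP Q FQ; exact.
  - by move=> [Q FQ Q1]; have [[_ _ _ + _]] := FP Q FQ; exact.
have Q0Q : Q0 `<=` Q.
  have [Q00|//] := QQ0; exfalso; apply: (Qmax Q0); last by split=> //; right.
  split; first by move=> x /Q00.
  by move=> Q0Q; apply: (Q00 0); apply: Q0Q; exists 0, 0; split=> //; rewrite mul0r addr0.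
have [Qs QD QM Q1] := Qc.
have Qpos : pos `<=` Q.
  by move=> p pp; apply: Q0Q; exists p, 0; split=> //; rewrite mul0r addr0.
exists Q; split=> //.
  by apply: Q0Q; exists 0, 1; split=> //; rewrite mul1r add0r.
have adj x : st x = x -> ~ Q x -> exists q p, [/\ Q q, pos p & -1 = q + p * x].
  move=> sx nx; apply: contrapT => nE.
  pose Q' := [set y | exists q p, [/\ Q q, pos p & y = q + p * x]].
  have QQ' : Q `<=` Q' by move=> q Qq; exists q, 0; split=> //; rewrite mul0r addr0.
  apply: (Qmax Q'); last first.
    split; last by right=> y /Q0Q/QQ'.
    split.
    - by move=> _ [q [p [Qq pp ->]]]; rewrite stD stM sx pp.1 Qs.
    - move=> _ _ [q [p [Qq pp ->]]] [q' [p' [Qq' pp' ->]]].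
      by exists (q + q'), (p + p'); split; [exact: QD|exact: pos_add|ring].
    - move=> r _ rP [q [p [Qq pp ->]]].
      by exists (r * q), (r * p); split; [exact: (QM)|exact: pos_mul|ring].
    - by move=> [q [p [Qq pp E]]]; apply: nE; exists q, p.
  split=> // Q'Q; apply: nx; apply: Q'Q; exists 0, 1; split=> //.
    exact: Qpos.
  by rewrite mul1r add0r.
move=> x sx; have [Qx|nx] := pselect (Q x); first by left.
right; apply: contrapT => nx'.
have [q [p [Qq pp E]]] := adj x sx nx.
have [|q' [p' [Qq' pp' E']]] := adj (- x) _ nx'; first by rewrite stN sx.
(* Eliminating x gives -(p + p') in Q, so p lies in the ideal Q :&: -Q. *)
have Np : Q (- p).
  have -> : - p = p' * q + p * q' + p'.
    have -> : p' * q + p * q' + p' = p' * (q + p * x) + p * (q' + p' * - x) + p' by ring.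
    by rewrite -E -E'; ring.
  by apply: (QD); [apply: (QD); exact: (QM)|exact: Qpos].
apply: Q1; rewrite E; apply: (QD) => //.
have -> : p * x = (x + rs (N x)) * p + rs (N x) * - p by ring.
apply: (QD); [apply: (QM); last exact: Qpos|apply: (QM) => //].
- have -> : x + rs (N x) = rs (N x) - (- x) by ring.
  by apply: pos_bounded; rewrite ?stN ?sx ?Nopp.
- exact: pos_rs.
Qed.

End MaximalCone.

(** * The real character of a total cone *)

Section ConeCharacter.
Variable Q : set B.
Hypothesis Qc : cone_module Q.
Hypothesis Qpos : pos `<=` Q.
Hypothesis Qtot : forall x, st x = x -> Q x \/ Q (- x).

Let QD x y : Q x -> Q y -> Q (x + y).
Proof. by have [_ + _ _] := Qc; exact. Qed.
Let QM p x : pos p -> Q x -> Q (p * x).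
Proof. by have [_ _ + _] := Qc; exact. Qed.

Let Qrs (r : R) : Q (rs r) -> 0 <= r.
Proof.
move=> Qr; rewrite leNgt; apply/negP => r0; have [_ _ _] := Qc; apply.
have -> : -1 = rs (- r^-1) * rs r.
  by rewrite -rmorphM/= mulNr mulVf ?lt_eqF// rmorphN rmorph1.
by apply: QM => //; apply: pos_rs; rewrite oppr_ge0 invr_le0 ltW.
Qed.

(** The cut that [x] defines on the real line in the order of [Q]. Elements that are infinitesimal
    for [Q] are sent to [0]. *)
Definition cone_char (x : B) : R := sup [set r : R | Q (x - rs r)].

Let bnd x : st x = x -> has_sup [set r : R | Q (x - rs r)].
Proof.
move=> sx; split.
  exists (- N x) => /=; have -> : x - rs (- N x) = rs (N x) - - x by rewrite rmorphN/=; ring.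
  by apply: Qpos; apply: pos_bounded; rewrite ?stN ?sx ?Nopp.
exists (N x) => r /= Qr; rewrite -subr_ge0; apply: Qrs.
have -> : rs (N x - r) = (rs (N x) - x) + (x - rs r) by rewrite rmorphB/=; ring.
by apply: QD => //; apply: Qpos; exact: pos_bounded.
Qed.

Let Qdown x (r s : R) : r <= s -> Q (x - rs s) -> Q (x - rs r).
Proof.
move=> rs' Qs; have -> : x - rs r = (x - rs s) + rs (s - r) by rewrite rmorphB/=; ring.
by apply: QD => //; apply: Qpos; apply: pos_rs; rewrite subr_ge0.
Qed.

Lemma cone_charP x (r : R) : st x = x -> r < cone_char x -> Q (x - rs r).
Proof.
move=> sx rx; have [s /= Qs rs'] := sup_gt (bnd sx).1 rx.
exact: Qdown (ltW rs') Qs.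
Qed.

Lemma cone_char_le x (r : R) : st x = x -> Q (rs r - x) -> cone_char x <= r.
Proof.
move=> sx Qr; apply: ge_sup; first exact: (bnd sx).1.
move=> s /= Qs; rewrite -subr_ge0; apply: Qrs.
have -> : rs (r - s) = (rs r - x) + (x - rs s) by rewrite rmorphB/=; ring.
exact: QD.
Qed.

Lemma cone_char_ge x (r : R) : st x = x -> Q (x - rs r) -> r <= cone_char x.
Proof. by move=> sx Qr; apply: ub_le_sup => //; exact: (bnd sx).2. Qed.

Lemma cone_char_gt x (r : R) : st x = x -> cone_char x < r -> Q (rs r - x).
Proof.
move=> sx xr; have [|Qx|] := @Qtot (rs r - x); first by rewrite stD stN sx strs.
  by [].
rewrite opprB => Qx; have := cone_char_ge sx Qx.
by rewrite leNgt xr.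
Qed.

Lemma cone_char_rs (r : R) : cone_char (rs r) = r.
Proof.
apply/eqP; rewrite eq_le; apply/andP; split.
  by apply: cone_char_le => //; rewrite subrr -(rmorph0 rs); apply: Qpos; exact: pos_rs.
by apply: cone_char_ge => //; rewrite subrr -(rmorph0 rs); apply: Qpos; exact: pos_rs.
Qed.

Lemma cone_charD x y : st x = x -> st y = y -> cone_char (x + y) = cone_char x + cone_char y.
Proof.
move=> sx sy; have sxy : st (x + y) = x + y by rewrite stD sx sy.
apply/eqP; rewrite eq_le; apply/andP; split; apply/ler_addgt0Pr => e e0.
  have e2 : 0 < e / 2 by rewrite divr_gt0.
  apply: cone_char_le => //.
  have -> : rs (cone_char x + cone_char y + e) - (x + y) =
     (rs (cone_char x + e / 2) - x) + (rs (cone_char y + e / 2) - y).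
    by rewrite {1}[e]splitr !rmorphD/=; ring.
  by apply: QD; apply: cone_char_gt => //; rewrite ltrDl.
have e2 : 0 < e / 2 by rewrite divr_gt0.
rewrite -lerBlDr; apply: cone_char_ge => //.
have -> : x + y - rs (cone_char x + cone_char y - e) =
   (x - rs (cone_char x - e / 2)) + (y - rs (cone_char y - e / 2)).
  by rewrite {1}[e]splitr !rmorphB/= !rmorphD/=; ring.
by apply: QD; apply: cone_charP => //; rewrite gtrBl.
Qed.

Lemma cone_charN x : st x = x -> cone_char (- x) = - cone_char x.
Proof.
move=> sx; apply/eqP; rewrite eq_sym -subr_eq0 -opprD oppr_eq0 -cone_charD ?stN ?sx//.
by rewrite subrr -(rmorph0 rs) cone_char_rs.
Qed.

(** If [y] is below every positive real in the order of [Q] and [0 <= p <= c], then [y p] is below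
    every positive real as well. Applied to [x] and [- x] this handles positive factors, from which
    multiplicativity follows by splitting. *)
Let ideal x p : st x = x -> cone_char x = 0 -> pos p -> cone_char (x * p) = 0.
Proof.
move=> sx x0 pp; have sxp : st (x * p) = x * p by rewrite stM sx pp.1.
pose c := N p + 1; have c0 : 0 < c by rewrite ltr_wpDl.
have cp : pos (rs c - p) by apply: pos_bounded; [exact: pp.1|rewrite /c lerDl].
have half y : st y = y -> cone_char y = 0 -> cone_char (y * p) <= 0.
  move=> sy y0; apply/ler_addgt0Pr => e e0; rewrite add0r.
  have ec : 0 < e / c by rewrite divr_gt0.
  apply: cone_char_le; first by rewrite stM sy pp.1.
  have -> : rs e - y * p = p * (rs (e / c) - y) + rs (e / c) * (rs c - p).
    have -> : rs e = rs (e / c) * rs c by rewrite -rmorphM/= divfK ?gt_eqF.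
    by ring.
  apply: QD; last by apply: Qpos; apply: pos_mul => //; apply: pos_rs; exact: ltW.
  by apply: QM => //; apply: cone_char_gt => //; rewrite y0.
apply/eqP; rewrite eq_le half//= -oppr_le0 -cone_charN// -mulNr half ?stN ?sx//.
by rewrite cone_charN// x0 oppr0.
Qed.

Lemma cone_charM x y : st x = x -> st y = y -> cone_char (x * y) = cone_char x * cone_char y.
Proof.
move=> sx sy; pose z := x - rs (cone_char x).
have sz : st z = z by rewrite stD stN strs sx.
have z0 : cone_char z = 0.
  by rewrite cone_charD ?stN ?strs// cone_charN ?strs// cone_char_rs subrr.
have ker v w : st v = v -> cone_char v = 0 -> st w = w -> cone_char (v * w) = 0.
  move=> sv v0 sw; pose p := rs (N w) - w.
  have pp : pos p by exact: pos_bounded.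
  have -> : v * w = v * rs (N w) + - (v * p) by rewrite /p; ring.
  rewrite cone_charD ?stN ?stM ?sv ?strs ?pp.1// cone_charN ?stM ?sv ?pp.1//.
  by rewrite !ideal ?oppr0 ?addr0//; exact: pos_rs.
have scal (r : R) w : st w = w -> cone_char (rs r * w) = r * cone_char w.
  move=> sw; pose v := w - rs (cone_char w).
  have sv : st v = v by rewrite stD stN strs sw.
  have v0 : cone_char v = 0.
    by rewrite cone_charD ?stN ?strs// cone_charN ?strs// cone_char_rs subrr.
  have -> : rs r * w = v * rs r + rs (r * cone_char w) by rewrite /v rmorphM/=; ring.
  by rewrite cone_charD ?stM ?sv ?strs// ker// cone_char_rs add0r.
have -> : x * y = z * y + rs (cone_char x) * y by rewrite /z; ring.
by rewrite cone_charD ?stM ?sz ?strs ?sy// ker// add0r scal.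
Qed.

End ConeCharacter.

Let re a := rs 2^-1 * (a + st a).
Let im a := rs 2^-1 * (J * (st a - a)).

Let st_re a : st (re a) = re a.
Proof. by rewrite stM strs stD stK addrC. Qed.

Let st_im a : st (im a) = im a.
Proof. by rewrite stM strs stM stJ stD stN stK mulNr -mulrN opprB. Qed.

Let re_im a : a = re a + J * im a.
Proof.
rewrite /re /im; have -> : rs 2^-1 * (a + st a) + J * (rs 2^-1 * (J * (st a - a))) =
  rs 2^-1 * (a + st a + (J * J) * (st a - a)) by ring.
rewrite JJ; have -> : a + st a + -1 * (st a - a) = a + a by ring.
by rewrite half_dbl.
Qed.

(** Either [h] or [- h] reaches its norm: otherwise [h] would lie between [-(N h - e)] and
    [N h - e], and [pos_norm] would give [N h <= N h - e]. *)
Lemma self_adjoint_char h : st h = h -> h != 0 -> exists c : B -> R,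
  [/\ forall x y, st x = x -> st y = y -> c (x + y) = c x + c y,
      forall x y, st x = x -> st y = y -> c (x * y) = c x * c y,
      forall r : R, c (rs r) = r, forall x, st x = x -> `|c x| <= N x & `|c h| = N h].
Proof.
move=> sh h0; have n0 : 0 < N h.
  by rewrite lt_def N_ge0 andbT; apply: contra_neq h0; exact: N_eq0.
have main g : st g = g -> (forall d : R, 0 < d -> ~ pos (rs (N g - d) - g)) ->
    exists c : B -> R,
  [/\ forall x y, st x = x -> st y = y -> c (x + y) = c x + c y,
      forall x y, st x = x -> st y = y -> c (x * y) = c x * c y,
      forall r : R, c (rs r) = r, forall x, st x = x -> `|c x| <= N x & `|c g| = N g].
  move=> sg gm; have [Q [Qc Qpos Qg Qtot]] := maximal_cone sg gm.
  exists (cone_char Q); split.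
  - exact: cone_charD.
  - exact: cone_charM.
  - exact: cone_char_rs.
  - move=> x sx; rewrite ler_norml; apply/andP; split; last first.
      by apply: cone_char_le => //; apply: Qpos; exact: pos_bounded.
    apply: cone_char_ge => //; apply: Qpos.
    have -> : x - rs (- N x) = rs (N x) - - x by rewrite rmorphN/=; ring.
    by apply: pos_bounded; rewrite ?stN ?sx ?Nopp.
  have -> : cone_char Q g = N g; last by rewrite ger0_norm.
  apply/eqP; rewrite eq_le cone_char_ge// andbT cone_char_le//.
  by apply: Qpos; exact: pos_bounded.
have [|nh] := pselect (forall d : R, 0 < d -> ~ pos (rs (N h - d) - h)); first exact: main.
have [||c [cD cM crs cb cN]] := main (- h); first by rewrite stN sh.
  move=> d d0 hd; apply: nh => d' d'0 hd'.
  (* Kept below [N h] as well, because [pos_norm] asks for a nonnegative bound. *)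
  pose e := Num.min (N h) (Num.min d d').
  have e0 : 0 < e by rewrite !lt_min n0 d0 d'0.
  have eN : e <= N h by rewrite ge_min lexx.
  have ed : e <= d by rewrite !ge_min lexx orbT.
  have ed' : e <= d' by rewrite !ge_min lexx !orbT.
  have : N h <= N h - e.
    apply: pos_norm; first by rewrite subr_ge0.
      have -> : rs (N h - e) - h = (rs (N h - d') - h) + rs (d' - e) by rewrite !rmorphB/=; ring.
      by apply: pos_add => //; apply: pos_rs; rewrite subr_ge0.
    have -> : rs (N h - e) + h = (rs (N (- h) - d) - - h) + rs (d - e).
      by rewrite Nopp !rmorphB/=; ring.
    by apply: pos_add => //; apply: pos_rs; rewrite subr_ge0.
  by rewrite lerBrDr gerDl leNgt e0.
exists c; split=> //; move: cN; rewrite Nopp => <-.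
have c0 : c h + c (- h) = 0 by rewrite -cD ?stN ?sh// subrr -(rmorph0 rs).
by rewrite (_ : c (- h) = - c h) ?normrN//; apply/eqP; rewrite -addr_eq0 addrC c0.
Qed.

(** A real character [c] on self-adjoint elements that attains the norm of [st a * a] extends
    through [x = re x + J im x]. The C*-identity then converts [|chi x|^2 = c (st x * x)] into the
    norm statements. *)
Lemma commutative_char a : a != 0 -> exists chi : B -> R[i],
  [/\ forall x y, chi (x + y) = chi x + chi y, forall x y, chi (x * y) = chi x * chi y,
      forall r : R, chi (rs r) = r%:C%C, chi J = 'i%C &
      [/\ forall x, chi (st x) = (chi x)^*, forall x, `|chi x| <= (N x)%:C%C &
          `|chi a| = (N a)%:C%C]].
Proof.
move=> a0; pose h := st a * a.
have sh : st h = h by rewrite /h stM stK mulrC.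
have Nh : N h = N a ^+ 2 by rewrite Nst.
have h0 : h != 0.
  apply: contra_neq a0 => hz; apply: N_eq0; apply/eqP; rewrite -sqrf_eq0 -Nh hz N0//.
have [c [cD cM crs cb cN]] := self_adjoint_char sh h0.
pose chi x : R[i] := (c (re x) +i* c (im x))%C.
have chiE x y : st x = x -> st y = y -> chi (x + J * y) = (c x +i* c y)%C.
  move=> sx sy; have sE : st (x + J * y) = x - J * y by rewrite stD stM sx sy stJ mulNr.
  have rE : re (x + J * y) = x.
    by rewrite /re sE (_ : x + J * y + (x - J * y) = x + x) ?half_dbl//; ring.
  have iE : im (x + J * y) = y.
    rewrite /im sE (_ : J * (x - J * y - (x + J * y)) = - (J * J) * (y + y)); last by ring.
    by rewrite JJ opprK mul1r half_dbl.
  by rewrite /chi rE iE.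
have c0 : c 0 = 0 by rewrite -(rmorph0 rs).
have cN' x : st x = x -> c (- x) = - c x.
  by move=> sx; apply/eqP; rewrite -addr_eq0 addrC -cD ?stN ?sx// subrr c0.
have s0 : st 0 = 0 by exact: st0.
have chiD x y : chi (x + y) = chi x + chi y.
  have -> : x + y = (re x + re y) + J * (im x + im y).
    by rewrite {1}(re_im x) {1}(re_im y); ring.
  by rewrite chiE ?cD ?stD ?st_re ?st_im.
have chiM x y : chi (x * y) = chi x * chi y.
  have -> : x * y = (re x * re y + (J * J) * (im x * im y)) + J * (re x * im y + im x * re y).
    by rewrite {1}(re_im x) {1}(re_im y); ring.
  have := st_re x; have := st_im x; have := st_re y; have := st_im y.
  rewrite /chi; move: (re x) (im x) (re y) (im y) => u v w z sz sw sv su.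
  have [suw svz suz svw] : [/\ st (u * w) = u * w, st (v * z) = v * z,
      st (u * z) = u * z & st (v * w) = v * w] by rewrite !stM su sv sw sz.
  rewrite JJ mulN1r -/(chi _) chiE; last by rewrite stD suz svw.
    by rewrite !cD ?cN' ?stN ?svz// !cM.
  by rewrite stD stN suw svz.
have chis x : chi (st x) = (chi x)^*.
  rewrite {1}(re_im x) stD stM st_re st_im stJ mulNr -mulrN chiE ?cN' ?stN ?st_re ?st_im//.
have chirs (r : R) : chi (rs r) = r%:C%C.
  have -> : rs r = rs r + J * 0 by ring.
  by rewrite chiE// crs c0.
have chiJ : chi J = 'i%C.
  have -> : J = 0 + J * rs 1 by rewrite rmorph1; ring.
  by rewrite chiE// crs c0.
have chi_sa y : st y = y -> chi y = (c y)%:C%C.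
  by move=> sy; have := chiE y 0 sy s0; rewrite mulr0 addr0 c0.
have sq_sa x : st (st x * x) = st x * x by rewrite stM stK mulrC.
have chi_sq x : `|chi x| ^+ 2 = (c (st x * x))%:C%C.
  by rewrite -chi_sa// chiM chis normCK mulrC.
clearbody chi; exists chi; split=> //; split=> // [x|].
  have Nx0 : 0 <= (N x)%:C%C by rewrite lecR.
  have : `|chi x| ^+ 2 <= (N x)%:C%C ^+ 2.
    rewrite chi_sq -(rmorphXn (real_complex R)) lecR.
    by rewrite (le_trans (ler_norm _))// (le_trans (cb _ (sq_sa x)))// Nst.
  by rewrite ler_pXn2r ?nnegrE.
have := cN; rewrite Nh => /(congr1 (real_complex R)); rewrite /= ger0_norm; last first.
  by rewrite -lecR -chi_sq exprn_ge0.
have Na0 : 0 <= (N a)%:C%C by rewrite lecR.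
by rewrite -chi_sq rmorphXn => /eqP; rewrite eqrXn2// => /eqP.
Qed.

End CommutativeCstar.

(** * Norming characters of a unital commutative C*-algebra *)

Section CommutativeCharacters.
Variables (R : realType) (A : cstar_algebra R) (e : A).
Hypothesis eU : is_unit e.
Hypothesis cA : forall a b : A, cmul a b = cmul b a.
Local Notation C := R[i].

Lemma cmul_one : left_id e (@cmul R A).
Proof. by move=> a; exact: (eU a).1. Qed.

Lemma cmulDl : left_distributive (@cmul R A) +%R.
Proof. by move=> a b c; have := cmul_linl 1 a b c; rewrite !scale1r. Qed.

(** The same carrier packed as a commutative ring, with real scalars [rs] and imaginary unit [J], so
    that the results of the preceding section, proved by ring identities, apply. *)
Let B : comPzRingType := HB.pack (cstar_car A)
  (GRing.Zmodule_isComPzRing.Build (cstar_car A) (@cmulA R A) cA cmul_one cmulDl).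

Let rsf (r : R) : B := r%:C%C *: e.

Lemma cmulZ k (a b : A) : cmul (k *: a) b = k *: cmul a b.
Proof.
have := cmul_linl k a 0 b; rewrite !addr0 => ->.
have -> : cmul 0 b = 0 by apply: (@addrI _ (cmul 0 b)); rewrite -cmulDl !addr0.
by rewrite addr0.
Qed.

Let rs_zmod : zmod_morphism rsf.
Proof. by move=> r s; rewrite /rsf rmorphB/= scalerBl. Qed.

Let rs_mon : monoid_morphism rsf.
Proof.
split=> [|r s]; first by rewrite /rsf scale1r.
rewrite /rsf rmorphM/= -scalerA; apply: esym.
by rewrite -[LHS]/(cmul (r%:C%C *: e) (s%:C%C *: e)) cmulZ cmul_one.
Qed.

Let rs : {rmorphism R -> B} := HB.pack rsf (GRing.isZmodMorphism.Build R B rsf rs_zmod)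
  (GRing.isMonoidMorphism.Build R B rsf rs_mon).

Let N (a : B) : R := complex.Re `|a : A|.

Let NE (a : A) : (N a)%:C%C = `|a|.
Proof. by rewrite /N RRe_real ?normr_real. Qed.

Let J : B := ('i%C : R[i]) *: e.

Lemma cstarD (a b : A) : cstar (a + b) = cstar a + cstar b.
Proof. by have := cstar_antilin 1 a b; rewrite !scale1r conjC1 scale1r. Qed.

Lemma cstarZ k (a : A) : cstar (k *: a) = k^* *: cstar a.
Proof.
have s0 : cstar 0 = 0 :> A by apply: (@addrI _ (cstar 0)); rewrite -cstarD !addr0.
by have := cstar_antilin k a 0; rewrite !addr0 s0 addr0.
Qed.

Let ND (a b : B) : N (a + b) <= N a + N b.
Proof. by rewrite -lecR rmorphD/= !NE; exact: ler_normD. Qed.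

Let NM (a b : B) : N (a * b) <= N a * N b.
Proof. by rewrite -lecR rmorphM/= !NE; exact: cnormM. Qed.

Let Nrs (r : R) (a : B) : N (rs r * a) = `|r| * N a.
Proof.
apply: (@complexI R); rewrite rmorphM/= NE.
have -> : `|r|%:C%C = `|r%:C%C : C| by rewrite normc_def/= expr0n/= addr0 sqrtr_sqr.
by rewrite -[rs r * a]/(cmul (r%:C%C *: e) a) cmulZ cmul_one NE normrZ.
Qed.

Let N_eq0 (a : B) : N a = 0 -> a = 0.
Proof.
move=> a0; have := NE a; rewrite a0 => h.
by apply/eqP; rewrite -[a == 0]/((a : A) == 0) -normr_eq0 -h.
Qed.

Let N_ge0 (a : B) : 0 <= N a.
Proof. by rewrite -lecR NE normr_ge0. Qed.

Let stM (a b : B) : cstar (a * b) = (cstar a : B) * cstar b.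
Proof. by rewrite mulrC; exact: cstarM. Qed.

Let strs (r : R) : cstar (rs r : A) = rs r.
Proof.
rewrite -[rs r]/(r%:C%C *: e : A) cstarZ (cstar_unit eU).
by rewrite conj_Creal// complex_real.
Qed.

Let stJ : cstar (J : A) = - J.
Proof. by rewrite /J cstarZ (cstar_unit eU) conjCi scaleNr. Qed.

Let JJ : J * J = -1.
Proof.
rewrite -[LHS]/(cmul ('i%C *: e) ('i%C *: e)) cmulZ cmul_one scalerA.
by rewrite -expr2 sqrCi scaleN1r.
Qed.

Let Nst (a : B) : N ((cstar a : B) * a) = N a ^+ 2.
Proof.
apply: (@complexI R); rewrite rmorphXn/= !NE; exact: cnorm_cstar.
Qed.

Let complete (u : nat -> B) (c q : R) : 0 <= q -> q < 1 ->
  (forall n, N (u n.+1 - u n) <= c * q ^+ n) ->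
  exists l, forall e : R, 0 < e -> exists n0, forall n, (n0 <= n)%N -> N (u n - l) <= e.
Proof.
(* [b n] is the tail of the geometric series from index [n], which bounds the distance from [u n] to
   all later terms. *)
move=> q0 q1 uq; pose b n := c * q ^+ n / (1 - q).
have q1' : 0 < 1 - q by rewrite subr_gt0.
have b0 n : 0 <= b n by rewrite divr_ge0 ?(ltW q1')// (le_trans _ (uq n)).
have bS n : c * q ^+ n + b n.+1 = b n.
  by rewrite /b exprS; field; rewrite gt_eqF.
have ub n m : N (u (n + m)%N - u n) <= b n - b (n + m)%N.
  elim: m => [|m IH]; first by rewrite addn0 !subrr /N normr0.
  rewrite addnS; have -> : u (n + m).+1 - u n =
    (u (n + m).+1 - u (n + m)%N) + (u (n + m)%N - u n) by ring.
  by rewrite (le_trans (ND _ _))//; have := uq (n + m)%N; have := bS (n + m)%N; lra.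
have small (d : R) : 0 < d -> exists n0, forall n, (n0 <= n)%N -> b n <= d.
  move=> d0; have /cvgrPdist_le : q ^+ n @[n --> \oo] --> (0 : R^o)
    by apply: cvg_expr; rewrite ger0_norm.
  have c1 : 0 < `|c| + 1 by rewrite ltr_wpDl.
  have k0 : 0 < d * (1 - q) / (`|c| + 1) by rewrite divr_gt0 ?mulr_gt0.
  move=> /(_ _ k0) [n0 _ n0E]; exists n0 => n nn0; have := n0E n nn0.
  rewrite /= sub0r normrN ger0_norm ?exprn_ge0// /b ler_pdivrMr// ler_pdivlMr// => h.
  rewrite (le_trans _ h)// mulrC ler_wpM2l ?exprn_ge0//.
  by rewrite (le_trans (ler_norm _))// lerDl.
have ubb n m : (n <= m)%N -> N (u m - u n) <= b n.
  by move=> nm; rewrite -(subnKC nm) (le_trans (ub _ _))// lerBlDr lerDl.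
have [||_ /gt0CP[d d0 ->]|k kE] := @cauchy_family R A
  (fun d => [set x | exists2 n, b n <= d & x = u n]) (@complete_normed _ _).
- move=> d d0; have [n0 n0E] := small d d0; exists (u n0), n0 => //; exact: n0E.
- by move=> d d' dd x [n bn ->]; exists n => //; exact: le_trans dd.
- exists d => // _ _ [n bn ->] [m bm ->]; rewrite -NE lecR.
  have [nm|mn] := leqP n m; last exact: le_trans (ubb _ _ (ltnW mn)) bm.
  by rewrite -lecR NE distrC -NE lecR; exact: le_trans (ubb _ _ nm) bn.
exists k => d d0; have [|d' d'0 kd] := kE d%:C%C; first by rewrite ltcR.
have [n0 n0E] := small d' d'0; exists n0 => n nn0.
rewrite -lecR -[u n - k]/((u n : A) - k) NE distrC; apply: kd; exists n => //; exact: n0E.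
Qed.

Lemma comm_sq_complement (a : A) : `|a| < 1 ->
  exists b : A, cmul (cstar b) b = e - cmul (cstar a) a.
Proof.
move=> a1; have [||y [sy yE]] := @sqrt_exists R B N (@cstar R A) rs ND NM Nrs N_eq0 N_ge0
  cstarD stM (@cstarK R A) strs Nst complete ((cstar a : B) * a).
- by rewrite stM cstarK mulrC.
- rewrite Nst; have : N a < 1 by rewrite -ltcR NE.
  by move=> h; rewrite exprn_ilt1.
by exists y; rewrite sy; exact: yE.
Qed.

Lemma comm_character (a : A) : a != 0 -> exists chi : dual A,
  [/\ forall x y, chi (cmul x y) = chi x * chi y, chi e = 1,
      forall x, chi (cstar x) = (chi x)^*, forall x, `|chi x| <= `|x| & `|chi a| = `|a|].
Proof.
move=> a0.
have [chi [chiD chiM chirs chiJ [chis chib chia]]] := @commutative_char R B N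
  (@cstar R A) rs J ND NM Nrs N_eq0 N_ge0 cstarD stM (@cstarK R A) strs stJ JJ Nst complete a a0.
have chiZ (k : C) x : chi (k *: x : A) = k * chi x.
  have -> : k *: x = (rs (complex.Re k) + J * rs (complex.Im k)) * (x : B).
    rewrite -[RHS]/(cmul ((complex.Re k)%:C%C *: e +
      cmul ('i%C *: e) ((complex.Im k)%:C%C *: e)) x).
    by rewrite cmulZ cmul_one scalerA -scalerDl cmulZ cmul_one -complexE.
  by rewrite chiM chiD chiM !chirs chiJ -complexE.
have [|| f fE] := @blin_exists R A R[i]^o chi.
- by move=> k x y; rewrite chiD chiZ.
- by exists 1 => x; rewrite mul1r -NE.
exists f; split=> [x y||x|x|]; rewrite ?fE.
- exact: chiM.
- by rewrite -[e]scale1r; have := chirs 1.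
- exact: chis.
- by rewrite -NE.
- by rewrite chia NE.
Qed.

End CommutativeCharacters.

(** * Commutative Eberlein algebras *)

Lemma Im_le_norm (R : rcfType) (z : R[i]) : `|complex.Im z|%:C%C <= `|z|.
Proof. by rewrite -normrN -ReiNIm (le_trans (normc_ge_Re _))// normrM normci mulr1. Qed.

Lemma continuous_addC (R : realType) (X : topologicalType) (f g : X -> R[i]^o) :
  continuous f -> continuous g -> continuous (fun x => f x + g x : R[i]^o).
Proof. by move=> fc gc x; apply: (@cvgD R[i] R[i]^o); [exact: fc|exact: gc]. Qed.

Lemma continuous_subC (R : realType) (X : topologicalType) (f g : X -> R[i]^o) :
  continuous f -> continuous g -> continuous (fun x => f x - g x : R[i]^o).
Proof. by move=> fc gc x; apply: (@cvgB R[i] R[i]^o); [exact: fc|exact: gc]. Qed.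

Section Projections.
Variables (R : realType) (H : hilbert R).
Local Notation C := R[i].

Lemma projection_op (V : set H) : subspace_like V -> adherent V `<=` V ->
  exists Q : bop H, (forall u, V (Q u)) /\ forall u v, V v -> dot (Q u) v = dot u v.
Proof.
move=> Vs Vc; pose q u := s2val (cid2 (orth_proj Vs Vc u)).
have qV u : V (q u) by exact: s2valP (cid2 (orth_proj Vs Vc u)).
have qo u v : V v -> dot (q u) v = dot u v.
  move=> Vv; apply/eqP; rewrite eq_sym -subr_eq0 -dotBl; apply/eqP.
  exact: (s2valP' (cid2 (orth_proj Vs Vc u))).
have VB x y : V x -> V y -> V (x - y).
  by move=> Vx Vy; rewrite addrC -scaleN1r; exact: Vs.2.
have [||Q QE] := @blin_exists R H H q.
- move=> c x y; apply/eqP; rewrite -subr_eq0 -normr_eq0 -sqrf_eq0 dot_norm.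
  set d := _ - _; have Vd : V d by apply: VB => //; exact: Vs.2.
  by rewrite {1}/d dotBl dotDl dotZl !qo// -dotZl -dotDl subrr.
- exists 1 => x; rewrite mul1r.
  have := cauchy_schwarz x (q x); rewrite -qo// -dot_norm normrX normr_id expr2.
  have [->|n0] := eqVneq `|q x| 0; first by [].
  by rewrite ler_pM2r// lt_def n0 normr_ge0.
by exists Q; split=> [u|u v Vv]; rewrite QE//; exact: qo.
Qed.

End Projections.

(** * Commutants and slices at characters *)

Section TensorCommutants.
Variables (R : realType) (A : cstar_algebra R) (U : univ_rep A) (H : hilbert R).
Variables (T : htensor U H) (N : set (bop H)).
Local Notation C := R[i].

Let rh := rep_star_hom U.

(** The commutant of [rep]. Tensored with the identity, its elements commute with every member of
    the von Neumann tensor product, see [vn_tensor_commute]. *)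
Definition rep_commuting (c : bop U) := forall a u, rep U a (c u) = c (rep U a u).

Lemma rep_commuting_bidual c x : rep_commuting c -> @bidual R A U x ->
  blin_comp c x = blin_comp x c.
Proof.
move=> cc bx; apply: bx => _ [a _ <-]; apply: blinP => u /=; exact: cc.
Qed.

Lemma vn_tensor_commute (X : bop T) c z : vn_tensor (@bidual R A U) N X -> rep_commuting c ->
  X (tens_op T c (blin_id H) z) = tens_op T c (blin_id H) (X z).
Proof.
move=> XN cc; have E : blin_comp (tens_op T c (blin_id H)) X =
    blin_comp X (tens_op T c (blin_id H)).
  apply: XN => t [x [y [bx _ tE]]]; apply: tens_op_ext => u h.
  rewrite /= tens_opE !tE tens_opE.
  by congr tens; exact: (congr1 (fun y : bop U => y u) (esym (rep_commuting_bidual cc bx))).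
exact: (congr1 (fun y : bop T => y z) (esym E)).
Qed.

(** [rep a] multiplies the range vector by [chi a] and, through its adjoint on [w'], the functional
    by the same scalar. *)
Lemma rep_commuting_rank1 (chi : A -> C) w w' :
  (forall a, rep U a w = chi a *: w) -> (forall a, rep U a w' = chi a *: w') ->
  (forall a, chi (cstar a) = (chi a)^*) -> rep_commuting (rank1 w w').
Proof.
move=> wE wE' chis a u; rewrite !rank1E blinZ wE (star_hom_dot rh) wE' dotZr chis conjCK scalerA.
by rewrite mulrC.
Qed.

(* The projection onto the closure of [rep U A u] lies in the commutant and *)
(* kills [v].                                                              *)
Lemma vanishing_slice (e : A) (X : bop T) u v h k : is_unit e -> vn_tensor (@bidual R A U) N X ->
  (forall a, dot (rep U a u) v = 0) -> dot (X (tens T u h)) (tens T v k) = 0.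
Proof.
move=> eU XN uv0; pose V0 := [set z | exists a, z = rep U a u]; pose V := adherent V0.
have V0s c x y : V0 x -> V0 y -> V0 (c *: x + y).
  by move=> [a ->] [b ->]; exists (c *: a + b); rewrite (star_homP rh).
have Vs : subspace_like V.
  split; first by apply: sub_adherent; exists 0; rewrite (star_hom0 rh).
  move=> c x y Vx Vy d d0; have c1 : 0 < `|c| + 1 by rewrite ltr_wpDl.
  have d2 : 0 < d / 2 by rewrite divr_gt0.
  have [x' Vx' xx] := Vx _ (divr_gt0 d2 c1); have [y' Vy' yy] := Vy _ d2.
  exists (c *: x' + y'); first exact: V0s.
  rewrite opprD addrACA -scalerBr (le_trans (ler_normD _ _))// [d]splitr lerD//.
  rewrite normrZ (le_trans (ler_wpM2l _ xx))// mulrCA ler_piMr ?(ltW d2)//.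
  by rewrite ler_pdivrMr// mul1r lerDl.
have Vc : adherent V `<=` V by exact: adherentK.
have Vrep a x : V x -> V (rep U a x).
  move=> Vx d d0; have [M M0 aM] := blin_gt0 (rep U a).
  have [_ [b ->] xb] := Vx _ (divr_gt0 d0 M0).
  exists (rep U (cmul a b) u); first by exists (cmul a b).
  rewrite (star_homM rh) -blinB (le_trans (aM _))// (le_trans (ler_wpM2l (ltW M0) xb))//.
  by rewrite mulrC divfK ?gt_eqF.
have [Q [QV Qo]] := projection_op Vs Vc.
have Qc : rep_commuting Q.
  move=> a x; apply/eqP; rewrite -subr_eq0 -normr_eq0 -sqrf_eq0 dot_norm.
  set d := _ - _; have Vd : V d.
    by rewrite /d addrC -scaleN1r; apply: Vs.2 => //; exact: Vrep.
  rewrite {1}/d dotBl Qo// !(star_hom_dot rh) Qo ?subrr//.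
  exact: Vrep.
have Vu : V u by apply: sub_adherent; exists e; rewrite (rep_unit eU).
have Qu : Q u = u.
  apply/eqP; rewrite -subr_eq0 -normr_eq0 -sqrf_eq0 dot_norm.
  set d := _ - _; have Vd : V d by rewrite /d addrC -scaleN1r; apply: Vs.2.
  by rewrite {1}/d dotBl Qo// subrr.
have Vv x : V x -> dot x v = 0.
  move=> Vx; apply: approx_eq => d d0; have d1 : 0 < d / (`|v| + 1).
    by rewrite divr_gt0// ltr_wpDl.
  have [_ [a ->] xa] := Vx _ d1.
  rewrite -(uv0 a) -dotBl (le_trans (cauchy_schwarz _ _))//.
  rewrite (le_trans (ler_wpM2r _ xa))// -mulrA ler_piMr ?(ltW d0)//.
  by rewrite mulrC ler_pdivrMr ?ltr_wpDl// mul1r lerDl.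
rewrite -{1}Qu.
have -> : tens T (Q u) h = tens_op T Q (blin_id H) (tens T u h) by rewrite tens_opE.
rewrite (vn_tensor_commute _ XN Qc) adjointP tens_op_adjoint tens_opE.
suff -> : adjoint Q v = 0 by rewrite tens0l dot0r.
by apply: dot_ext => x; rewrite dot_adjoint dot0l -[LHS]conjCK -dotC Vv// conjC0.
Qed.

Lemma eigen_star (chi : A -> C) w : `|w| = 1 -> (forall a, rep U a w = chi a *: w) ->
  forall a, chi (cstar a) = (chi a)^*.
Proof.
move=> w1 wE a; have ww : dot w w = 1 by rewrite -dot_norm w1 expr1n.
have E b : chi b = dot (rep U b w) w by rewrite wE dotZl ww mulr1.
by rewrite {1}E (star_hom_dot rh) cstarK wE dotZr ww mulr1.
Qed.

(** The vectors [u] and [v] representing [chi] are arbitrary. Since [u - w0] and [v] induce the zero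
    functional, [vanishing_slice] replaces [u] by [w0]. The projection onto [w] lies in the
    commutant, which then replaces [v] by its component along [w]. *)
Lemma character_slice (e : A) (chi : dual A) u v : is_unit e ->
  (forall a b, chi (cmul a b) = chi a * chi b) -> chi e = 1 ->
  (forall a, chi a = dot (rep U a u) v) ->
  exists w : U, [/\ `|w| = 1, forall a, rep U a w = chi a *: w &
    forall (X : bop T) h k, vn_tensor (@bidual R A U) N X ->
      dot (X (tens T u h)) (tens T v k) = dot (X (tens T w h)) (tens T w k)].
Proof.
move=> eU chiM chi1 chiE; have [w0 [w0v w0E w0u]] := character_vector eU chiM chi1 chiE.
have n0 : `|w0| != 0.
  by rewrite normr_eq0; apply/eqP => z; move/eqP: w0v; rewrite z dot0l eq_sym oner_eq0.
pose w := `|w0|^-1 *: w0.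
have w1 : `|w| = 1 by rewrite normrZ normfV normr_id mulVf.
have wE a : rep U a w = chi a *: w by rewrite blinZ w0E !scalerA mulrC.
have chis := eigen_star w1 wE.
have uw0 : dot u w0 = dot w0 w0.
  apply: approx_eq => d d0; have d1 : 0 < d / (`|w0| + 1) by rewrite divr_gt0// ltr_wpDl.
  have [_ [a a1 ->] xa] := w0u _ d1.
  have -> : dot u w0 = dot (rep U a u) w0.
    by rewrite (star_hom_dot rh) w0E chis a1 conjC1 scale1r.
  rewrite -dotBl (le_trans (cauchy_schwarz _ _))// distrC.
  rewrite (le_trans (ler_wpM2r _ xa))// -mulrA ler_piMr ?(ltW d0)//.
  by rewrite mulrC ler_pdivrMr ?ltr_wpDl// mul1r lerDl.
have u1 a : dot (rep U a (u - w0)) v = 0.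
  by rewrite blinB dotBl -chiE w0E dotZl w0v mulr1 subrr.
exists w; split=> // X h k XN.
have pc := rep_commuting_rank1 wE wE chis.
have pw0 : rank1 w w w0 = w0.
  rewrite rank1E /w dotZr -dot_norm scalerA geC0_conj ?invr_ge0//.
  by rewrite expr2 mulrA mulVf// mul1r mulfV// scale1r.
have pv : rank1 w w v = `|w0|^-1 *: w.
  rewrite rank1E /w dotZr dotC w0v conjC1 mulr1 geC0_conj ?invr_ge0//.
have pa : adjoint (rank1 w w) = rank1 w w by exact: adjoint_rank1.
rewrite -{1}(subrK w0 u) tensDl blinD dotDl (vanishing_slice h k eU XN u1) add0r.
rewrite -{1}pw0.
have -> : tens T (rank1 w w w0) h = tens_op T (rank1 w w) (blin_id H) (tens T w0 h).
  by rewrite tens_opE.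
rewrite (vn_tensor_commute _ XN pc) adjointP tens_op_adjoint tens_opE pa pv.
have -> : adjoint (blin_id H) k = k by rewrite (@adjoint_uniq _ _ (blin_id H) (blin_id H)).
have w0w : w0 = `|w0| *: w by rewrite scalerA mulfV ?scale1r.
rewrite {1}w0w !tensZl blinZ dotZl dotZr geC0_conj ?invr_ge0// mulrA mulfV ?mul1r//.
Qed.

End TensorCommutants.

Section FlippedTensor.
Variables (R : realType) (K H : hilbert R) (T : htensor K H).

Lemma flip_dot u v h k : dot (tens T h u) (tens T k v) = dot u v * dot h k.
Proof. by rewrite tens_dot mulrC. Qed.

Lemma flip_total : dense (lin_span [set z | exists u h, z = tens T h u]).
Proof.
have := @tens_total _ _ _ T; congr (dense (lin_span _)).
by apply/seteqP; split=> z [u [h ->]]; exists h, u.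
Qed.

(** The same Hilbert space with the legs exchanged, so that results on the first leg apply to the
    second. *)
Definition flip_tensor : htensor H K := HTensor flip_dot flip_total.

Lemma flip_vn_tensor (M : set (bop K)) (N : set (bop H)) (X : bop T) :
  vn_tensor M N X -> vn_tensor (T := flip_tensor) N M X.
Proof.
move=> XMN c cc; apply: XMN => t [x [y [Mx Ny tE]]]; apply: cc.
by exists y, x; split=> // h u; exact: tE.
Qed.

End FlippedTensor.

(** * The semigroup of slices at characters *)

Section EberleinCommutative.
Variables (R : realType) (A : cstar_algebra R) (U : univ_rep A) (H : hilbert R).
Variables (T2 : htensor U U) (T : htensor U H) (Phi : A -> bop T2) (V : bop T).
Local Notation C := R[i].
Hypothesis EV : is_eberlein Phi V.
Variable e : A.
Hypothesis eU : is_unit e.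
Hypothesis cA : forall a b : A, cmul a b = cmul b a.

Let rh := rep_star_hom U.
Let Ph := eberlein_hom EV.
Let sq := comm_sq_complement eU cA.
Let V1 := eberlein_contractive EV.

(** Stated for bare functions, so that it applies directly to [conv Phi chi psi]. *)
Definition is_character (chi : A -> C) :=
  (forall a b, chi (cmul a b) = chi a * chi b) /\ chi e = 1.

Let conv_dual_ex (m l : A -> C) : exists n : dual A, forall a, n a = Defs.conv Phi m l a.
Proof.
apply: (@blin_exists R A R[i]^o (Defs.conv Phi m l)).
  by move=> k a b; rewrite /Defs.conv /pairing2 (star_homP Ph) dotDl dotZl.
exists (`|tens T2 (vectors U m).1 (vectors U l).1| *
  `|tens T2 (vectors U m).2 (vectors U l).2|) => a.
rewrite /Defs.conv /pairing2 (le_trans (cauchy_schwarz _ _))//.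
rewrite [leRHS]mulrC mulrA ler_wpM2r//.
exact: (star_hom_bound Ph eU sq).
Qed.

Lemma conv_dual (m l : A -> C) : exists n : dual A, n = Defs.conv Phi m l :> (A -> C).
Proof. by have [n nE] := conv_dual_ex m l; exists n; apply/funext. Qed.

Lemma rslice_dot (w : predual H) u v : dot (rslice V w u) v = w (vec_slice V u v).
Proof.
have [c c0 wc] := predual_le w.
have sliceM u' v' h : `|vec_slice V u' v' h| <= 1 * `|u'| * `|v'| * `|h|.
  by apply: vec_slice_bound => // z; rewrite mul1r; exact: V1.
have [||u' v'||Y [YE _]] := @op_of_form R U U (fun u v => w (vec_slice V u v)) c.
- move=> k x x' y; apply: predual_lin => h; apply: dot_ext => h'.
  by rewrite dotDl dotZl !vec_sliceP tensDl tensZl blinD blinZ dotDl dotZl.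
- move=> k x y y'; apply: predual_lin => h; apply: dot_ext => h'.
  by rewrite dotDl dotZl !vec_sliceP tensDl tensZl dotDr dotZr.
- rewrite (le_trans (wc _ _ _ (sliceM u' v')))// ?mulr_ge0//.
  by rewrite mul1r mulrC mulrA.
- exact: ltW.
suff -> : rslice V w = Y by exact: YE.
by apply: rslice_eq => x y; rewrite YE.
Qed.

Definition slice_elt (w : predual H) : A := sval (cid (eberlein_slices EV w)).

Lemma slice_eltE w : rslice V w = rep U (slice_elt w).
Proof. exact: (svalP (cid (eberlein_slices EV w))). Qed.

(** The exchange formula [<(m (x) id) V, w> = <m, (id (x) w) V>]. Together with the density of
    slices it transports identities between operators on [H] and functionals on [A]. *)
Lemma lslice_elt (w : predual H) (m : dual A) : w (lslice V m) = m (slice_elt w).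
Proof. by rewrite (vectorsP U m) -slice_eltE rslice_dot. Qed.

Lemma slice_vectors (w : predual H) u v : w (vec_slice V u v) = dot (rep U (slice_elt w) u) v.
Proof. by rewrite -slice_eltE rslice_dot. Qed.

Lemma predual_sep (x y : bop H) : (forall w : predual H, w x = w y) -> x = y.
Proof.
move=> xy; apply: blinP => h; apply: dot_ext => k.
have [w wE] := vec_predual (fun _ : 'I_1 => h) (fun=> k).
by have := xy w; rewrite !wE !big_ord1.
Qed.

(** Characters are norming by [comm_character], so they already separate [a] from [0]. *)
Lemma dual_zero (a : A) : (forall m : dual A, m a = 0) -> a = 0.
Proof.
move=> ma; apply/eqP; apply/negP => /negP a0.
have [chi [_ _ _ _ chia]] := comm_character eU cA a0.
by move/eqP: a0; apply; apply/eqP; rewrite -normr_eq0 -chia ma normr0.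
Qed.

Lemma slice_dense a : adherent [set a : A | exists w, a = slice_elt w] a.
Proof.
have := (@denseP R A _).1 (eberlein_dense EV) a; apply: adherentS => b [w wb].
exists w; apply/eqP; rewrite -subr_eq0; apply/eqP; apply: dual_zero => m.
by rewrite blinB !(vectorsP U m) -slice_eltE wb; exact: subrr.
Qed.

Lemma dual_slice0 (m : dual A) : (forall w, m (slice_elt w) = 0) -> forall a, m a = 0.
Proof.
move=> m0 a; have [c c0 mc] := blin_gt0 m.
apply: approx_eq => d d0; have [b [w ->] ab] := slice_dense a (divr_gt0 d0 c0).
have h := mc (a - slice_elt w); rewrite blinB m0 in h.
rewrite (le_trans h)// (le_trans (ler_wpM2l (ltW c0) ab))//.
by rewrite mulrC divfK ?gt_eqF.
Qed.

Lemma dual_eq_slices (m l : dual A) : (forall w, m (slice_elt w) = l (slice_elt w)) ->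
  forall a, m a = l a.
Proof.
move=> ml a; have [n nE] := blin_sub_exists m l.
apply/eqP; rewrite -subr_eq0 -nE; apply/eqP; apply: dual_slice0 => w.
by rewrite nE ml; exact: subrr.
Qed.

(** [chi] is also represented by a unit eigenvector [w], and slicing by [<. w, w>] does not increase
    the norm of [V]. *)
Lemma char_slice (chi : dual A) : is_character chi -> contractive (lslice V chi).
Proof.
move=> [chiM chi1]; have [w [w1 wE]] := @character_eigenvector _ _ U e eU chi chiM chi1.
have -> : lslice V chi = vec_slice V w w.
  apply: predual_sep => p; rewrite lslice_elt slice_vectors wE dotZl.
  by rewrite -dot_norm w1 expr1n mulr1.
move=> h; rewrite (le_trans (@vec_slice_bound _ _ _ _ _ 1 _ _ ler01 _ h))//.
  by move=> z; rewrite mul1r; exact: V1.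
by rewrite w1 !mulr1 mul1r.
Qed.

Lemma conv_character (chi psi : dual A) : is_character chi -> is_character psi ->
  is_character (Defs.conv Phi chi psi).
Proof.
move=> [chiM chi1] [psiM psi1].
have [w [w1 wE wX]] := @character_slice R A U U T2
  (@bidual R A U) e chi _ _ eU chiM chi1 (vectorsP U chi).
have [w' [w1' wE' wX']] := @character_slice R A U U (flip_tensor T2)
  (@bidual R A U) e psi _ _ eU psiM psi1 (vectorsP U psi).
pose z := tens T2 w w'.
have z1 : dot z z = 1 by rewrite tens_dot -!dot_norm w1 w1' !expr1n mulr1.
have convE a : Defs.conv Phi chi psi a = dot (Phi a z) z.
  rewrite /Defs.conv /pairing2 wX; last exact: eberlein_range EV a.
  exact: (wX' _ _ _ (flip_vn_tensor (eberlein_range EV a))).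
(* [Phi a] commutes with the projection onto [w] in the first leg and onto [w'] in the second, hence
   with their product, the projection onto the line of [z]. *)
have PhiZ a : Phi a z = Defs.conv Phi chi psi a *: z.
  have pc := rep_commuting_rank1 wE wE (eigen_star w1 wE).
  have pc' := rep_commuting_rank1 wE' wE' (eigen_star w1' wE').
  have pw : rank1 w w w = w by rewrite rank1E -dot_norm w1 expr1n scale1r.
  have pw' : rank1 w' w' w' = w' by rewrite rank1E -dot_norm w1' expr1n scale1r.
  have E1 : Phi a z = tens_op T2 (rank1 w w) (blin_id U) (Phi a z).
    by rewrite -(vn_tensor_commute _ (eberlein_range EV a) pc) tens_opE pw.
  have E2 : Phi a z = tens_op T2 (blin_id U) (rank1 w' w') (Phi a z).
    have <- : tens_op (flip_tensor T2) (rank1 w' w') (blin_id U) =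
        tens_op T2 (blin_id U) (rank1 w' w').
      by apply: (@tens_op_uniq _ _ _ T2) => u h; exact: (@tens_opE _ _ _ (flip_tensor T2)).
    have h := @vn_tensor_commute R A U U (flip_tensor T2) _ _ _ z
      (flip_vn_tensor (eberlein_range EV a)) pc'.
    by rewrite -h -[z]/(tens (flip_tensor T2) w' w) (@tens_opE _ _ _ (flip_tensor T2)) pw'.
  have E3 y : tens_op T2 (blin_id U) (rank1 w' w') (tens_op T2 (rank1 w w) (blin_id U) y) =
      rank1 z z y.
    have -> : rank1 z z = blin_comp (tens_op T2 (blin_id U) (rank1 w' w'))
        (tens_op T2 (rank1 w w) (blin_id U)).
      apply: tens_op_ext => u h; rewrite /= !tens_opE !rank1E /z tens_dot.
      by rewrite tensZl tensZr scalerA.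
    by [].
  by rewrite {1}E2 {1}E1 E3 rank1E convE.
split.
- by move=> a b; rewrite [LHS]convE (star_homM Ph) PhiZ blinZ PhiZ !dotZl z1 !mulr1 mulrC.
- by rewrite convE (eberlein_unital EV).1.
Qed.

Lemma character_bound (chi : dual A) a : is_character chi -> `|chi a| <= `|a|.
Proof.
move=> [chiM chi1]; have [w [w1 wE]] := @character_eigenvector _ _ U e eU chi chiM chi1.
have := star_hom_bound rh eU sq a w.
by rewrite wE normrZ w1 !mulr1.
Qed.

Definition char_ops : set (bop H) :=
  [set x | exists2 chi : dual A, is_character chi & x = lslice V chi].

Lemma char_ops_contractive x : char_ops x -> contractive x.
Proof. by move=> [chi chiP ->]; exact: char_slice. Qed.

Lemma char_ops_subsemigroup : subsemigroup char_ops.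
Proof.
move=> _ _ [chi chiP ->] [psi psiP ->]; have [n nE] := conv_dual chi psi.
exists n; first by rewrite nE; exact: conv_character.
by rewrite nE (eberlein_mult EV).
Qed.

(** A vanishing slice would make [chi] zero on the dense set of slices of [V], against
    [chi e = 1]. *)
Lemma char_ops0 : ~ char_ops (blin_zero H H).
Proof.
move=> [chi [chiM chi1] chi0].
have := dual_slice0 (m := chi) _ e; rewrite chi1 => h.
suff /eqP : (1 : C) = 0 by rewrite oner_eq0.
apply: h => w; rewrite -lslice_elt -chi0.
rewrite (@predual_lin _ _ w (-1) (blin_zero H H) (blin_zero H H) (blin_zero H H)).
  by rewrite mulN1r addNr.
by move=> u; rewrite /= scaleN1r addNr.
Qed.

Let Z : topologicalType := prod_topology (fun _ : A => C^o : topologicalType).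

Lemma compact_square (r : R) :
  compact [set z : C^o | (- r <= complex.Re z <= r) && (- r <= complex.Im z <= r)].
Proof.
pose f (c : R * R) : C^o := (c.1%:C + 'i * c.2%:C)%C.
have fE c : f c = (c.1 +i* c.2)%C by rewrite [RHS]complexE.
have I0 : compact (`[- r, r] : set R) by exact: segment_compact.
have -> : [set z : C^o | (- r <= complex.Re z <= r) && (- r <= complex.Im z <= r)] =
    f @` (`[- r, r] `*` `[- r, r]).
  apply/seteqP; split=> [z /andP[zr zi]|_ [[x y] [/= c1 c2] <-]].
    exists (complex.Re z, complex.Im z); first by split; rewrite /= in_itv.
    by rewrite /f /= -complexE.
  by rewrite !in_itv/= in c1 c2; have -> := fE (x, y); rewrite /= c1 c2.
apply: continuous_compact; last exact: compact_setX.
apply: continuous_subspaceT => c.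
have c1 : continuous (fun c : R * R => c.1%:C%C : R[i]^o).
  by apply: continuous_real => z; exact: cvg_fst.
have c2 : continuous (fun c : R * R => c.2%:C%C : R[i]^o).
  by apply: continuous_real => z; exact: cvg_snd.
apply: (@cvgD R[i] R[i]^o); first exact: c1.
exact: (continuous_mulC (@cst_continuous _ R[i]^o 'i%C) c2).
Qed.

Let square (a : A) : set C^o := [set z : C^o |
  (- complex.Re `|a| <= complex.Re z <= complex.Re `|a|) &&
  (- complex.Re `|a| <= complex.Im z <= complex.Re `|a|)].

Let cube : set Z := [set f | forall a, square a (f a)].

Let cube_compact : compact cube.
Proof. by apply: tychonoff => a; exact: compact_square. Qed.

Let char_eqs : set Z := \bigcap_(t in [set: (C * A * A) * (A * A)])
  ([set f : Z | f (t.1.1.1 *: t.1.1.2 + t.1.2) - (t.1.1.1 * f t.1.1.2 + f t.1.2) = 0] `&`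
   [set f : Z | f (cmul t.2.1 t.2.2) - f t.2.1 * f t.2.2 = 0] `&`
   [set f : Z | f e - 1 = 0]).

Let eval_c a : continuous (fun f : Z => f a : C^o).
Proof. exact: ptws_eval. Qed.

Let closed_zero (g : Z -> C^o) : continuous g -> closed [set f | g f = 0].
Proof.
move=> gc; apply: (closed_comp (f := g) (D := [set 0])) => [f _|]; first exact: gc.
exact: (@accessible_closed_set1 C^o (hausdorff_accessible (@norm_hausdorff _ C^o)) 0).
Qed.

Let char_eqs_closed : closed char_eqs.
Proof.
apply: closed_bigI => t _; apply: closedI; first apply: closedI; apply: closed_zero.
- apply: (@continuous_subC R Z (fun f => f _) (fun f => t.1.1.1 * f t.1.1.2 + f t.1.2)).
    exact: eval_c.
  apply: (@continuous_addC R Z (fun f => t.1.1.1 * f t.1.1.2) (fun f => f _)).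
    by apply: (@continuous_mulC R Z (fun=> _) (fun f => f _));
      [exact: cst_continuous|exact: eval_c].
  exact: eval_c.
- apply: (@continuous_subC R Z (fun f => f _) (fun f => f t.2.1 * f t.2.2)).
    exact: eval_c.
  by apply: (@continuous_mulC R Z (fun f => f _) (fun f => f _)); exact: eval_c.
- by apply: (@continuous_subC R Z (fun f => f _) (fun=> 1)); [exact: eval_c|exact: cst_continuous].
Qed.

Let char_eqsP (f : Z) : char_eqs f <-> [/\ forall k a b, f (k *: a + b) = k * f a + f b,
  forall a b, f (cmul a b) = f a * f b & f e = 1].
Proof.
split=> [fe|[fL fM f1] [[[k a] b] [c d]] _]; last first.
  by split; first split; rewrite /= ?fL ?fM ?f1 subrr.
split=> [k a b|a b|].
- by have [[/= /eqP + _] _] := fe (((k, a), b), (0, 0)) Logic.I; rewrite subr_eq0 => /eqP.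
- by have [[_ /= /eqP +] _] := fe (((0, 0), 0), (a, b)) Logic.I; rewrite subr_eq0 => /eqP.
- by have [_ /= /eqP] := fe (((0, 0), 0), (0, 0)) Logic.I; rewrite subr_eq0 => /eqP.
Qed.

Let char_dual (f : Z) : cube f -> char_eqs f ->
  exists2 chi : dual A, is_character chi & chi = f :> (A -> C).
Proof.
move=> fc /char_eqsP[fL fM f1].
have [||chi chiE] := @blin_exists R A R[i]^o f; first exact: fL.
  exists 2 => a; have /andP[/= fr fi] := fc a; have aE : (complex.Re `|a|)%:C%C = `|a|.
    by rewrite RRe_real ?normr_real.
  rewrite [f a]complexE (le_trans (ler_normD _ _))// normrM normci mul1r mulr2n mulrDl mul1r.
  rewrite !normc_def/= !expr0n/= !addr0 !sqrtr_sqr -aE.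
  by rewrite lerD// lecR ler_norml.
have E : chi = f :> (A -> C) by apply/funext.
by exists chi => //; split; rewrite ?E.
Qed.

(** The characters form a closed subset of a Tychonoff cube, and [char_ops] is its image under a
    weak-star continuous map: followed by [w], the map is evaluation at [slice_elt w]. *)
Lemma char_ops_compact : compact (char_ops : set (bop_top weak_star H)).
Proof.
have -> : char_ops = (fun f : Z => lslice V f) @` (cube `&` char_eqs).
  apply/seteqP; split=> [_ [chi chiP ->]|_ [f [fc fe] <-]].
    exists (chi : A -> C) => //; split.
      move=> a; have := character_bound a chiP => ca.
      have ab (r : R) : `|r|%:C%C <= `|chi a| -> - complex.Re `|a| <= r <= complex.Re `|a|.
        move=> rc; rewrite -ler_norml -lecR (le_trans rc)// (le_trans ca)//.
        by rewrite RRe_real ?normr_real.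
      by apply/andP; split; apply: ab; [exact: normc_ge_Re|exact: Im_le_norm].
    by apply/char_eqsP; case: chiP => chiM chi1; split=> // k a b; rewrite blinD blinZ.
  by have [chi chiP chiE] := char_dual fc fe; exists chi => //; rewrite chiE.
apply: (@continuous_compact Z (bop_top weak_star H)); last exact: compact_closedI.
apply: continuous_weak => w.
(* [lslice] is defined on all functions through chosen vectors, and the exchange formula identifies
   it with an evaluation only on the character set; continuity is therefore taken relative to that
   set. *)
apply: (@subspace_eq_continuous _ _ _ (fun f : Z => f (slice_elt w) : C^o)).
  move=> f; rewrite inE => -[fc fe]; have [chi _ <-] := char_dual fc fe.
  by rewrite lslice_elt.
by apply: continuous_subspaceT; exact: eval_c.
Qed.

End EberleinCommutative.

(** * The Gelfand transform onto functions on the semigroup of slices *)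

Section EberleinGelfand.
Variables (R : realType) (A : cstar_algebra R) (U : univ_rep A) (H : hilbert R).
Variables (T2 : htensor U U) (T : htensor U H) (Phi : A -> bop T2) (V : bop T).
Local Notation C := R[i].
Hypothesis EV : is_eberlein Phi V.
Variable e : A.
Hypothesis eU : is_unit e.
Hypothesis cA : forall a b : A, cmul a b = cmul b a.

Let rh := rep_star_hom U.
Let S : set (bop H) := char_ops V e.
Let S1 := char_ops_contractive EV eU.
Let sgS := char_ops_subsemigroup EV eU cA.
Let cS := char_ops_compact EV eU cA.
Local Notation X := (sub_top weak_star S).
Let cX : compact [set: X] := compact_sub_top cS.
Local Notation B := (cb_algebra R X).

Let slice_elt := slice_elt EV.

Let chr_ex (s : X) : {chi : dual A | is_character e chi /\ sub_val s = lslice V chi}.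
Proof. by apply: cid; have [chi chiP sE] := sub_val_mem s; exists chi. Qed.

(** A choice of character for each point. It is determined by the point, since its values on the
    dense set of elements [slice_elt w] are [w (sub_val s)]. *)
Let chr s : dual A := sval (chr_ex s).

Let chrP s : is_character e (chr s).
Proof. by have [] := svalP (chr_ex s). Qed.

Let chrE s : sub_val s = lslice V (chr s).
Proof. by have [] := svalP (chr_ex s). Qed.

Let chr_slice s w : chr s (slice_elt w) = w (sub_val s).
Proof. by rewrite chrE (lslice_elt EV). Qed.

Let chr_bound s a : `|chr s a| <= `|a|.
Proof. exact: character_bound eU cA _ _ (chrP s). Qed.

Let chr_surj (chi : dual A) : is_character e chi -> exists s, forall a, chr s a = chi a.
Proof.
move=> chiP; have Sx : S (lslice V chi) by exists chi.
pose s : X := exist _ (lslice V chi) (mem_set Sx); exists s.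
have E w : chr s (slice_elt w) = chi (slice_elt w) by rewrite chr_slice (lslice_elt EV).
exact: (dual_eq_slices eU cA E).
Qed.

Let gel_continuous a : continuous (fun s => chr s a : R[i]^o).
Proof.
apply: cb_uniform_limit => d d0; have [_ [w ->] aw] := slice_dense EV eU cA a d0.
exists (fun s => w (sub_val s)).
  apply: (@predual_continuous _ _ _ (fun s : X => sub_val s) 1) => //.
    by move=> s u; rewrite mul1r; exact: (S1 (sub_val_mem s)).
  exact: (@sub_val_wot R H weak_star S).
move=> s; rewrite -chr_slice -/slice_elt.
have := chr_bound s (a - slice_elt w); rewrite blinB => h; exact: le_trans aw.
Qed.

Definition gel (a : A) : B := mkcb cX (@gel_continuous a).

Lemma gelE a s : (gel a : cbfun R X) s = chr s a. Proof. by []. Qed.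

Lemma gelP k a b : gel (k *: a + b) = k *: gel a + gel b.
Proof. by apply: cbfun_inj => s; rewrite gelE blinD blinZ. Qed.

Lemma gelM a b : gel (cmul a b) = cmul (gel a) (gel b).
Proof. by apply: cbfun_inj => s; rewrite gelE (chrP s).1. Qed.

Lemma gel_star a : gel (cstar a) = cstar (gel a).
Proof.
apply: cbfun_inj => s; rewrite gelE /=.
have [w [w1 wE]] := character_eigenvector U eU (chrP s).1 (chrP s).2.
exact: (eigen_star w1 wE).
Qed.

Lemma gel_unit s : (gel e : cbfun R X) s = 1.
Proof. by rewrite gelE (chrP s).2. Qed.

(** The lower bound comes from a character with [|chi a| = |a|], which by [chr_surj] is the one
    attached to some point. *)
Lemma gel_norm a : `|gel a| = `|a|.
Proof.
apply/eqP; rewrite eq_le; apply/andP; split.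
  by apply: cb_le_norm => // s; exact: chr_bound.
have [->|a0] := eqVneq a 0; first by rewrite normr0.
have [chi [chiM chi1 _ _ chia]] := comm_character eU cA a0.
have [s sE] := chr_surj (conj chiM chi1).
by rewrite -chia -sE; exact: (cb_norm_ge (gel a : cbfun R X) s).
Qed.

Lemma gelB a b : gel (a - b) = gel a - gel b.
Proof. by have := gelP (-1) b a; rewrite !scaleN1r addrC => ->; rewrite addrC. Qed.

Lemma gel_inj : injective gel.
Proof.
move=> a b ab; apply/eqP; rewrite -subr_eq0 -normr_eq0 -gel_norm gelB ab subrr normr0.
by [].
Qed.

Lemma gel_dense (f : B) : adherent (range gel) f.
Proof.
apply: (@stone_weierstrass R X cX (range gel)).
- by exists 0 => //; have := gelB 0 0; rewrite !subrr.
- by move=> _ _ [a _ <-] [b _ <-]; exists (1 *: a + b) => //; rewrite gelP scale1r.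
- move=> k _ [a _ <-]; exists (k *: a + 0) => //; rewrite gelP.
  by have := gelB 0 0; rewrite !subrr => ->; rewrite addr0.
- by move=> _ _ [a _ <-] [b _ <-]; exists (cmul a b) => //; rewrite gelM.
- by move=> _ [a _ <-]; exists (cstar a) => //; rewrite gel_star.
- move=> s t st; apply: contrapT => nE; apply: st; apply: sub_val_inj.
  apply: predual_sep => w; rewrite -!chr_slice; apply: contrapT => ne; apply: nE.
  by exists (gel (slice_elt w)) => //; exists (slice_elt w).
- by move=> s; exists (gel e); [exists e|rewrite gel_unit; apply/eqP; exact: oner_neq0].
Qed.

(** The transform is isometric on a complete space, so its range is closed; it is dense by
    Stone-Weierstrass. *)
Lemma gel_surj (f : B) : exists a, gel a = f.
Proof.
have [||_ /gt0CP[d d0 ->]|k kE] := @cauchy_family R A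
    (fun d => [set a | `|f - gel a| <= d%:C%C]) (@complete_normed _ _).
- move=> d d0; have [|_ [a _ <-] fa] := gel_dense f (e := d%:C%C); first by rewrite ltcR.
  by exists a.
- by move=> d d' dd a /= fa; rewrite (le_trans fa)// lecR.
- exists (d / 2); first by rewrite divr_gt0.
  move=> a b /= fa fb; rewrite -gel_norm gelB.
  have -> : gel a - gel b = (f - gel b) - (f - gel a) by rewrite opprB [RHS]addrC subrKA.
  rewrite (le_trans (ler_normB _ _))// (le_trans (lerD fb fa))//.
  by rewrite -rmorphD/= -splitr.
exists k; apply/eqP; rewrite eq_sym -subr_eq0 -normr_le0.
apply/ler_addgt0Pr => _ /gt0CP[d d0 ->]; rewrite add0r.
have d2 : 0 < d / 2 by rewrite divr_gt0.
have [|r r0 kr] := kE (d / 2)%:C%C; first by rewrite ltcR.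
pose q := Num.min r (d / 2); have q0 : 0 < q by rewrite lt_min r0 d2.
have [|_ [a _ <-] fa] := gel_dense f (e := q%:C%C); first by rewrite ltcR.
have ka : `|k - a| <= (d / 2)%:C%C.
  by apply: kr; rewrite /= (le_trans fa)// lecR ge_min lexx.
have -> : f - gel k = (f - gel a) - (gel k - gel a) by rewrite opprB subrKA.
rewrite (le_trans (ler_normB _ _))// [d]splitr rmorphD/= lerD//.
  by rewrite (le_trans fa)// lecR ge_min lexx orbT.
by rewrite -gelB gel_norm.
Qed.

Lemma gel_star_iso : star_iso gel.
Proof.
split; [|exact: gelP|exact: gelM|exact: gel_star].
have inv f : {a | gel a = f} := cid (gel_surj f).
exists (fun f => sval (inv f)) => [a|f]; last exact: svalP (inv f).
by apply: gel_inj; exact: svalP (inv (gel a)).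
Qed.

Let p (s : X) : bop H := sub_val s.
Let pc : wot_continuous p := @sub_val_wot R H weak_star S.
Let p1 s : contractive (p s).
Proof. exact: (S1 (sub_val_mem s)). Qed.

Let gel_slice w s : (gel (slice_elt w) : cbfun R X) s = w (p s).
Proof. by rewrite gelE chr_slice. Qed.

Let pdense (f : B) :
  adherent [set g : B | exists w : predual H, forall s, (g : cbfun R X) s = w (p s)] f.
Proof.
have [a <-] := gel_surj f => d d0; have [_ [w ->] aw] := slice_dense EV eU cA a d0.
exists (gel (slice_elt w)); first by exists w => s; exact: gel_slice.
by rewrite -gelB gel_norm.
Qed.

Let mul := sub_mul (tau := weak_star) sgS.
Let pmul s t : p (mul s t) = blin_comp (p s) (p t).
Proof. by []. Qed.
Let mul_cl t : continuous (fun s => mul s t).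
Proof. exact: sub_mul_cl. Qed.
Let mul_cr s : continuous (mul s).
Proof. exact: sub_mul_cr. Qed.

Let pull_ex (m : dual B) : {n : dual A | n = m \o gel :> (A -> C)}.
Proof.
apply: cid; have [c c0 mc] := blin_gt0 m.
have [||n nE] := @blin_exists R A R[i]^o (m \o gel).
- by move=> k a b; rewrite /= gelP blinD blinZ.
- by exists c => a; rewrite /= -gel_norm.
by exists n; apply/funext.
Qed.

Lemma gel_is_V : is_V gel p V.
Proof.
split=> [|m w]; first exact: (eberlein_V EV).
have [n nE] := pull_ex m.
rewrite /pairing -nE (lslice_elt EV) nE; symmetry; apply: sintE => s.
exact: esym (gel_slice w s).
Qed.

Let lslice_pull (m : dual B) : lslice V (m \o gel) = mop cX (@pc) p1 m.
Proof.
have [n nE] := pull_ex m.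
apply: predual_sep => w; rewrite -nE (lslice_elt EV) nE /=.
by apply: mop_coef0 => s; exact: gel_slice.
Qed.

(** The convolution by [Phi] of the pulled-back functionals is compared with the convolution on the
    semigroup. On slices of [V] both are [w] of a product of two slices, by [eberlein_mult] and
    [mconv_coef]; density of slices then gives equality on all of [A]. *)
Lemma gel_is_Phi : is_Phi mul gel Phi.
Proof.
move=> a; split=> [|m l]; first exact: (eberlein_range EV).
have [m' mE] := pull_ex m; have [l' lE] := pull_ex l.
have [n nE] := conv_dual EV eU cA m' l'.
have [q qE] := pull_ex (mconv cX (@pc) p1 pdense (@mul_cl) pmul m l).
have nq w : n (slice_elt w) = q (slice_elt w).
  rewrite -(lslice_elt EV) nE (eberlein_mult EV).
  rewrite mE lE !lslice_pull qE /=.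
  by rewrite (@mconv_coef _ _ _ _ _ _ _ _ _ _ _ _ _ w)//; move=> s; exact: gel_slice.
have := dual_eq_slices eU cA nq a; rewrite nE qE mE lE => E.
rewrite -[LHS]/(Defs.conv Phi (m \o gel) (l \o gel) a) E /= mconvE.
symmetry; apply: sintE => t /=.
by rewrite (@sintE _ _ m _ (trl cX mul_cl (gel a) t)).
Qed.

End EberleinGelfand.

Theorem theorem3p9 (R : realType) :
  [/\ forall (H : hilbert R) (F : fock H) (tau : op_topology)
        (S : set (bop H)) (sgS : subsemigroup S),
      (forall x, S x -> contractive x) ->
      compact (S : set (bop_top tau H)) ->
      ~ S (blin_zero H H) ->
      forall (U : univ_rep (cb_algebra R (sub_top tau S)))
        (T2 : htensor U U) (T : htensor U F),
      exists (Phi : cb_algebra R (sub_top tau S) -> bop T2) (V : bop T),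
        [/\ is_Phi (sub_mul (tau := tau) sgS) idfun Phi,
            is_V idfun (fun s : sub_top tau S => fock_op F (sub_val s)) V &
            is_eberlein Phi V],
      forall (A : cstar_algebra R) (U : univ_rep A) (H : hilbert R)
        (T2 : htensor U U) (T : htensor U H) (Phi : A -> bop T2) (V : bop T),
      is_eberlein Phi V ->
      (exists e : A, is_unit e) ->
      (forall a b : A, cmul a b = cmul b a) ->
      exists (S : set (bop H)) (sgS : subsemigroup S)
        (g : A -> cb_algebra R (sub_top weak_star S)),
        [/\ forall x, S x -> contractive x,
            compact (S : set (bop_top weak_star H)),
            ~ S (blin_zero H H),
            star_iso g &
            is_Phi (sub_mul (tau := weak_star) sgS) g Phi /\
            is_V g (@sub_val R weak_star H S) V] &
      forall (K : hilbert R) (S : set (bop K)),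
      subsemigroup S ->
      (forall x, S x -> contractive x) ->
      compact (S : set (bop_top weak_star K)) ->
      ~ S (blin_zero K K) ->
      forall (U : univ_rep (cb_algebra R (sub_top weak_star S)))
        (T : htensor U K),
      exists V : bop T,
        is_V idfun (@sub_val R weak_star K S) V /\
        (multiplier_compact V <->
         forall O : set (set_type S),
           @open (sub_top weak_star S) O <-> @open (sub_top strong_star S) O)].
Proof.
split.
- move=> H F tau S sgS S1 cS S0 U T2 T.
  exact: (subsemigroup_eberlein sgS S1 cS S0 T2 T).
- move=> A U H T2 T Phi V EV [e eU] cA.
  exists (char_ops V e), (@char_ops_subsemigroup _ _ _ _ _ _ _ _ EV _ eU cA), (gel EV eU cA); split.
  + exact: (char_ops_contractive EV eU).
  + exact: (char_ops_compact EV eU cA).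
  + exact: (char_ops0 EV eU cA).
  + exact: gel_star_iso.
  + split; [exact: gel_is_Phi|exact: gel_is_V].
- move=> K S _ S1 cS _ U T.
  exact: (subsemigroup_multiplier S1 cS T).
Qed.
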